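(* Let $f:\mathbb{R}^N\to\mathbb{R}^N$ be the flux of a one-dimensional system of conservation laws, let $\sigma$ be a Young measure from $\mathbb{R}$ to $\mathbb{R}^N$, and let $u_0$ be a random field on a probability space $(\Omega,\mathcal{F},P)$ with law $\sigma$. For each mesh size $\Delta x>0$ let $u^{\Delta x}(\omega)$ be generated, for every $\omega\in\Omega$, by the one-dimensional numerical scheme described in the context from the approximate initial random field $u_0^{\Delta x}(\omega)$, and let $\nu^{\Delta x}$ be the law of the random field $u^{\Delta x}$. Assume: (a) Uniform boundedness: $\|u^{\Delta x}(\omega)\|_{L^\infty(\mathbb{R}\times\mathbb{R}_+)}\le C$ for all $\omega\in\Omega$, $\Delta x>0$. (b) Weak BV: there exists $1\le r<\infty$ such that (for every $T>0$) $$\lim_{\Delta x\to0}\int_0^T\sum_i\bigl|u^{\Delta x}_{i+1}(\omega,t)-u^{\Delta x}_i(\omega,t)\bigr|^r\Delta x\,dt=0\qquad\forall\,\omega\in\Omega .$$ (c) Entropy consistency: the scheme is entropy stable with respect to an entropy pair $(\eta,q)$, i.e. there exists a numerical entropy flux $Q=Q_{i+1/2}(t)$, consistent with the entropy flux $q$ and locally Lipschitz, such that computed solutions satisfy the discrete entropy inequality $$\frac{d}{dt}\eta(u_i^{\Delta x})+\frac1{\Delta x}\bigl(Q^{\Delta x}_{i+1/2}-Q^{\Delta x}_{i-1/2}\bigr)\le0\qquad\forall\,t>0,\ i\in\mathbb{Z},\ \omega\in\Omega .$$ (d) Consistency with initial data: if $\sigma^{\Delta x}$ is the law of $u_0^{\Delta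 x}$, then $$\lim_{\Delta x\to0}\int_{\mathbb{R}}\psi(x)\langle\sigma^{\Delta x}_x,\mathrm{id}\rangle\,dx=\int_{\mathbb{R}}\psi(x)\langle\sigma_x,\mathrm{id}\rangle\,dx\quad\forall\,\psi\in C_c^1(\mathbb{R}),$$ $$\limsup_{\Delta x\to0}\int_{\mathbb{R}}\psi(x)\langle\sigma_x^{\Delta x},\eta\rangle\,dx\le\int_{\mathbb{R}}\psi(x)\langle\sigma_x,\eta\rangle\,dx\quad\forall\,0\le\psi\in C_c^1(\mathbb{R}).$$ Then the approximate Young measures $\nu^{\Delta x}$ converge weak* (up to a subsequence) as $\Delta x\to0$ to an EMV solution $\nu$ (a Young measure from $\mathbb{R}\times\mathbb{R}_+$ to $\mathbb{R}^N$) of the measure-valued Cauchy problem $\partial_t\langle\nu,\mathrm{id}\rangle+\partial_x\langle\nu,f\rangle=0$, $\nu_{(x,0)}=\sigma_x$.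
   Context: Notation: $\mathbb{R}_+=[0,\infty)$; $\mathrm{id}(\xi)=\xi$. An entropy pair is $(\eta,q)$ with $\eta:\mathbb{R}^N\to\mathbb{R}$ convex, $q:\mathbb{R}^N\to\mathbb{R}$, $q'=\eta'\cdot f'$. A Young measure from a set $D\subset\mathbb{R}^k$ to $\mathbb{R}^N$ is a map $z\mapsto\nu_z$ from $D$ to the Borel probability measures on $\mathbb{R}^N$ with $z\mapsto\langle\nu_z,g\rangle:=\int g\,d\nu_z$ Borel measurable for all $g\in C_0(\mathbb{R}^N)$. Weak* convergence $\nu^n\rightharpoonup\nu$: $\int_D\phi(z)\langle\nu^n_z,g\rangle dz\to\int_D\phi(z)\langle\nu_z,g\rangle dz$ for all $\phi\in L^1(D)$, $g\in C_0(\mathbb{R}^N)$. A random field is a jointly measurable map $u:\Omega\times D\to\mathbb{R}^N$; its law is the Young measure $\nu_z(F)=P(u(\cdot,z)\in F)$, $F\subset\mathbb{R}^N$ Borel. Scheme: cells $\mathcal{C}_i=[x_{i-1/2},x_{i+1/2})$, $i\in\mathbb{Z}$, of uniform size $\Delta x$ with midpoints $x_i$. $u_i^{\Delta x}(t)$ solves $$\frac{d}{dt}u_i^{\Delta x}(t)+\frac1{\Delta x}\bigl(F_{i+1/2}(t)-F_{i-1/2}(t)\bigr)=0\ (t>0),\qquad u_i^{\Delta x}(0)=u_0^{\Delta x}(x_i),$$ with exact time integration: $u_i^{\Delta x}(t+\Delta t)=u_i^{\Delta x}(t)-\frac1{\Delta x}\int_t^{t+\Delta t}(F_{i+1/2}-F_{i-1/2})(\tau)d\tau$.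 Here $u_0^{\Delta x}$ is an approximation to the initial data $u_0$, regarded as constant on each cell, and $u^{\Delta x}(\omega;x,t):=u_i^{\Delta x}(\omega,t)$ for $x\in\mathcal{C}_i$. The numerical flux $F_{i+1/2}(t)$ is a function of $u_j(t)$, $j=i-p+1,\dots,i+p$, for some $p\in\mathbb{N}$, assumed consistent with $f$ and locally Lipschitz: for every compact $K\subset\mathbb{R}^N$ there is $C>0$ with $|F_{i+1/2}(t)-f(u_i(t))|\le C\sum_{j=i-p+1}^{i+p}|u_j(t)-u_i(t)|$ whenever $u_j(t)\in K$ for those $j$. Consistency of $Q_{i+1/2}$ with $q$ and its local Lipschitz continuity are meant in the same sense. A Young measure $\nu$ from $\mathbb{R}\times\mathbb{R}_+$ to $\mathbb{R}^N$ is an EMV (entropy measure-valued) solution with initial data $\sigma$ if for all $\varphi\in C_c^1(\mathbb{R}\times\mathbb{R}_+)$ $$\int_{\mathbb{R}_+}\int_{\mathbb{R}}\partial_t\varphi\langle\nu_{(x,t)},\mathrm{id}\rangle+\partial_x\varphi\,\langle\nu_{(x,t)},f\rangle\,dxdt+\int_{\mathbb{R}}\varphi(x,0)\langle\sigma_x,\mathrm{id}\rangle dx=0,$$ and, for every entropy pair $(\eta,q)$ and all $0\le\varphi\in C_c^1(\mathbb{R}\times\mathbb{R}_+)$, $$\int_{\mathbb{R}_+}\int_{\mathbb{R}}\partial_t\varphi\langle\nu_{(x,t)},\eta\rangle+\partial_x\varphi\,\langle\nu_{(x,t)},q\rangle\,dxdt+\int_{\mathbb{R}}\varphi(x,0)\langle\sigma_x,\eta\rangle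 dx\ge0 .$$
   Formalization: Entropy consistency (c) and the entropy part of (d) are assumed for every pair in a chosen class of entropy pairs, and the EMV entropy inequality is concluded for that class; stability for one pair alone does not give it for all pairs (e.g. a Burgers expansion shock with η = q = 0). *)

(* Defs.v *)
From HB Require Import structures.
From mathcomp Require Import all_boot all_order all_algebra.
From mathcomp Require Import all_classical all_reals all_analysis.
From mathcomp Require Import measurable_realfun.

Set Implicit Arguments.
Unset Strict Implicit.
Unset Printing Implicit Defensive.

Import Order.TTheory GRing.Theory Num.Theory.
Import numFieldNormedType.Exports.

Local Open Scope classical_set_scope.
Local Open Scope ring_scope.

(* States are row vectors, normed by the library's max norm.  All norm bounds
   and limits below are insensitive to the choice of norm on R^N. *)
Definition borel_rV (R : realType) (N : nat) :=
  g_sigma_algebraType (@open 'rV[R]_N).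

(* Points of R x R_+ are pairs (x, t). *)
Definition half_plane (R : realType) : set (R * R) := [set z | 0 <= z.2].
Arguments half_plane : clear implicits.

Definition lebesgue2 (R : realType) :=
  ((@lebesgue_measure R) \x (@lebesgue_measure R))%E.
Arguments lebesgue2 : clear implicits.

Section test_functions.
Context {R : realType}.

Definition C0 N (g : 'rV[R]_N -> R) :=
  continuous g /\
  forall e, 0 < e -> exists M : R, forall y, M < `|y| -> `|g y| < e.

(* For V = R * R these are the functions whose restrictions to the closed
   half plane make up C_c^1(R x R_+); they need not vanish at t = 0. *)
Definition C1c (V : normedModType R) (phi : V -> R) :=
  [/\ forall z, differentiable phi z,
      forall v, continuous (fun z => 'D_v phi z) &
      compact (closure [set z | phi z != 0])].

Definition Dx (phi : R * R -> R) (z : R * R) : R := derive phi z (1, 0).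
Definition Dt (phi : R * R -> R) (z : R * R) : R := derive phi z (0, 1).

End test_functions.

Section young_measures.
Context {R : realType} {N : nat}.

(* Extended-real valued, so that no default value stands for the integral of a
   function that is not integrable. *)
Definition pairing (nu : probability (borel_rV R N) R) (g : 'rV[R]_N -> R)
  : \bar R := (\int[nu]_y (g y)%:E)%E.

Definition rV_coord (k : 'I_N) (y : 'rV[R]_N) : R := y ord0 k.

Context {d : measure_display} {T : measurableType d}.

Definition young_measure (D : set T) (nu : T -> probability (borel_rV R N) R) :=
  forall g, C0 g -> measurable_fun D ((fun z => pairing (nu z) g) : T -> \bar R).

Definition weak_star_cvg (mu : {measure set T -> \bar R}) (D : set T)
    (nun : nat -> T -> probability (borel_rV R N) R)
    (nu : T -> probability (borel_rV R N) R) :=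
  forall (phi : T -> R) (g : 'rV[R]_N -> R),
    mu.-integrable D (EFin \o phi) -> C0 g ->
    (fun n => \int[mu]_(z in D) ((phi z)%:E * pairing (nun n z) g))%E @ \oo -->
    (\int[mu]_(z in D) ((phi z)%:E * pairing (nu z) g))%E.

Context {d' : measure_display} {Omega : measurableType d'}.

Definition random_field (D : set T) (u : Omega -> T -> 'rV[R]_N) :=
  measurable_fun ([set: Omega] `*` D)
    ((fun p => u p.1 p.2) : Omega * T -> borel_rV R N).

Definition law_of (P : probability Omega R) (D : set T)
    (u : Omega -> T -> 'rV[R]_N) (nu : T -> probability (borel_rV R N) R) :=
  forall z, D z -> forall F : set (borel_rV R N), measurable F ->
    nu z F = P [set w | F (u w z)].

End young_measures.

Section emv_solutions.
Context {R : realType} {N : nat}.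
Local Notation V := 'rV[R]_N.

Definition entropy_pairs (f : V -> V) : set ((V -> R) * (V -> R)) :=
  [set e | [/\ convex_function [set: V] e.1,
    forall y, differentiable e.1 y,
    forall y, differentiable e.2 y &
    forall y v, 'd (e.2) y v = 'd (e.1) y ('d f y v)]].

Definition mv_solution (f : V -> V) (sigma : R -> probability (borel_rV R N) R)
    (nu : R * R -> probability (borel_rV R N) R) :=
  forall (phi : R * R -> R) (k : 'I_N), C1c phi ->
    (\int[lebesgue2 R]_(z in half_plane R)
        ((Dt phi z)%:E * pairing (nu z) (rV_coord k)
         + (Dx phi z)%:E * pairing (nu z) (fun y => rV_coord k (f y)))
     + \int[lebesgue_measure]_x
        ((phi (x, 0%R))%:E * pairing (sigma x) (rV_coord k)) = 0)%E.

(* E is the class of entropy pairs for which the entropy inequality is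
   required; the notion quantified over every entropy pair is
   E = entropy_pairs f. *)
Definition emv_solution (E : set ((V -> R) * (V -> R))) (f : V -> V)
    (sigma : R -> probability (borel_rV R N) R)
    (nu : R * R -> probability (borel_rV R N) R) :=
  mv_solution f sigma nu /\
  forall eta q, E (eta, q) ->
  forall phi : R * R -> R, C1c phi -> (forall z, half_plane R z -> 0 <= phi z) ->
    (0 <= \int[lebesgue2 R]_(z in half_plane R)
            ((Dt phi z)%:E * pairing (nu z) eta
             + (Dx phi z)%:E * pairing (nu z) q)
          + \int[lebesgue_measure]_x
            ((phi (x, 0%R))%:E * pairing (sigma x) eta))%E.

End emv_solutions.

Section scheme.
Context {R : realType} {N : nat}.
Local Notation V := 'rV[R]_N.

(* Uniform grid of mesh size dx; a is the midpoint of cell 0. *)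
Definition midpoint (dx a : R) (i : int) : R := a + i%:~R * dx.

Definition cell (dx a : R) (i : int) : set R :=
  [set x | midpoint dx a i - dx / 2 <= x < midpoint dx a i + dx / 2].

Definition cell_index (dx a x : R) : int := Num.floor ((x - a) / dx + 2^-1).

Lemma cell_indexP (dx a x : R) (i : int) :
  0 < dx -> cell dx a i x <-> cell_index dx a x = i.
Proof.
move=> dx0; rewrite /cell /cell_index /midpoint /=.
have {1 2}-> : x = a + (x - a) / dx * dx.
  by rewrite divfK ?gt_eqF// addrC subrK.
set y := (x - a) / dx.
have -> : (a + i%:~R * dx - dx / 2 <= a + y * dx) = (i%:~R <= y + 2^-1).
  rewrite -addrA lerD2l [dx / 2]mulrC -mulrBl ler_pM2r//.
  by rewrite lerBlDr.
have -> : (a + y * dx < a + i%:~R * dx + dx / 2) = (y + 2^-1 < (i + 1)%:~R).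
  rewrite -addrA ltrD2l [dx / 2]mulrC -mulrDl ltr_pM2r// intrD.
  rewrite -ltrBrDr -addrA.
  suff -> : 1%:~R - 2^-1 = 2^-1 :> R by [].
  by rewrite mulr1z {1}(splitr 1) mul1r addrK.
split; first by move=> /floor_def.
by move=> <-; rewrite floor_le floorD1_gt.
Qed.

Definition cell_field (dx a : R) (u : int -> R -> V) (z : R * R) : V :=
  u (cell_index dx a z.1) z.2.

(* The values v_j, j = i-p+1, ..., i+p. *)
Definition stencil (p : nat) (v : int -> V) (i : int) : 'I_(2 * p) -> V :=
  fun l => v (i - p%:Z + 1 + (l : nat)%:Z).
Arguments stencil : clear implicits.

(* G dx i is the flux function at the interface i+1/2; it may depend on the
   mesh size and on the interface, the Lipschitz constant may not. *)
Definition consistent_flux (W : normedModType R) (p : nat) (g : V -> W)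
    (G : R -> int -> ('I_(2 * p) -> V) -> W) :=
  [/\ (0 < p)%N,
      forall (dx : R) (i : int) (y : V), 0 < dx -> G dx i (fun=> y) = g y &
      forall K : set V, compact K -> exists2 C : R, 0 < C &
        forall (dx : R) (i : int) (v : int -> V), 0 < dx ->
          (forall l, K (stencil p v i l)) ->
          `|G dx i (stencil p v i) - g (v i)|
            <= C * \sum_(l < 2 * p) `|stencil p v i l - v i|].

(* G_{i+1/2}(t) - G_{i-1/2}(t) along the grid function u. *)
Definition flux_diff (W : normedModType R) (p : nat)
    (G : R -> int -> ('I_(2 * p) -> V) -> W) (dx : R) (u : int -> R -> V)
    (i : int) (t : R) : W :=
  G dx i (stencil p (u^~ t) i) - G dx (i - 1) (stencil p (u^~ t) (i - 1)).

(* The ODE in its time-integrated form, which does not require the numerical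
   flux to be continuous in its arguments. *)
Definition scheme_solution (p : nat) (F : R -> int -> ('I_(2 * p) -> V) -> V)
    (dx a : R) (u0 : R -> V) (u : int -> R -> V) :=
  (forall i, u i 0 = u0 (midpoint dx a i)) /\
  forall i (k : 'I_N) (t h : R), 0 <= t -> 0 <= h ->
    lebesgue_measure.-integrable `[t, t + h]
      (fun s => (rV_coord k (flux_diff F dx u i s))%:E) /\
    rV_coord k (u i (t + h)) = rV_coord k (u i t)
      - dx^-1 * \int[lebesgue_measure]_(s in `[t, t + h])
                   rV_coord k (flux_diff F dx u i s).

(* Grid functions solving the time-integrated scheme are differentiable at
   almost every t only, hence the inequality at the times where the time
   derivative exists. *)
Definition discrete_entropy_inequality (p : nat) (eta : V -> R)
    (Q : R -> int -> ('I_(2 * p) -> V) -> R) (dx : R) (u : int -> R -> V) :=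
  forall (i : int) (t : R), 0 < t -> derivable (eta \o u i) t 1 ->
    derive1 (eta \o u i) t + dx^-1 * flux_diff Q dx u i t <= 0.

End scheme.

(* Main.v *)
Require Import Defs.
From HB Require Import structures.
From mathcomp Require Import all_boot all_order all_algebra.
From mathcomp Require Import all_classical all_reals all_analysis.
From mathcomp Require Import measurable_realfun.
From mathcomp Require Import ring lra.

Set Implicit Arguments.
Unset Strict Implicit.
Unset Printing Implicit Defensive.

Import Order.TTheory GRing.Theory Num.Theory.
Import numFieldNormedType.Exports.

Local Open Scope classical_set_scope.
Local Open Scope ring_scope.


Lemma common_subsequence (R : realType) (M : nat -> R) (a : nat -> nat -> R) :
  (forall j n, `|a j n| <= M j) ->
  exists2 s : nat -> nat, {homo s : m n / (m < n)%N} &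
    forall j, cvgn (a j \o s).
Proof.
move=> aM.
pose A (j : nat) : set R := `[- M j, M j]%classic.
pose B := [set f : forall j : nat, R | forall j, A j (f j)].
pose PT : topologicalType := prod_topology (fun _ : nat => R).
have cB : @compact PT B.
  by apply: tychonoff => j; exact: segment_compact.
pose x n : PT := fun j => a j n.
have xB : (x @ \oo) B.
  by exists 0%N => // n _ j; rewrite /A/= in_itv/= -ler_norml; exact: aM.
have [L [_ xL]] := cB _ _ xB.
have near_L n : @nbhs PT PT L
    [set f | forall j : 'I_n.+1, `|L j - (f : nat -> R) j| < n.+1%:R^-1].
  apply: (@filter_forall PT _ (fun j : 'I_n.+1 =>
    [set f | `|L j - (f : nat -> R) j| < n.+1%:R^-1]) (@nbhs PT PT L)) => j.
  have := @proj_continuous _ (fun _ : nat => R) (j : nat) L.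
  move=> /(_ (ball (L j) n.+1%:R^-1)).
  by move=> h; apply: h; apply: nbhsx_ballx; rewrite invr_gt0 ltr0n.
have pick n m : {k | (m <= k)%N /\
    forall j : 'I_n.+1, `|L j - a j k| < n.+1%:R^-1}.
  apply: cid.
  have FA : (x @ \oo) (x @` [set k | (m <= k)%N]).
    by exists m => // k mk; exists k.
  have [_ [[k mk <-] h]] := xL _ _ FA (near_L n).
  by exists k.
pose s := fix s n := if n is n'.+1 then sval (pick n (s n').+1)
                     else sval (pick 0 0)%N.
exists s.
  apply: homo_ltn; first exact: ltn_trans.
  by move=> n; have [] := svalP (pick n.+1 (s n).+1).
move=> j; apply/cvg_ex; exists (L j); apply/cvgrPdist_lt => e e0.
have [N _ hN] := near_infty_natSinv_lt (PosNum e0).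
exists (maxn j N) => // n /=; rewrite geq_max => /andP[jn Nn].
apply: lt_trans (hN _ Nn).
rewrite -ltnS in jn; case: n jn {Nn} => [|n] jn.
- by have [_ /(_ (Ordinal jn))] := svalP (pick 0 0)%N.
- by have [_ /(_ (Ordinal jn))] := svalP (pick n.+1 (s n).+1).
Qed.

Section real_integrals.
Context d (T : measurableType d) (R : realType).
Variables (mu : {measure set T -> \bar R}) (D : set T) (mD : measurable D).

Lemma integrable_leR (f g : T -> R) : measurable_fun D f ->
  mu.-integrable D (EFin \o g) -> (forall x, D x -> `|f x| <= g x) ->
  mu.-integrable D (EFin \o f).
Proof.
move=> mf ig fg; apply: (le_integrable mD _ _ ig); first exact/measurable_EFinP.
by move=> x Dx /=; rewrite lee_fin (le_trans (fg x Dx))// ler_norm.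
Qed.

Lemma norm_Rintegral_le (f g : T -> R) : measurable_fun D f ->
  mu.-integrable D (EFin \o g) -> (forall x, D x -> `|f x| <= g x) ->
  `|\int[mu]_(x in D) f x| <= \int[mu]_(x in D) g x.
Proof.
move=> mf ig fg; have if_ := integrable_leR mf ig fg.
apply: le_trans (le_normr_Rintegral mD if_) _.
apply: le_Rintegral => //.
exact: integrable_norm.
Qed.

Lemma Rdominated_cvg (f_ : nat -> T -> R) (f g : T -> R) :
  (forall n, measurable_fun D (f_ n)) -> measurable_fun D f ->
  {ae mu, forall x, D x -> f_ ^~ x @ \oo --> f x} ->
  mu.-integrable D (EFin \o g) ->
  (forall n x, D x -> `|f_ n x| <= g x) ->
  mu.-integrable D (EFin \o f) /\
  (fun n => \int[mu]_(x in D) f_ n x) @ \oo --> \int[mu]_(x in D) f x.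
Proof.
move=> mf_ mf f_f ig fg.
have [] := @dominated_convergence _ _ _ mu D mD (fun n => EFin \o f_ n)
  (EFin \o f) (EFin \o g).
- by move=> n; exact/measurable_EFinP.
- exact/measurable_EFinP.
- by apply: filterS f_f => x h Dx; apply/fine_cvgP; split; [exact: nearW|exact: h].
- exact: ig.
- by apply: aeW => x n Dx; rewrite /= lee_fin; exact: fg.
move=> i _ c; split => //.
have := c; rewrite -[X in _ --> X -> _]fineK; last exact: integrable_fin_num.
by move=> /fine_cvgP[].
Qed.

Lemma ae_le_integral (f g : T -> R) :
  mu.-integrable D (EFin \o f) -> mu.-integrable D (EFin \o g) ->
  (forall A, measurable A -> A `<=` D ->
    \int[mu]_(x in A) f x <= \int[mu]_(x in A) g x) ->
  {ae mu, forall x, D x -> f x <= g x}.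
Proof.
move=> intf intg fg.
have mf : measurable_fun D f by apply/measurable_EFinP; exact: measurable_int intf.
have mg : measurable_fun D g by apply/measurable_EFinP; exact: measurable_int intg.
pose A := D `&` (fun x => g x < f x) @^-1` [set true].
have mA : measurable A by apply: measurable_fun_ltr.
have AD : A `<=` D by move=> x [].
have fA : mu.-integrable A (EFin \o f) by exact: integrableS intf.
have gA : mu.-integrable A (EFin \o g) by exact: integrableS intg.
pose h x := f x - g x.
have mB : measurable_fun A (EFin \o h).
  by apply/measurable_EFinP/measurable_funB; exact: measurable_funS AD _.
have iB : mu.-integrable A (EFin \o h).
  have -> : EFin \o h = ((EFin \o f) \- (EFin \o g))%E by [].
  exact: integrableB.
have h0 x : A x -> 0 <= h x by move=> [_ /= gf]; rewrite subr_ge0 ltW.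
have : (\int[mu]_(x in A) `|(EFin \o h) x| = 0)%E.
  transitivity (\int[mu]_(x in A) (EFin \o h) x)%E.
    by apply: eq_integral => x; rewrite inE => /h0 hx; rewrite /= ger0_norm.
  rewrite -[LHS]fineK; last exact: integrable_fin_num.
  congr EFin; apply/eqP; rewrite eq_le; apply/andP; split.
    have := RintegralB mA fA gA; rewrite /Rintegral /h /= => ->.
    by rewrite subr_le0; exact: fg.
  by apply: fine_ge0; apply: integral_ge0 => x /h0 hx; rewrite lee_fin.
move=> /(ae_eq_integral_abs mu mA mB); apply: filterS => x hx Dx.
rewrite leNgt; apply/negP => gf.
have /hx/= : A x by [].
by case=> /eqP; rewrite subr_eq0 gt_eqF.
Qed.

End real_integrals.

Lemma cvgn_uniform_approx (R : realType) (b : nat -> R) :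
  (forall e, 0 < e -> exists2 c : nat -> R, cvgn c &
     forall n, `|b n - c n| <= e) -> cvgn b.
Proof.
move=> h; apply/cauchy_cvgP/cauchy_exP => e e0.
have [c cc bc] := h _ (divr_gt0 e0 (ltr0n _ 2)).
exists (limn c); move/cvgrPdist_lt : cc => /(_ _ (divr_gt0 e0 (ltr0n _ 2))).
apply: filterS => n cn; rewrite /ball/= (splitr e).
rewrite -(subrKA (c n)) (le_lt_trans (ler_normD _ _))//.
by rewrite ltr_leD// distrC.
Qed.

Lemma tail_Rintegral_cvg0 d (T : measurableType d) (R : realType)
    (mu : {measure set T -> \bar R}) (rho : T -> R) (F : nat -> set T) :
  mu.-integrable setT (EFin \o rho) -> (forall n, measurable (F n)) ->
  (fun m => \int[mu]_(x in \bigcup_k F k `\` \bigcup_(k < m) F k) rho x)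
    @ \oo --> (0 : R).
Proof.
move=> irho mF.
pose A m := \bigcup_k F k `\` \bigcup_(k < m) F k.
have mA m : measurable (A m).
  by apply: measurableD; [exact: bigcup_measurable|exact: bigcup_measurable].
under eq_fun do rewrite Rintegral_mkcond.
have mrho : measurable_fun setT rho.
  by apply/measurable_EFinP; exact: measurable_int irho.
have [] := @Rdominated_cvg _ _ _ mu setT measurableT (fun m => rho \_ (A m))
  (cst 0) (fun x => `|rho x|).
- by move=> n; apply/(measurable_restrictT _ (mA n)); exact: measurable_funTS.
- exact: measurable_cst.
- apply: aeW => x _; have [[k _ Fk]|xU] := pselect ((\bigcup_k F k) x).
    apply: cvg_near_cst; exists k.+1 => // n /= kn.
    by rewrite patchE memNset// => -[_]; apply; exists k.
  by apply: cvg_near_cst; apply: nearW => n; rewrite patchE memNset// => -[].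
- exact: integrable_norm.
- by move=> n x _; rewrite patchE; case: ifP => // _; rewrite normr0.
by move=> _; rewrite [X in _ --> X]Rintegral_cst// mul0r.
Qed.

Lemma cvg_sum_seq (R : realType) (I : Type) (r : seq I) (f : I -> nat -> R)
    (l : I -> R) : (forall i, f i @ \oo --> l i) ->
  (fun N => \sum_(i <- r) f i N) @ \oo --> \sum_(i <- r) l i.
Proof.
move=> fl; elim: r => [|i r IH].
  by under eq_fun do rewrite big_nil; rewrite big_nil; exact: cvg_cst.
by under eq_fun do rewrite big_cons; rewrite big_cons; exact: cvgD.
Qed.

Section weak_star_compactness.
Import HBNNSimple.
Context d (T : measurableType d) (R : realType).
Variable mu : {sigma_finite_measure set T -> \bar R}.
Variables (rho : T -> R) (rho_gt0 : forall x, 0 < rho x).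
Hypothesis irho : mu.-integrable setT (EFin \o rho).
Variables (h : nat -> T -> R) (mh : forall n, measurable_fun setT (h n)).
Hypothesis h01 : forall n x, 0 <= h n x <= 1.

Let mrho : measurable_fun setT rho.
Proof. by apply/measurable_EFinP; exact: measurable_int irho. Qed.

Let iM (phi g : T -> R) : mu.-integrable setT (EFin \o phi) ->
  measurable_fun setT g -> (forall x, 0 <= g x <= 1) ->
  mu.-integrable setT (EFin \o (fun x => phi x * g x)).
Proof.
move=> iphi mg g01; apply: (integrable_leR measurableT _ (integrable_norm iphi)).
  by apply: measurable_funM => //; apply/measurable_EFinP; exact: measurable_int iphi.
move=> x _ /=; have /andP[g0 g1] := g01 x.
by rewrite normrM (ger0_norm g0) ler_piMr.
Qed.

Let irh n A : measurable A ->
  mu.-integrable A (EFin \o (fun x => rho x * h n x)).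
Proof. by move=> mA; apply: integrableS (iM irho _ (h01 n)). Qed.

Let I A n := \int[mu]_(x in A) (rho x * h n x).

Let I_ge0 A n : 0 <= I A n.
Proof.
apply: Rintegral_ge0 => x _; have /andP[? _] := h01 n x.
by rewrite mulr_ge0 // ltW.
Qed.

Let I_le A n : measurable A -> I A n <= \int[mu]_(x in A) rho x.
Proof.
move=> mA; apply: le_Rintegral => //; first exact: irh.
  exact: integrableS irho.
by move=> x _; have /andP[? ?] := h01 n x; rewrite ler_piMr// ltW.
Qed.

Let ID A B n : measurable A -> measurable B -> [disjoint A & B] ->
  I (A `|` B) n = I A n + I B n.
Proof. by move=> mA mB AB; rewrite /I Rintegral_setU//; apply: irh; exact: measurableU. Qed.

Let IDset A B n : measurable A -> measurable B -> B `<=` A ->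
  I A n = I B n + I (A `\` B) n.
Proof.
move=> mA mB BA; rewrite -{1}(setDUK BA) ID//; first exact: measurableD.
by apply/disj_setPS => x [? []].
Qed.

Let bigcup_split (F : nat -> set T) m : \bigcup_(k < m) F k `<=` \bigcup_k F k.
Proof. by move=> x [k _ Fk]; exists k. Qed.

Let I_bigcup (F : nat -> set T) m n : (forall k, measurable (F k)) ->
  trivIset setT F -> I (\bigcup_(k < m) F k) n = \sum_(k < m) I (F k) n.
Proof.
move=> mF tF; elim: m => [|m IH].
  by rewrite bigcup_mkord !big_ord0 /I Rintegral_set0.
rewrite bigcup_mkord big_ord_recr -bigcup_mkord/= ID//.
- by rewrite IH big_ord_recr.
- exact: bigcup_measurable.
- apply/disj_setPS => x [[k /= km Fk] Fm].
  have := tF k m Logic.I Logic.I => /(_ (ex_intro _ x (conj Fk Fm))) km'.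
  by rewrite km' ltnn in km.
Qed.

Lemma dynkin_cvg_integrals (G : nat -> set T) :
  @measurable _ T = <<s range G>> -> setI_closed (range G) ->
  cvgn (I setT) -> (forall j, cvgn (I (G j))) ->
  forall A, measurable A -> cvgn (I A).
Proof.
move=> GE GI cT cG A; rewrite GE.
apply: (@dynkin_induction _ T (range G) [set A | cvgn (I A)] GE GI cT).
- by move=> _ [j _ <-]; exact: cG.
- move=> S mS /= cS.
  have -> : I (~` S) = (fun n => I setT n - I S n).
    apply/funext => n; rewrite (@IDset setT S)//.
    by rewrite addrC addKr setTD.
  exact: (is_cvgB cT cS).
- move=> F mF tF cF /=; apply: cvgn_uniform_approx => e e0.
  have /cvgrPdist_le/(_ _ e0)[m _ /(_ _ (leqnn m)) hm] := tail_Rintegral_cvg0 irho mF.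
  have mU : measurable (\bigcup_k F k) by exact: bigcup_measurable.
  have mUm : measurable (\bigcup_(k < m) F k) by exact: bigcup_measurable.
  exists (fun n => \sum_(k < m) I (F k) n).
    apply/cvg_ex; eexists; apply: cvg_sum_seq => k; exact: cF.
  move=> n; rewrite -I_bigcup// (@IDset (\bigcup_k F k) (\bigcup_(k < m) F k))//.
  rewrite addrC addKr ger0_norm//.
  apply: le_trans (I_le _ _) _; first exact: measurableD.
  by apply: le_trans hm; rewrite sub0r normrN ler_norm.
Qed.

Lemma density_of_limit :
  (forall A, measurable A -> cvgn (I A)) ->
  exists H : T -> R, [/\ measurable_fun setT H, forall x, 0 <= H x <= 1 &
    forall A, measurable A -> I A @ \oo --> \int[mu]_(x in A) (rho x * H x)].
Proof.
move=> cI.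
pose lam (A : set T) : \bar R := (limn (I A))%:E.
have limI_le A : measurable A -> 0 <= limn (I A) <= \int[mu]_(x in A) rho x.
  move=> mA; apply/andP; split.
    by apply: limr_ge; [exact: cI|exact: nearW].
  by apply: limr_le; [exact: cI|apply: nearW => n; exact: I_le].
have l0 : lam set0 = 0%E.
  rewrite /lam (_ : I set0 = cst 0) ?lim_cst//.
  by apply/funext => n; rewrite /I Rintegral_set0.
have lfin A : measurable A -> lam A \is a fin_num by [].
have lsa : semi_sigma_additive lam.
  move=> F mF tF mU.
  have -> : (fun n => \sum_(0 <= i < n) lam (F i))%E =
            EFin \o (fun n => \sum_(0 <= i < n) limn (I (F i))).
    by apply/funext => n /=; rewrite sumEFin.
  apply: cvg_EFin; first exact: nearW.
  apply/cvgrPdist_le => e e0.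
  have /cvgrPdist_le/(_ _ e0)[m _ hm] := tail_Rintegral_cvg0 irho mF.
  exists m => // n mn /=.
  have mUn : measurable (\bigcup_(k < n) F k) by exact: bigcup_measurable.
  have mUD : measurable (\bigcup_k F k `\` \bigcup_(k < n) F k) by exact: measurableD.
  have -> : \sum_(0 <= i < n) limn (I (F i)) = limn (I (\bigcup_(k < n) F k)).
    have -> : I (\bigcup_(k < n) F k) = fun N => \sum_(k < n) I (F k) N.
      by apply/funext => N; rewrite I_bigcup.
    rewrite big_mkord; apply/esym/cvg_lim => //.
    by apply: cvg_sum_seq => k; exact: cI.
  have -> : I (\bigcup_k F k) =
      (fun N => I (\bigcup_(k < n) F k) N + I (\bigcup_k F k `\` \bigcup_(k < n) F k) N).
    by apply/funext => N; rewrite -IDset.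
  rewrite limD; [|exact: cI..].
  rewrite addrC addKr; have /andP[l_ge0 l_le] := limI_le _ mUD.
  rewrite ger0_norm//; apply: le_trans l_le _.
  by apply: le_trans (hm n mn); rewrite sub0r normrN ler_norm.
pose lamC : {charge set T -> \bar R} :=
  HB.pack lam (isCharge.Build _ _ _ lam l0 lfin lsa).
have ldom : lamC `<< mu.
  move=> A A0 B mB BA.
  have B0 : mu B = 0%E by exact: A0.
  rewrite /= /lam; congr EFin; apply/eqP; rewrite eq_le.
  have /andP[-> hB] := limI_le _ mB; rewrite andbT (le_trans hB)//.
  rewrite /Rintegral null_set_integral//.
  by apply/measurable_EFinP; exact: measurable_funTS.
pose g x := fine (Radon_Nikodym lamC mu x).
have gE : EFin \o g = Radon_Nikodym lamC mu.
  by apply/funext => x /=; rewrite fineK// Radon_Nikodym_fin_num.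
have ig : mu.-integrable setT (EFin \o g).
  by rewrite gE; exact: Radon_Nikodym_integrable.
have lamE A : measurable A -> limn (I A) = \int[mu]_(x in A) g x.
  move=> mA; rewrite /Rintegral.
  under eq_integral => x _ do rewrite -[(g x)%:E]/((EFin \o g) x) gE.
  by rewrite -(Radon_Nikodym_integral ldom mA).
have mg : measurable_fun setT g.
  by apply/measurable_EFinP; exact: measurable_int ig.
have g0 : {ae mu, forall x, setT x -> 0 <= g x}.
  apply: (ae_le_integral measurableT (f := cst 0)) => //.
    exact: (integrable0 mu).
  move=> A mA _; rewrite Rintegral_cst// mul0r -lamE//.
  by have /andP[] := limI_le _ mA.
have g1 : {ae mu, forall x, setT x -> g x <= rho x}.
  apply: ae_le_integral => // A mA _; rewrite -lamE//.
  by have /andP[] := limI_le _ mA.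
pose H x := Num.min 1 (Num.max 0 (g x * (rho x) `^ (- 1))).
have mH : measurable_fun setT H.
  apply: measurable_minr; first exact: measurable_cst.
  apply: measurable_maxr; first exact: measurable_cst.
  apply: measurable_funM => //.
  by apply: (measurableT_comp (measurable_powR (- 1))).
have H01 x : 0 <= H x <= 1.
  by rewrite /H ge_min lexx/= andbT le_min ler01/= le_max lexx.
exists H; split => // A mA.
have -> : \int[mu]_(x in A) (rho x * H x) = limn (I A); last exact: cI.
rewrite lamE// /Rintegral; congr fine; apply: ae_eq_integral => //.
- apply/measurable_EFinP/measurable_funM; first exact: measurable_funTS.
  exact: measurable_funTS.
- by apply/measurable_EFinP; exact: measurable_funTS.
- apply: filterS2 g0 g1 => x /(_ Logic.I) gx0 /(_ Logic.I) gx1 _ /=.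
  congr EFin; rewrite /H powR_inv1; last exact: ltW.
  rewrite max_r ?divr_ge0 ?(ltW (rho_gt0 x))//.
  rewrite min_r ?ler_pdivrMr ?mul1r//.
  by rewrite mulrC divfK// gt_eqF.
Qed.

(** Linear combinations and limits in mean of the test functions rho 1_A
    exhaust the integrable functions, so convergence against indicators
    suffices. *)
Lemma cvg_weak_star (H : T -> R) : measurable_fun setT H ->
  (forall x, 0 <= H x <= 1) ->
  (forall A, measurable A -> I A @ \oo --> \int[mu]_(x in A) (rho x * H x)) ->
  forall phi, mu.-integrable setT (EFin \o phi) ->
    (fun n => \int[mu]_x (phi x * h n x)) @ \oo --> \int[mu]_x (phi x * H x).
Proof.
move=> mH H01 cI.
pose C (phi : T -> R) := mu.-integrable setT (EFin \o phi) /\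
  (fun n => \int[mu]_x (phi x * h n x)) @ \oo --> \int[mu]_x (phi x * H x).
have CD f g : C f -> C g -> C (fun x => f x + g x).
  move=> [fi fc] [gi gc]; split.
    exact: (integrableD measurableT fi gi).
  have E (k : T -> R) : measurable_fun setT k -> (forall x, 0 <= k x <= 1) ->
      \int[mu]_x ((f x + g x) * k x) =
      \int[mu]_x (f x * k x) + \int[mu]_x (g x * k x).
    move=> mk k01; under eq_Rintegral do rewrite mulrDl.
    by rewrite RintegralD//; exact: iM.
  rewrite E//; under eq_fun do rewrite (E _ (mh _) (h01 _)).
  exact: cvgD.
have CZ f a : C f -> C (fun x => a * f x).
  move=> [fi fc]; split.
    exact: (integrableZl measurableT a fi).
  have E (k : T -> R) : measurable_fun setT k -> (forall x, 0 <= k x <= 1) ->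
      \int[mu]_x (a * f x * k x) = a * \int[mu]_x (f x * k x).
    move=> mk k01; under eq_Rintegral do rewrite -mulrA.
    by rewrite RintegralZl//; exact: iM.
  rewrite E//; under eq_fun do rewrite (E _ (mh _) (h01 _)).
  exact: cvgMl_tmp.
have CA A : measurable A -> C (fun x => rho x * \1_A x).
  move=> mA; split.
    apply: (iM irho); first exact: measurable_indic.
    by move=> x; rewrite indicE; case: (_ \in _); rewrite ?lexx ?ler01.
  have E (k : T -> R) : \int[mu]_x (rho x * \1_A x * k x) = \int[mu]_(x in A) (rho x * k x).
    rewrite [RHS]Rintegral_mkcond; apply: eq_Rintegral => x _.
    by rewrite patchE indicE; case: (_ \in _); rewrite ?mulr1 // mulr0 mul0r.
  rewrite E; under eq_fun do rewrite E; exact: cI.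
have Csum n (f : 'I_n -> T -> R) : (forall i, C (f i)) ->
    C (fun x => \sum_(i < n) f i x).
  elim: n f => [|n IH] f Cf.
    have -> : (fun x => \sum_(i < 0) f i x) = (fun x => 0 * (rho x * \1_(@set0 T) x)).
      by apply/funext => x; rewrite big_ord0 mul0r.
    by apply: CZ; exact: CA.
  have -> : (fun x => \sum_(i < n.+1) f i x) =
      (fun x => \sum_(i < n) f (widen_ord (leqnSn n) i) x + f ord_max x).
    by apply/funext => x; rewrite big_ord_recr.
  by apply: CD; [exact: IH|exact: Cf].
have Clim f : mu.-integrable setT (EFin \o f) ->
    (forall e, 0 < e -> exists2 g, C g & \int[mu]_x `|f x - g x| <= e) -> C f.
  move=> fi hf; split => //; apply/cvgrPdist_le => e e0.
  have [g [gi gc] fg] := hf _ (divr_gt0 e0 (ltr0n _ 3)).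
  have E (k : T -> R) : measurable_fun setT k -> (forall x, 0 <= k x <= 1) ->
      `|\int[mu]_x (f x * k x) - \int[mu]_x (g x * k x)| <= e / 3.
    move=> mk k01; rewrite -RintegralB//; [|exact: iM..].
    apply: le_trans fg; apply: norm_Rintegral_le => //.
    - have [/measurable_EFinP fkm _] := integrableP _ _ _ (iM fi mk k01).
      have [/measurable_EFinP gkm _] := integrableP _ _ _ (iM gi mk k01).
      exact: measurable_funB.
    - apply: integrable_norm.
      exact: (integrableB measurableT fi gi).
    - move=> x _; rewrite -mulrBl normrM ler_piMr//.
      by have /andP[k0 k1] := k01 x; rewrite ger0_norm.
  move/cvgrPdist_le : gc => /(_ _ (divr_gt0 e0 (ltr0n _ 3))).
  apply: filterS => n gn.
  have := E _ mH H01; have := E _ (mh n) (h01 n).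
  move: gn; rewrite !ler_norml => /andP[? ?] /andP[? ?] /andP[? ?].
  by apply/andP; split; lra.
have Cge0 f : mu.-integrable setT (EFin \o f) -> (forall x, 0 <= f x) -> C f.
  move=> fi f0; apply: Clim => // e e0.
  have mf : measurable_fun setT f.
    by apply/measurable_EFinP; exact: measurable_int fi.
  pose psi x := f x * (rho x) `^ (- 1).
  have psi0 x : (0 <= (psi x)%:E)%E by rewrite lee_fin mulr_ge0// powR_ge0.
  have psiE x : rho x * psi x = f x.
    rewrite /psi powR_inv1; last exact: ltW.
    by rewrite mulrC divfK// gt_eqF.
  have mpsi : measurable_fun setT (EFin \o psi).
    apply/measurable_EFinP/measurable_funM => //.
    by apply: (measurableT_comp (measurable_powR (- 1))).
  pose g := nnsfun_approx measurableT mpsi.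
  have gpsi n x : 0 <= g n x <= psi x.
    rewrite fun_ge0/= -lee_fin /g nnsfun_approxE.
    by apply: le_approx => // y _; exact: psi0.
  have : (fun n => \int[mu]_x `|f x - rho x * g n x|) @ \oo --> (0 : R).
    have [] := @Rdominated_cvg _ _ _ mu setT measurableT
      (fun n x => `|f x - rho x * g n x|) (cst 0) f.
    - move=> n; apply: measurableT_comp => //; apply: measurable_funB => //.
      by apply: measurable_funM; [exact: mrho|exact: measurable_funP].
    - exact: measurable_cst.
    - apply: aeW => x _.
      have /fine_cvgP[_ gx] := cvg_nnsfun_approx measurableT mpsi (fun x _ => psi0 x) (Logic.I : setT x).
      rewrite -[X in _ --> X](_ : `|f x - rho x * psi x| = 0); last first.
        by rewrite psiE subrr normr0.
      apply: cvg_norm; apply: cvgB; first exact: cvg_cst.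
      by apply: cvgMl_tmp; exact: gx.
    - exact: fi.
    - move=> n x _; rewrite normr_id -psiE -mulrBr normrM gtr0_norm//.
      have /andP[g0 g1] := gpsi n x.
      rewrite ler_pM2l// ger0_norm ?subr_ge0//.
      by rewrite lerBlDr lerDl.
    by rewrite Rintegral_cst// mul0r.
  move=> /cvgrPdist_le/(_ _ e0)[n _ /(_ n (leqnn n))] hn.
  exists (fun x => rho x * g n x).
    have [m [v gE]] : exists m (v : nat -> R), forall x,
        g n x = \sum_(i < m) (v i * \1_(g n @^-1` [set v i]) x).
      by eexists; eexists; exact: fimfunEord.
    have -> : (fun x => rho x * g n x) = (fun x =>
        \sum_(i < m) (v i * (rho x * \1_(g n @^-1` [set v i]) x))).
      apply/funext => x; rewrite gE big_distrr/=.
      by apply: eq_bigr => i _; rewrite mulrCA.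
    apply: Csum => i; apply: CZ; apply: CA.
    by rewrite -[X in measurable X]setTI; exact: measurable_funP.
  by apply: le_trans hn; rewrite sub0r normrN ler_norm.
move=> phi iphi.
have mphi : measurable_fun setT phi.
  by apply/measurable_EFinP; exact: measurable_int iphi.
have -> : phi = (fun x => (phi^\+ x) + (-1) * (phi^\- x))%R.
  by apply/funext => x; rewrite mulN1r -[LHS](congr1 (@^~ x) (funrposBneg phi)).
have iN : mu.-integrable setT (EFin \o phi^\-).
  apply: (integrable_leR measurableT _ (integrable_norm iphi)) => //.
    exact: measurable_funrneg.
  move=> x _ /=; rewrite /funrneg ger0_norm ?le_max ?lexx ?orbT//.
  by rewrite ge_max normr_ge0 andbT -normrN ler_norm.
have iP : mu.-integrable setT (EFin \o phi^\+).
  apply: (integrable_leR measurableT _ (integrable_norm iphi)) => //.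
    exact: measurable_funrpos.
  move=> x _ /=; rewrite /funrpos ger0_norm ?le_max ?lexx ?orbT//.
  by rewrite ge_max normr_ge0 andbT ler_norm.
apply: (CD _ _ _ _).2; first by apply: Cge0.
by apply: CZ; apply: Cge0.
Qed.

End weak_star_compactness.

Lemma weak_star_subsequence d (T : measurableType d) (R : realType)
    (mu : {sigma_finite_measure set T -> \bar R}) (rho : T -> R)
    (G : nat -> set T) (h : nat -> nat -> T -> R) :
  (forall x, 0 < rho x) -> mu.-integrable setT (EFin \o rho) ->
  @measurable _ T = <<s range G>> -> setI_closed (range G) ->
  (forall c n, measurable_fun setT (h c n)) ->
  (forall c n x, 0 <= h c n x <= 1) ->
  exists (s : nat -> nat) (H : nat -> T -> R),
    [/\ {homo s : m n / (m < n)%N}, forall c, measurable_fun setT (H c),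
        forall c x, 0 <= H c x <= 1 &
        forall c phi, mu.-integrable setT (EFin \o phi) ->
          (fun n => \int[mu]_x (phi x * h c (s n) x)) @ \oo -->
          \int[mu]_x (phi x * H c x)].
Proof.
move=> rho0 irho GE GI mh h01.
have mG j : measurable (G j) by rewrite GE; apply: sub_gen_smallest; exists j.
pose I c A n := \int[mu]_(x in A) (rho x * h c n x).
pose a (i : nat) n : R := if unpickle i is Some (c, o)
  then I c (if o is Some j then G j else setT) n else 0.
have mrho : measurable_fun setT rho.
  by apply/measurable_EFinP; exact: measurable_int irho.
have I_le c A n : measurable A -> `|I c A n| <= \int[mu]_x rho x.
  move=> mA; rewrite /I Rintegral_mkcond.
  apply: norm_Rintegral_le => //.
    apply/(measurable_restrictT _ mA)/measurable_funTS.
    by apply: measurable_funM.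
  move=> x _; rewrite patchE; case: ifP => _; last by rewrite normr0 ltW.
  have /andP[h0 h1] := h01 c n x.
  by rewrite normrM gtr0_norm// ger0_norm// ler_piMr// ltW.
have [|s s_homo cs] := @common_subsequence R (cst (\int[mu]_x rho x)) a.
  move=> i n; rewrite /a; case: unpickle => [[c [j|]]|]; try exact: I_le.
  by rewrite normr0; apply: Rintegral_ge0 => x _; exact: ltW.
have cI c A : measurable A -> cvgn (fun n => I c A (s n)).
  move=> mA; apply: (dynkin_cvg_integrals rho0 irho (fun n => mh c (s n)) (fun n => h01 c (s n)) GE GI) => //.
  - have := cs (pickle (c, @None nat)); rewrite /a pickleK; exact.
  - by move=> j; have := cs (pickle (c, Some j)); rewrite /a pickleK; exact.
have Hc c := density_of_limit rho0 irho (fun n => mh c (s n)) (fun n => h01 c (s n)) (cI c).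
pose H c := projT1 (cid (Hc c)).
exists s, H; split => //.
- by move=> c; rewrite /H; case: cid => ? [].
- by move=> c; rewrite /H; case: cid => ? [].
- move=> c phi iphi; rewrite /H; case: cid => K [mK K01 cK] /=.
  exact: (cvg_weak_star rho0 irho (fun n => mh c (s n)) (fun n => h01 c (s n))).
Qed.

Section plane.
Context {R : realType}.
Local Notation RM := (measurableTypeR R).

Let up (o : option rat) : set RM :=
  if o is Some q then [set x | ratr q < x] else setT.

Definition rational_quadrant (n : nat) : set (RM * RM) :=
  if unpickle n is Some (o1, o2) then up o1 `*` up o2 else setT.

Let quadrantE o1 o2 : rational_quadrant (pickle (o1, o2)) = up o1 `*` up o2.
Proof. by rewrite /rational_quadrant pickleK. Qed.

Let mup o : measurable (up o).
Proof.
case: o => [q|]//=.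
rewrite (_ : [set x | _] = `]ratr q, +oo[%classic)//.
by apply/seteqP; split => x /=; rewrite in_itv/= andbT.
Qed.

Let upI o1 o2 : exists o, up o1 `&` up o2 = up o.
Proof.
case: o1 => [q1|]; last by exists o2; rewrite setTI.
case: o2 => [q2|]; last by exists (Some q1); rewrite setIT.
exists (Some (Num.max q1 q2)) => /=; apply/seteqP; split => x /=.
  by case: (leP q1 q2) => _ [].
move=> h; split; apply: le_lt_trans h; rewrite ler_rat.
  by case: (leP q1 q2).
by case: (leP q1 q2) => // /ltW.
Qed.

Lemma rational_quadrant_setI_closed : setI_closed (range rational_quadrant).
Proof.
have rE n : exists o1 o2, rational_quadrant n = up o1 `*` up o2.
  rewrite /rational_quadrant; case: unpickle => [[] o1 o2|]; first by exists o1, o2.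
  by exists None, None; rewrite -setXTT.
move=> _ _ [m _ <-] [n _ <-].
have [a1 [a2 ->]] := rE m; have [b1 [b2 ->]] := rE n.
have [c1 E1] := upI a1 b1; have [c2 E2] := upI a2 b2.
exists (pickle (c1, c2)) => //; rewrite quadrantE -E1 -E2.
by apply/seteqP; split => -[x y] /= [] [? ?] [? ?].
Qed.

Lemma measurable_rational_quadrant :
  @measurable _ (RM * RM)%type = <<s range rational_quadrant>>.
Proof.
apply/seteqP; split; last first.
  apply: smallest_sub; first exact: sigma_algebra_measurable.
  move=> _ [n _ <-]; rewrite /rational_quadrant.
  case: unpickle => [[] o1 o2|]; last exact: measurableT.
  by apply: measurableX; exact: mup.
pose S := g_sigma_algebraType (range rational_quadrant).
have sub o1 o2 : <<s range rational_quadrant>> (up o1 `*` up o2).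
  by apply: sub_gen_smallest; exists (pickle (o1, o2)) => //; exact: quadrantE.
have ray (x : R) : `]x, +oo[%classic = \bigcup_(q : rat)
    (if x <= ratr q then up (Some q) else set0).
  apply/seteqP; split => y /=.
    rewrite in_itv/= andbT => xy; have [q] := rat_in_itvoo xy.
    rewrite in_itv/= => /andP[xq qy]; exists q => //.
    by rewrite (ltW xq).
  move=> [q _]; case: ifP => // xq /= qy.
  by rewrite in_itv/= andbT (le_lt_trans xq).
have m1 : measurable_fun (setT : set S) (fst : S -> RM).
  apply: (measurability _ (RGenOInfty.measurableE R)).
  move=> _ [_ [x ->] <-]; rewrite setTI ray preimage_bigcup.
  apply: bigcupT_measurable_rat => q; case: ifP => _; last by rewrite preimage_set0.
  rewrite (_ : _ @^-1` _ = up (Some q) `*` up None); first exact: sub.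
  by apply/seteqP; split => -[? ?] //= [].
have m2 : measurable_fun (setT : set S) (snd : S -> RM).
  apply: (measurability _ (RGenOInfty.measurableE R)).
  move=> _ [_ [x ->] <-]; rewrite setTI ray preimage_bigcup.
  apply: bigcupT_measurable_rat => q; case: ifP => _; last by rewrite preimage_set0.
  rewrite (_ : _ @^-1` _ = up None `*` up (Some q)); first exact: sub.
  by apply/seteqP; split => -[? ?] //= [].
rewrite measurable_prod_measurableType; apply: smallest_sub.
  exact: smallest_sigma_algebra.
move=> _ [A mA [B mB <-]].
have -> : A `*` B = (fst @^-1` A) `&` (snd @^-1` B) by [].
apply: (@measurableI _ S).
- by rewrite -[X in measurable X]setTI; exact: m1.
- by rewrite -[X in measurable X]setTI; exact: m2.
Qed.

Definition gaussian_weight (z : RM * RM) : R :=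
  normal_pdf 0 1 z.1 * normal_pdf 0 1 z.2.

Lemma gaussian_weight_gt0 z : 0 < gaussian_weight z.
Proof.
have p (x : R) : 0 < normal_pdf 0 1 x.
  rewrite normal_pdfE ?oner_eq0// mulr_gt0 ?expR_gt0//.
  by rewrite normal_peak_gt0// oner_eq0.
exact: mulr_gt0.
Qed.

Lemma integrable_gaussian_weight :
  (lebesgue2 R).-integrable setT (EFin \o gaussian_weight).
Proof.
have mg : measurable_fun setT gaussian_weight.
  apply: measurable_funM.
    by apply: (measurableT_comp (measurable_normal_pdf 0 1)).
  by apply: (measurableT_comp (measurable_normal_pdf 0 1)).
apply/integrable12ltyP; first exact/measurable_EFinP.
rewrite (_ : (\int[_]_x _)%E = (\int[lebesgue_measure]_x (normal_pdf 0 1 x : R)%:E)%E).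
  by rewrite integral_normal_pdf ltry.
apply: eq_integral => x _ /=.
transitivity (\int[lebesgue_measure]_y ((normal_pdf 0 1 x)%:E * (normal_pdf 0 1 y : R)%:E))%E.
  apply: eq_integral => y _.
  by rewrite ger0_norm ?EFinM// mulr_ge0// normal_pdf_ge0.
rewrite integralZl//; last exact: integrable_normal_pdf.
by rewrite integral_normal_pdf mule1.
Qed.

End plane.

Section unit_interval.
Context {R : realType}.
Local Notation RM := (measurableTypeR R).

Let munit : measurable (`[0, 1[%classic : set RM).
Proof. exact: measurable_itv. Qed.

Definition unit_measure : set RM -> \bar R := mrestr (@lebesgue_measure R) munit.

HB.instance Definition _ := Measure.on unit_measure.

Let unit_measureT : unit_measure setT = 1%E.
Proof.
by rewrite /unit_measure/= /mrestr setTI lebesgue_measure_itv/= lte_fin ltr01 oppr0 adde0.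
Qed.

HB.instance Definition _ := Measure_isProbability.Build _ _ _ unit_measure unit_measureT.

End unit_interval.

Section inverse_cdf.
Context {R : realType}.
Local Notation RM := (measurableTypeR R).
Variable m : seq bool -> R.

Fixpoint left_end (c : seq bool) : R :=
  if c is b :: c' then left_end c' + (if b then m (false :: c') else 0) else 0.

Fixpoint digits (s : R) (k : nat) : seq bool :=
  if k is k'.+1 then
    (left_end (digits s k') + m (false :: digits s k') <= s) :: digits s k'
  else [::].

Definition clip (s : R) : R := if 0 <= s < 1 then s else 0.

Lemma size_digits s k : size (digits s k) = k.
Proof. by elim: k => //= k ->. Qed.

Lemma digits_drop s j k : drop j (digits s (j + k)) = digits s k.
Proof. by elim: j => [|j IH] /=; rewrite ?drop0. Qed.

Lemma measurable_digits c k : measurable [set s : RM | digits s k = c].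
Proof.
elim: k c => [|k IH] [|b c] /=.
- by rewrite (_ : mkset _ = setT)//; apply/seteqP; split.
- by rewrite (_ : mkset _ = set0)//; apply/seteqP; split.
- by rewrite (_ : mkset _ = set0)//; apply/seteqP; split.
pose a := left_end c + m (false :: c).
pose B : set RM := if b then `[a, +oo[%classic else `]-oo, a[%classic.
rewrite (_ : mkset _ = [set s | digits s k = c] `&` B).
  by apply: measurableI => //; rewrite /B; case: ifP => _; exact: measurable_itv.
apply/seteqP; split => s /=.
  move=> [E1 E2]; split => //; rewrite /B /a -E1 E2; case: leP => h /=.
    by rewrite in_itv/= h.
  by rewrite in_itv/=.
move=> [E]; rewrite /B E -/a; case: b {B} => /=; rewrite in_itv/= ?andbT.
  by move=> ->.
by rewrite ltNge => /negbTE ->.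
Qed.

Lemma measurable_digits_clip (S : set (seq bool)) k :
  measurable [set s : RM | S (digits (clip s) k)].
Proof.
have mc c : measurable [set s : RM | digits (clip s) k = c].
  pose U : set RM := `[0, 1[%classic.
  have mU : measurable U by exact: measurable_itv.
  have -> : [set s : RM | digits (clip s) k = c] =
      (U `&` [set s : RM | digits s k = c]) `|`
      (~` U `&` (if digits 0 k == c then setT else set0)).
    have UE s : U s = (0 <= s < 1) by rewrite /U/= in_itv.
    apply/seteqP; split => s; rewrite /setU /setI /setC /mkset UE /clip.
      have [h E|h E] := boolP (0 <= s < 1); first by left.
      by right; rewrite E eqxx; split => //; exact/negP.
    have [h|h] := boolP (0 <= s < 1); first by case=> [[]|[]].
    by case=> [[]//|[_]]; case: eqP.
  apply: measurableU; apply: measurableI => //; first exact: measurable_digits.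
    exact: measurableC.
  by case: ifP.
have -> : [set s : RM | S (digits (clip s) k)] =
    \bigcup_(c in S) [set s | digits (clip s) k = c].
  by apply/seteqP; split => s /= => [h|[c Sc ->//]]; exists (digits (clip s) k).
rewrite bigcup_mkcond; apply: countable_bigcupT_measurable => // c.
by case: ifP.
Qed.

Hypotheses (m1 : m [::] = 1) (m_ge0 : forall c, 0 <= m c).
Hypothesis mD : forall c, m (false :: c) + m (true :: c) = m c.

Lemma digits_itv c s : 0 <= s < 1 ->
  (digits s (size c) == c) = (left_end c <= s < left_end c + m c).
Proof.
move=> s01; elim: c => [|b c IH] /=; first by rewrite m1 add0r.
rewrite eqseq_cons.
have [E|/eqP E] := eqVneq (digits s (size c)) c.
  rewrite E andbT; move: IH; rewrite E eqxx => /esym/andP[h1 h2].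
  case: b => /=; last by rewrite addr0 h1/= eqbF_neg -ltNge.
  by rewrite eqb_id -addrA mD h2 andbT.
rewrite andbF; apply/esym/negP => /andP[h1 h2].
apply: E; apply/eqP; rewrite IH.
have := m_ge0 (false :: c); have := m_ge0 (true :: c); have := mD c.
by case: b h1 h2 => h1 h2 *; apply/andP; split; lra.
Qed.

Lemma left_end_itv c : 0 <= left_end c /\ left_end c + m c <= 1.
Proof.
elim: c => [|b c [h1 h2]] /=; first by rewrite m1 add0r lexx.
have := m_ge0 (false :: c); have := m_ge0 (true :: c); have := mD c.
by case: b => *; split; lra.
Qed.

(** The set of s whose digits start with c is an interval of length m c. *)
Lemma unit_measure_digits c :
  unit_measure [set s : RM | digits (clip s) (size c) = c] = (m c)%:E.
Proof.
have [l0 l1] := left_end_itv c.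
rewrite /unit_measure/= /mrestr.
rewrite (_ : _ `&` _ = `[left_end c, left_end c + m c[%classic).
  rewrite lebesgue_measure_itv/= lte_fin ltrDl.
  case: ifPn => [_|]; first by rewrite -EFinD addrC addKr.
  by rewrite -leNgt => h; congr EFin; apply/eqP; rewrite eq_le h m_ge0.
apply/seteqP; split => s /=; rewrite !in_itv/=.
  by move=> [+ s01]; rewrite /clip s01 => /eqP; rewrite digits_itv.
move=> h; have s01 : 0 <= s < 1.
  by case/andP: h => h1 h2; rewrite (le_trans l0 h1) (lt_le_trans h2 l1).
by rewrite /clip s01; split => //; apply/eqP; rewrite digits_itv.
Qed.

Lemma digits_gt0 s k : 0 < m (digits (clip s) k).
Proof.
have c01 : 0 <= clip s < 1 by rewrite /clip; case: ifP => //; rewrite lexx ltr01.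
have := digits_itv (digits (clip s) k) c01; rewrite size_digits eqxx => /esym/andP[h1].
by move=> /(le_lt_trans h1); rewrite ltrDl.
Qed.

End inverse_cdf.

Section code_approximation.
Context d (S : measurableType d) {R : realType} (P : probability S R).

(** If X is within e of a function of the first k digits of a random binary
    sequence, so is its mean of the corresponding finite sum. *)
Lemma expectation_code (X : S -> R) (code : S -> seq bool) (gam : seq bool -> R)
    (k : nat) (e : R) :
  measurable_fun setT X -> (forall c, measurable [set s | code s = c]) ->
  (forall s, size (code s) = k) ->
  (forall s, `|X s - gam (code s)| <= e) ->
  P.-integrable setT (EFin \o X) /\
  `|\int[P]_s X s
    - \sum_(c : k.-tuple bool) gam c * fine (P [set s | code s = c])| <= e.
Proof.
move=> mX mcode scode Xe.
have gE s : gam (code s) = \sum_(c : k.-tuple bool) gam c * \1_[set s | code s = c] s.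
  have sz : size (code s) == k by rewrite scode.
  rewrite (bigD1 (Tuple sz))//= indicE mem_set// mulr1 big1 ?addr0// => c cc.
  rewrite indicE memNset ?mulr0//= => E; case/eqP: cc; apply: val_inj => /=.
  by rewrite E.
have iind c : P.-integrable setT (EFin \o (fun s => gam c * \1_[set s | code s = c] s)).
  have ic : P.-integrable setT (EFin \o \1_[set s | code s = c]) by exact: integrable_indic.
  exact: (integrableZl measurableT (gam c) ic).
have isum : P.-integrable setT (EFin \o (fun s => gam (code s))).
  rewrite (_ : _ \o _ = (fun s => \sum_(c <- index_enum (k.-tuple bool)) (gam c * \1_[set s | code s = c] s)%:E)%E).
    by apply: integrable_sum => //= c _; exact: iind.
  by apply/funext => s; rewrite /= gE sumEFin.
have iP (a : R) : P.-integrable setT (EFin \o cst a).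
  exact: finite_measure_integrable_cst.
have mg : measurable_fun setT (fun s => gam (code s)).
  by apply/measurable_EFinP; exact: measurable_int isum.
have iX : P.-integrable setT (EFin \o X).
  apply: (@integrable_leR _ _ _ P setT measurableT _ (fun s => `|gam (code s)| + e)) => //.
    apply: (integrableD measurableT (integrable_norm isum) (iP e)).
  move=> s _; rewrite -[X s](subrK (gam (code s))) addrC.
  by rewrite (le_trans (ler_normD _ _))// lerD2l.
split => //.
have -> : \sum_(c : k.-tuple bool) gam c * fine (P [set s | code s = c]) =
    \int[P]_s gam (code s).
  rewrite /Rintegral.
  rewrite (eq_integral (fun s => \sum_(c <- index_enum (k.-tuple bool)) (gam c * \1_[set s | code s = c] s)%:E)%E); last first.
    by move=> s _; rewrite gE sumEFin.
  rewrite integral_sum => [|//|c]; last exact: iind.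
  have -> : \sum_(c : k.-tuple bool) gam c * fine (P [set s | code s = c]) =
      fine (\sum_(c : k.-tuple bool) (gam c * fine (P [set s | code s = c]))%:E)%E.
    by rewrite sumEFin.
  congr fine; apply: eq_bigr => c _.
  under eq_integral do rewrite EFinM.
  rewrite integralZl//; last exact: integrable_indic.
  by rewrite integral_indic// setIT EFinM fineK// fin_num_measure.
rewrite -RintegralB//.
apply: le_trans (_ : \int[P]_s cst e s <= e); last first.
  have -> : \int[P]_s cst e s = e * fine (P setT) by exact: Rintegral_cst.
  by rewrite (@probability_setT _ _ _ P) mulr1.
by apply: norm_Rintegral_le => //; exact: measurable_funB.
Qed.

End code_approximation.

Section row_vectors.
Context {R : realType} {N : nat}.
Local Notation V := 'rV[R]_N.
Local Notation BV := (borel_rV R N).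

Lemma le_rV_norm (y : V) (e : R) : 0 <= e ->
  (forall k, `|y ord0 k| <= e) -> `|y| <= e.
Proof.
move=> e0 ye; rewrite [leLHS]/Num.norm /= mx_normrE.
by apply: bigmax_le => // -[i k] _ /=; rewrite (ord1 i).
Qed.

Lemma coord_le_norm (y : V) k : `|y ord0 k| <= `|y|.
Proof.
rewrite [leRHS]/Num.norm /= mx_normrE.
exact: (le_bigmax _ (fun ij : 'I_1 * 'I_N => `|y ij.1 ij.2|) (ord0, k)).
Qed.

Lemma measurable_continuous_rV (g : V -> R) : continuous g ->
  measurable_fun setT (g : BV -> measurableTypeR R).
Proof.
move=> cg; apply: (measurability _ (RGenOpens.measurableE R)).
move=> _ [_ [a [b ->] <-]]; rewrite setTI; apply: sub_gen_smallest.
exact: (open_comp (fun x _ => cg x) (interval_open _ _)).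
Qed.

Lemma uniform_continuity (K : set V) (g : V -> R) : compact K -> continuous g ->
  forall e, 0 < e -> exists2 del, 0 < del &
    forall y y', K y -> K y' -> `|y - y'| < del -> `|g y - g y'| <= e.
Proof.
move=> /compact_near_coveringP cK cg e e0.
have : \forall del \near (0 : R)^'+, K `<=`
    [set y | forall y', `|y - y'| < del -> `|g y - g y'| <= e].
  apply: cK => y Ky.
  have /cvgrPdist_lt/(_ _ (divr_gt0 e0 (ltr0n _ 2))) := cg y.
  move=> /nbhs_ballP[r /= r0 hr].
  near=> y1 del; move=> y2 /= y12.
  have B1 : `|g y - g y1| < e / 2.
    apply: hr; rewrite -ball_normE/=.
    by near: y1; apply/nbhs_ballP; exists r => // z; rewrite -ball_normE.
  have B2 : `|g y - g y2| < e / 2.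
    apply: hr; rewrite -ball_normE/= -(subrKA y1).
    apply: le_lt_trans (ler_normD _ _) _; rewrite (splitr r) ltrD//.
      near: y1; apply/nbhs_ballP; exists (r / 2); first by rewrite /= divr_gt0.
      by move=> z; rewrite -ball_normE.
    apply: lt_trans y12 _; near: del.
    by apply: nbhs_right_lt; rewrite divr_gt0.
  rewrite -(subrKA (g y)); apply: le_trans (ler_normD _ _) _.
  by rewrite (splitr e) lerD// ltW// distrC.
move=> h; have [del [del0 hdel]] := filter_ex (filterI (nbhs_right_gt (0 : R)) h).
by exists del => // y y' Ky _; exact: hdel.
Unshelve. all: by end_near. Qed.

(** The n-th binary digit of a vector tells whether it lies in the n-th of the
    half-spaces { y | q <= y_k } with rational q.  Codes list the most recent
    digit first. *)
Definition digit (y : V) (n : nat) : bool :=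
  if unpickle n is Some (k, q) then (ratr (q : rat) <= y ord0 (k : 'I_N)) else false.

Fixpoint code (y : V) (k : nat) : seq bool :=
  if k is k'.+1 then digit y k' :: code y k' else [::].

Lemma size_code y k : size (code y k) = k.
Proof. by elim: k => //= k ->. Qed.

Lemma code_drop y j k : drop j (code y (j + k)) = code y k.
Proof. by elim: j => [|j IH] /=; rewrite ?drop0. Qed.

Lemma code_digit y y' k : code y k = code y' k ->
  forall n, (n < k)%N -> digit y n = digit y' n.
Proof.
elim: k => // k IH /= [E1 E2] n; rewrite ltnS leq_eqVlt => /predU1P[->//|].
exact: IH.
Qed.

Lemma measurable_code k (c : seq bool) :
  measurable ([set y | code y k = c] : set BV).
Proof.
elim: k c => [|k IH] [|b c] /=.
- by rewrite (_ : mkset _ = setT)//; apply/seteqP; split.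
- by rewrite (_ : mkset _ = set0)//; apply/seteqP; split.
- by rewrite (_ : mkset _ = set0)//; apply/seteqP; split.
rewrite (_ : mkset _ = [set y | code y k = c] `&` [set y | digit y k = b]).
  apply: measurableI; first exact: IH.
  rewrite /digit; case: (unpickle k) => [[i q]|]; last first.
    case: b.
    - by rewrite (_ : mkset _ = set0)//; apply/seteqP; split.
    - by rewrite (_ : mkset _ = setT)//; apply/seteqP; split.
  have h : measurable_fun setT ((fun y : V => y ord0 i) : BV -> measurableTypeR R).
    exact: measurable_continuous_rV (@coord_continuous R 1 N ord0 i).
  have {}h := h measurableT _ (measurable_itv `[ratr q, +oo[).
  pose B : set BV := setT `&` (fun y : V => y ord0 i) @^-1` `[ratr q, +oo[.
  have BE (y : BV) : B y = (ratr q <= (y : V) ord0 i).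
    by rewrite /B setTI /= in_itv/= andbT.
  case: b.
    by rewrite (_ : mkset _ = B)//; apply/seteqP; split => y; rewrite BE.
  rewrite (_ : mkset _ = ~` B); first exact: measurableC.
  by apply/seteqP; split => y; rewrite /setC/= BE; [move=> ->|move=> /negP/negbTE].
by apply/seteqP; split => y /=; [move=> [-> ->]|move=> [-> ->]].
Qed.

Lemma code_fine (M e : R) : 0 < e -> exists k, forall y y' : V,
  `|y| <= M -> `|y'| <= M -> code y k = code y' k -> `|y - y'| <= e.
Proof.
move=> e0.
have [n ne] : exists n, n.+1%:R^-1 < e.
  have [n _ hn] := near_infty_natSinv_lt (PosNum e0).
  by exists n; exact: hn n (leqnn n).
have [B MB] : exists B : nat, M * n.+1%:R <= B%:R.
  by exists (Num.truncn (M * n.+1%:R)).+1; exact: ltW (truncnS_gt _).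
pose q (i : nat) : rat := (i%:Z - B%:Z)%:~R / n.+1%:R.
pose k := (\max_(j : 'I_N) \max_(i < (2 * B).+1) pickle (j, q i)).+1.
exists k => y y' yM y'M.
move=> cyy'.
have key (z z' : V) : `|z| <= M -> code z k = code z' k ->
    forall j, z ord0 j - z' ord0 j < e.
  move=> zM czz' j; apply: lt_trans ne.
  pose f := Num.floor (z ord0 j * n.+1%:R).
  have fl : f%:~R <= z ord0 j * n.+1%:R := floor_le _.
  have fr : z ord0 j * n.+1%:R < (f + 1)%:~R := floorD1_gt _.
  have /andP[zl zr] : - M <= z ord0 j <= M.
    by rewrite -ler_norml (le_trans (coord_le_norm _ _)).
  have n0 : 0 < n.+1%:R :> R by rewrite ltr0n.
  have fB : (f <= B%:Z)%R.
    rewrite -(ler_int R) (le_trans fl)// (le_trans _ MB)//.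
    by rewrite ler_pM2r.
  have fB' : (- B%:Z <= f)%R.
    rewrite -ltzD1 -(ltr_int R) (le_lt_trans _ fr)// mulrNz.
    by rewrite (@le_trans _ _ (- (M * n.+1%:R)))// ?lerN2// -mulNr ler_pM2r.
  pose i := absz (f + B%:Z).
  have iE : (i%:Z = f + B%:Z)%R by rewrite gez0_abs// addrC -lerBlDl sub0r.
  have iB : (i < (2 * B).+1)%N.
    by rewrite ltnS -lez_nat iE mul2n -addnn PoszD lerD2r.
  have qE : ratr (q i) = f%:~R / n.+1%:R :> R.
    by rewrite /q iE addrK fmorph_div/= ratr_int ratr_nat.
  have lk : (pickle (j, q i) < k)%N.
    rewrite ltnS (leq_trans _ (leq_bigmax j))//.
    exact: (leq_bigmax (Ordinal iB)).
  have := code_digit czz' lk; rewrite /digit pickleK qE.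
  rewrite ler_pdivrMr// fl => /esym.
  rewrite ler_pdivrMr// => fl'.
  rewrite -(ltr_pM2r n0) mulVf ?gt_eqF// mulrBl ltrBlDr.
  by apply: lt_le_trans fr _; rewrite intrD addrC lerD2l.
apply: le_rV_norm; first exact: ltW.
move=> j; rewrite !mxE ler_norml lerNl opprB.
by apply/andP; split; apply: ltW; apply: key.
Qed.

End row_vectors.

Section tree_law.
Context {R : realType} {N : nat}.
Local Notation V := 'rV[R]_N.
Local Notation BV := (borel_rV R N).
Local Notation RM := (measurableTypeR R).
Variables (K : set V) (M : R) (y0 : V).
Hypotheses (closedK : closed K) (KM : forall y, K y -> `|y| <= M) (Ky0 : K y0).

Definition rep (c : seq bool) : V := xget y0 (K `&` [set y | code y (size c) = c]).

Lemma rep_in c : K (rep c).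
Proof. by rewrite /rep; case: xgetP => [y -> []|]. Qed.

Lemma code_rep c : (exists2 y, K y & code y (size c) = c) -> code (rep c) (size c) = c.
Proof.
by move=> [y Ky yc]; rewrite /rep; case: xgetP => [z -> []//|/(_ y) []]; split.
Qed.

Definition code_within (g : V -> R) (k : nat) (e : R) :=
  forall y y', K y -> K y' -> code y k = code y' k -> `|g y - g y'| <= e.

Lemma continuous_code_within (g : V -> R) e : continuous g -> 0 < e ->
  exists k, code_within g k e.
Proof.
move=> cg e0; have cK : compact K.
  apply: bounded_closed_compact => //; exists M; split; first exact: num_real.
  by move=> x Mx y Ky; apply: le_trans (KM Ky) (ltW Mx).
have [del del0 hdel] := uniform_continuity cK cg e0.
have [k hk] := @code_fine R N M _ (divr_gt0 del0 (ltr0n _ 2)).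
exists k => y y' Ky Ky' yy'; apply: hdel => //.
apply: le_lt_trans (hk y y' (KM Ky) (KM Ky') yy') _.
by rewrite ltr_pdivrMr// ltr_pMr// ltr1n.
Qed.

Lemma code_within_rep (g : V -> R) k e y : code_within g k e -> K y ->
  `|g y - g (rep (code y k))| <= e.
Proof.
move=> h Ky; apply: h => //; first exact: rep_in.
have := @code_rep (code y k); rewrite size_code => ->//; by exists y.
Qed.

Variable m : seq bool -> R.
Hypotheses (m1 : m [::] = 1) (m_ge0 : forall c, 0 <= m c).
Hypothesis mD : forall c, m (false :: c) + m (true :: c) = m c.
Hypothesis m_supp : forall c, (forall y, K y -> code y (size c) <> c) -> m c = 0.

Let pk (s : RM) k : V := rep (digits m (clip s) k).

Let code_pk s k : code (pk s k) k = digits m (clip s) k.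
Proof.
rewrite -[X in code _ X](size_digits m (clip s) k); apply: code_rep.
apply: contrapT => h; have := digits_gt0 m1 m_ge0 mD s k.
rewrite m_supp ?ltxx// => y Ky yc; apply: h; exists y => //.
Qed.

Let code_pk_le s j k : code (pk s (j + k)) k = digits m (clip s) k.
Proof. by rewrite -(code_drop _ j) code_pk digits_drop. Qed.

Let cvg_pk s : cvgn (pk s).
Proof.
apply/cauchy_cvgP/cauchy_exP => e e0.
have [k hk] := @code_fine R N M _ (divr_gt0 e0 (ltr0n _ 2)).
exists (pk s k), k => // n /= kn; rewrite -ball_normE/=.
apply: le_lt_trans (hk _ _ _ _ _) _.
- by apply: KM; exact: rep_in.
- by apply: KM; exact: rep_in.
- by rewrite code_pk -(subnK kn) code_pk_le.
- by rewrite ltr_pdivrMr// ltr_pMr// ltr1n.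
Qed.

Let Y (s : RM) : V := limn (pk s).

Let Y_in s : K (Y s).
Proof.
have h : \forall n \near \oo, K (pk s n) by apply: nearW => k; exact: rep_in.
have cY : pk s @ \oo --> Y s by exact: cvg_pk.
have H := closed_cvg _ closedK h.
exact (H _ (Y s) cY).
Qed.

Let Y_within (g : V -> R) k e s : continuous g -> code_within g k e ->
  `|g (Y s) - g (pk s k)| <= e.
Proof.
move=> cg ge.
have cgY : (fun n => `|g (pk s n) - g (pk s k)|) @ \oo --> `|g (Y s) - g (pk s k)|.
  apply: cvg_norm; apply: cvgB; last exact: cvg_cst.
  by apply: (continuous_cvg _ (cg (Y s))); exact: cvg_pk.
apply: (cvgr_to_le cgY).
exists k => // n /= kn; apply: ge; [exact: rep_in|exact: rep_in|].
by rewrite code_pk -(subnK kn) code_pk_le.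
Qed.

(** Y is a uniform limit of functions of finitely many digits: Y s lies in an
    open set iff some approximation lies in it together with a ball whose
    radius is the error of that approximation. *)
Let measurable_Y : measurable_fun setT (Y : RM -> BV).
Proof.
apply: (@measurability _ _ RM BV setT Y (@open V)); first by [].
move=> _ [U oU <-]; rewrite setTI.
have near_Y n : exists k, forall s, `|Y s - pk s k| <= n.+1%:R^-1.
  have n0 : 0 < n.+1%:R^-1 :> R by rewrite invr_gt0.
  have [k hk] := @code_fine R N M _ n0.
  exists k => s; apply: le_rV_norm; first exact: ltW.
  move=> j; rewrite !mxE; apply: (@Y_within (fun y => y ord0 j)).
    exact: coord_continuous.
  move=> y y' Ky Ky' yy'; apply: le_trans (hk y y' (KM Ky) (KM Ky') yy').
  by have := coord_le_norm (y - y') j; rewrite !mxE.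
pose k n := projT1 (cid (near_Y n)).
have kP n s : `|Y s - pk s (k n)| <= n.+1%:R^-1 := projT2 (cid (near_Y n)) s.
pose S n : set (seq bool) :=
  [set c | forall y, `|y - rep c| <= n.+1%:R^-1 -> U y].
have -> : Y @^-1` U = \bigcup_n [set s | S n (digits m (clip s) (k n))].
  apply/seteqP; split => s /=; last by move=> [n _ Sn]; exact: Sn _ (kP n s).
  move=> UY; have /nbhs_ballP[e /= e0 eU] := open_nbhs_nbhs (conj oU UY).
  have [n _ /(_ n (leqnn n)) ne] := near_infty_natSinv_lt (PosNum (divr_gt0 e0 (ltr0n R 2))).
  exists n => // y yn; apply: eU; rewrite -ball_normE/= -(subrKA (pk s (k n))).
  apply: le_lt_trans (ler_normD _ _) _; rewrite (splitr e) ltrD//.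
    exact: le_lt_trans (kP n s) ne.
  by rewrite distrC; exact: le_lt_trans yn ne.
by apply: bigcupT_measurable => n; exact: measurable_digits_clip.
Qed.

Lemma tree_law : exists nu : probability BV R, forall g : V -> R, continuous g ->
  (forall B, (forall y, K y -> `|g y| <= B) ->
     nu.-integrable setT ((EFin \o g) : BV -> \bar R) /\ `|fine (pairing nu g)| <= B) /\
  (forall k e, code_within g k e ->
     `|fine (pairing nu g) - \sum_(c : k.-tuple bool) g (rep c) * m c| <= e).
Proof.
pose X : {mfun RM >-> BV} := 
  MeasurableFun.Pack (MeasurableFun.Class (isMeasurableFun.Build _ _ RM BV Y measurable_Y)).
exists (distribution (@unit_measure R) X : probability BV R) => g cg.
have mg : measurable_fun setT (g : BV -> measurableTypeR R).
  exact: measurable_continuous_rV.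
have mgY : measurable_fun setT (fun s => g (Y s)).
  by apply: (measurableT_comp mg); exact: measurable_Y.
have bounded_int B : (forall y, K y -> `|g y| <= B) ->
    (@unit_measure R).-integrable setT (EFin \o (fun s => g (Y s))).
  move=> gB; apply: (@integrable_leR _ _ _ _ setT measurableT _ (cst B)) => //.
    exact: finite_measure_integrable_cst.
  by move=> s _; exact: gB.
have pairE B : (forall y, K y -> `|g y| <= B) ->
    fine (pairing (distribution (@unit_measure R) X) g) = \int[@unit_measure R]_s g (Y s).
  move=> gB; rewrite /pairing /distribution integral_pushforward//.
  - exact/measurable_EFinP.
  - exact: bounded_int gB.
split.
  move=> B gB; split.
    apply: (@integrable_pushforward _ _ RM BV R X) => //.
    - exact/measurable_EFinP.
    - exact: bounded_int gB.
  rewrite (pairE B)//; apply: le_trans (norm_Rintegral_le measurableT mgY (finite_measure_integrable_cst _ B measurableT) _) _.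
    by move=> s _; exact: gB.
  have -> : \int[@unit_measure R]_s cst B s = B * fine (@unit_measure R setT).
    exact: Rintegral_cst.
  by rewrite probability_setT mulr1.
move=> k e ge.
have gB y : K y -> `|g y| <= \sum_(c : k.-tuple bool) `|g (rep c)| + e.
  move=> Ky; rewrite -[g y](subrK (g (rep (code y k)))) addrC.
  apply: le_trans (ler_normD _ _) _; apply: lerD; last exact: code_within_rep.
  have sz : size (code y k) == k by rewrite size_code.
  by rewrite (bigD1 (Tuple sz))//= lerDl sumr_ge0.
rewrite (pairE _ gB).
have [_] := @expectation_code _ _ R (@unit_measure R) (fun s => g (Y s))
  (fun s => digits m (clip s) k) (g \o rep) k e mgY
  (fun c => @measurable_digits_clip R m [set c] k)
  (fun s => size_digits m (clip s) k) (fun s => Y_within s cg ge).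
rewrite (eq_bigr (fun c : k.-tuple bool => g (rep c) * m c))// => c _.
congr (_ * _); have := unit_measure_digits m1 m_ge0 mD c.
by rewrite size_tuple => h; exact: (congr1 fine h).
Qed.

End tree_law.

Section real_integrals_sum.
Context d (T : measurableType d) (R : realType).
Variables (mu : {measure set T -> \bar R}).

Lemma Rintegral_sum (I : Type) (r : seq I) (F : I -> T -> R) :
  (forall i, mu.-integrable setT (EFin \o F i)) ->
  mu.-integrable setT (EFin \o (fun x => \sum_(i <- r) F i x)) /\
  \int[mu]_x (\sum_(i <- r) F i x) = \sum_(i <- r) \int[mu]_x F i x.
Proof.
move=> iF; elim: r => [|i r [IH1 IH2]].
  rewrite big_nil (_ : (fun x => _) = cst 0); last by apply/funext => x; rewrite big_nil.
  by split; [exact: (integrable0 mu)|rewrite Rintegral_cst// mul0r].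
rewrite big_cons (_ : (fun x => _) = (fun x => F i x + \sum_(j <- r) F j x)).
  split; first exact: (integrableD measurableT (iF i) IH1).
  by rewrite RintegralD// IH2.
by apply/funext => x; rewrite big_cons.
Qed.

Lemma ae_eq_Rintegral (f g : T -> R) : measurable_fun setT f ->
  measurable_fun setT g -> {ae mu, forall x, f x = g x} ->
  \int[mu]_x f x = \int[mu]_x g x.
Proof.
move=> mf mg fg; congr fine; apply: ae_eq_integral => //.
- exact/measurable_EFinP.
- exact/measurable_EFinP.
- by apply: filterS fg => x /= ->.
Qed.

Lemma integrable_mul_bounded (phi g : T -> R) (B : R) :
  mu.-integrable setT (EFin \o phi) -> measurable_fun setT g ->
  (forall x, `|g x| <= B) ->
  mu.-integrable setT (EFin \o (fun x => phi x * g x)).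
Proof.
move=> iphi mg gB.
have mphi : measurable_fun setT phi by apply/measurable_EFinP; exact: measurable_int iphi.
apply: (@integrable_leR _ _ _ mu setT measurableT _ (fun x => B * `|phi x|)).
- exact: measurable_funM.
- exact: (integrableZl measurableT B (integrable_norm iphi)).
- by move=> x _; rewrite normrM mulrC ler_wpM2r.
Qed.

Lemma ae_eq_weak_star (rho f g : T -> R) (B : R) : (forall x, 0 < rho x) ->
  mu.-integrable setT (EFin \o rho) ->
  measurable_fun setT f -> measurable_fun setT g ->
  (forall x, `|f x| <= B) -> (forall x, `|g x| <= B) ->
  (forall phi, mu.-integrable setT (EFin \o phi) ->
    \int[mu]_x (phi x * f x) = \int[mu]_x (phi x * g x)) ->
  {ae mu, forall x, f x = g x}.
Proof.
move=> rho0 irho mf mg fB gB fg.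
have fgA A : measurable A -> \int[mu]_(x in A) (rho x * f x) = \int[mu]_(x in A) (rho x * g x).
  move=> mA; rewrite !(Rintegral_mkcond _ A).
  have E (k : T -> R) : (fun x => rho x * k x) \_ A = (fun x => (rho x * \1_A x) * k x).
    apply/funext => x; rewrite patchE indicE; case: (_ \in _); rewrite ?mulr1//.
    by rewrite mulr0 mul0r.
  rewrite !E; apply: fg; apply: (integrable_mul_bounded (B := 1)) => //.
  by move=> x; rewrite indicE; case: (_ \in _); rewrite ?normr1// normr0.
have irf := integrable_mul_bounded irho mf fB.
have irg := integrable_mul_bounded irho mg gB.
have h1 : {ae mu, forall x, setT x -> rho x * f x <= rho x * g x}.
  by apply: ae_le_integral => // A mA _; rewrite fgA.
have h2 : {ae mu, forall x, setT x -> rho x * g x <= rho x * f x}.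
  by apply: ae_le_integral => // A mA _; rewrite fgA.
apply: filterS2 h1 h2 => x /(_ Logic.I) le1 /(_ Logic.I) le2.
apply: (mulfI (lt0r_neq0 (rho0 x))); apply/eqP.
by rewrite eq_le le1 le2.
Qed.

Lemma measurable_uniform_approx (f : T -> R) :
  (forall e, 0 < e -> exists2 g : T -> R, measurable_fun setT g &
    forall x, `|f x - g x| <= e) -> measurable_fun setT f.
Proof.
move=> h.
have n0 n : 0 < n.+1%:R^-1 :> R by rewrite invr_gt0.
pose g n := projT1 (cid2 (h _ (n0 n))).
have mg n : measurable_fun setT (g n) by rewrite /g; case: cid2.
have fg n x : `|f x - g n x| <= n.+1%:R^-1 by rewrite /g; case: cid2.
apply: (measurable_fun_cvg mg) => x _; apply/cvgrPdist_le => e e0.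
have [k _ hk] := near_infty_natSinv_lt (PosNum e0).
by exists k => // n /hk/ltW; apply: le_trans.
Qed.

Lemma measurable_eqR (f g : T -> R) : measurable_fun setT f ->
  measurable_fun setT g -> measurable [set x | f x = g x].
Proof.
move=> mf mg; rewrite (_ : mkset _ = setT `&` (f \- g) @^-1` [set 0]).
  by apply: (measurable_funB mf mg).
rewrite setTI; apply/seteqP; split => x /=.
  by move=> ->; rewrite subrr.
by move=> /eqP; rewrite subr_eq0 => /eqP.
Qed.

End real_integrals_sum.

Section young_compactness.
Context {R : realType} {N : nat}.
Local Notation V := 'rV[R]_N.
Local Notation BV := (borel_rV R N).
Context d (T : measurableType d) (mu : {sigma_finite_measure set T -> \bar R}).
Variables (rho : T -> R) (G : nat -> set T).
Hypotheses (rho_gt0 : forall x, 0 < rho x)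
  (irho : mu.-integrable setT (EFin \o rho))
  (GE : @measurable _ T = <<s range G>>) (GI : setI_closed (range G)).
Variables (K : set V) (M : R) (y0 : V).
Hypotheses (closedK : closed K) (KM : forall y, K y -> `|y| <= M) (Ky0 : K y0).
Context d' (Omega : measurableType d') (P : probability Omega R).
Variable X : nat -> Omega -> T -> V.
Hypothesis mX : forall n, measurable_fun setT (fun p : Omega * T => X n p.1 p.2 : BV).
Hypothesis KX : forall n w z, K (X n w z).

Let E n (g : V -> R) z : R := \int[P]_w g (X n w z).

Let mXz n z : measurable_fun setT (fun w => X n w z : BV).
Proof. exact: (measurableT_comp (mX n) (pair2_measurable z)). Qed.

Let mass n (c : seq bool) z : R := fine (P [set w | code (X n w z) (size c) = c]).

Let mcode n c z : measurable [set w | code (X n w z) (size c) = c].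
Proof.
have := mXz n z measurableT (measurable_code (size c) c).
by rewrite setTI.
Qed.

Let mass01 n c z : 0 <= mass n c z <= 1.
Proof.
rewrite /mass fine_ge0//= -lee_fin fineK ?fin_num_measure//.
exact: probability_le1.
Qed.

Let measurable_mass n c : measurable_fun setT (mass n c).
Proof.
have mA : measurable [set p : Omega * T | code (X n p.1 p.2) (size c) = c].
  have := mX n measurableT (measurable_code (size c) c).
  by rewrite setTI.
have := measurable_fun_ysection P mA.
move=> h; apply/measurable_EFinP; apply: eq_measurable_fun h => z _ /=.
rewrite /mass fineK ?fin_num_measure//; congr (P _).
by apply/seteqP; split => w; rewrite /ysection/= inE.
Qed.

Let mass_nil n z : mass n [::] z = 1.
Proof.
rewrite /mass (_ : mkset _ = setT) ?probability_setT//.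
by apply/seteqP; split.
Qed.

Let mass_split n c z : mass n (false :: c) z + mass n (true :: c) z = mass n c z.
Proof.
rewrite /mass -fineD ?fin_num_measure// -measureU//.
  congr (fine (P _)); apply/seteqP; split => w /=.
    by case=> -[].
  by move=> cw; case: (digit _ _) => /=; [right|left]; rewrite cw.
by apply/seteqP; split => w //= -[[-> _]] [].
Qed.

Let mass_supp n c z : (forall y, K y -> code y (size c) <> c) -> mass n c z = 0.
Proof.
move=> h; rewrite /mass (_ : mkset _ = set0) ?measure0//.
by apply/seteqP; split => w //=; exact: h.
Qed.

Let E_approx n (g : V -> R) k e z : continuous g -> code_within K g k e ->
  `|E n g z - \sum_(c : k.-tuple bool) g (rep K y0 c) * mass n c z| <= e.
Proof.
move=> cg ge.
have mcode' c : measurable [set w | code (X n w z) k = c].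
  by have := mXz n z measurableT (measurable_code k c); rewrite setTI.
have [_] := @expectation_code _ _ R P (fun w => g (X n w z))
  (fun w => code (X n w z) k) (g \o rep K y0) k e
  (measurableT_comp (measurable_continuous_rV cg) (mXz n z))
  mcode' (fun w => size_code _ k)
  (fun w => code_within_rep Ky0 ge (KX n w z)).
rewrite (eq_bigr (fun c : k.-tuple bool => g (rep K y0 c) * mass n c z))// => c _.
by rewrite /mass size_tuple.
Qed.

Lemma young_compactness : exists (s : nat -> nat) (nu : T -> probability BV R),
  {homo s : m n / (m < n)%N} /\
  forall g : V -> R, continuous g ->
  [/\ forall B z, (forall y, K y -> `|g y| <= B) ->
        (nu z).-integrable setT ((EFin \o g) : BV -> \bar R) /\
        `|fine (pairing (nu z) g)| <= B,
      measurable_fun setT (fun z => fine (pairing (nu z) g)) &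
      forall phi, mu.-integrable setT (EFin \o phi) ->
        (fun n => \int[mu]_z (phi z * E (s n) g z)) @ \oo -->
        \int[mu]_z (phi z * fine (pairing (nu z) g))].
Proof.
pose h i n z : R := if unpickle i is Some c then mass n c z else 0.
have [||s [H [s_homo mH H01 cH]]] := weak_star_subsequence (h := h) rho_gt0 irho GE GI.
- by move=> i n; rewrite /h; case: unpickle => [c|].
- by move=> i n z; rewrite /h; case: unpickle => [c|]; rewrite ?lexx ?ler01.
pose W (c : seq bool) := H (pickle c).
have cW c phi : mu.-integrable setT (EFin \o phi) ->
    (fun n => \int[mu]_z (phi z * mass (s n) c z)) @ \oo --> \int[mu]_z (phi z * W c z).
  by move=> iphi; have := cH (pickle c) phi iphi; rewrite /h pickleK.
have W01 c z : 0 <= W c z <= 1 by exact: H01.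
have Wn c z : `|W c z| <= 1 by have /andP[? ?] := W01 c z; rewrite ger0_norm.
have massn n c z : `|mass n c z| <= 1.
  by have /andP[? ?] := mass01 n c z; rewrite ger0_norm.
have W1 : {ae mu, forall z, W [::] z = 1}.
  apply: (ae_eq_weak_star (g := cst 1) (B := 1) rho_gt0 irho) => //.
  - exact: mH.
  - by move=> x /=; rewrite normr1.
  - move=> phi iphi; apply: (cvg_unique _ (cW [::] phi iphi)) => //=.
    under eq_fun do under eq_Rintegral do rewrite mass_nil.
    exact: cvg_cst.
have WD c : {ae mu, forall z, W (false :: c) z + W (true :: c) z = W c z}.
  apply: (ae_eq_weak_star (B := 2) rho_gt0 irho) => //.
  - by apply: measurable_funD; exact: mH.
  - exact: mH.
  - move=> z; apply: le_trans (ler_normD _ _) _.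
    by have := Wn (false :: c) z; have := Wn (true :: c) z; lra.
  - by move=> z; rewrite (le_trans (Wn _ _))// ler1n.
  - move=> phi iphi; apply: (cvg_unique _ _ (cW c phi iphi)) => //=.
    under eq_Rintegral do rewrite mulrDr.
    have iW b := integrable_mul_bounded iphi (mH (pickle (b :: c))) (Wn (b :: c)).
    rewrite RintegralD//; [|exact: iW|exact: iW].
    have -> : (fun n => \int[mu]_z (phi z * mass (s n) c z)) =
        (fun n => \int[mu]_z (phi z * mass (s n) (false :: c) z) +
                  \int[mu]_z (phi z * mass (s n) (true :: c) z)).
      apply/funext => n.
      have im b := integrable_mul_bounded iphi (measurable_mass (s n) (b :: c)) (massn (s n) (b :: c)).
      rewrite -RintegralD//; apply: eq_Rintegral => z _.
      by rewrite -mulrDr mass_split.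
    exact: (cvgD (cW (false :: c) phi iphi) (cW (true :: c) phi iphi)).
have WS c : (forall y, K y -> code y (size c) <> c) -> {ae mu, forall z, W c z = 0}.
  move=> hc; apply: (ae_eq_weak_star (g := cst 0) (B := 1) rho_gt0 irho) => //.
  - exact: mH.
  - by move=> x /=; rewrite normr0.
  - move=> phi iphi; apply: (cvg_unique _ (cW c phi iphi)) => //=.
    under eq_fun do under eq_Rintegral do rewrite mass_supp//.
    exact: cvg_cst.
pose goodc (c : seq bool) : set T :=
  [set z | W (false :: c) z + W (true :: c) z = W c z] `&`
  (if `[< forall y, K y -> code y (size c) <> c >] then [set z | W c z = 0] else setT).
pose good : set T := [set z | W [::] z = 1] `&`
  \bigcap_n goodc (odflt [::] (unpickle n)).
have mgoodc c : measurable (goodc c).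
  apply: measurableI.
    by apply: measurable_eqR; [apply: measurable_funD; exact: mH|exact: mH].
  by case: ifP => // _; apply: measurable_eqR => //; exact: mH.
have mgood : measurable good.
  apply: measurableI; first by apply: measurable_eqR => //; exact: mH.
  by apply: bigcapT_measurable.
have ae_goodc c : {ae mu, forall z, goodc c z}.
  have [hc|hc] := asboolP (forall y, K y -> code y (size c) <> c).
    apply: filterS2 (WD c) (WS c hc) => z h1 h2; split => //.
    by case: asboolP.
  apply: filterS (WD c) => z h1; split => //.
  by case: asboolP.
have ae_good : {ae mu, forall z, good z}.
  have : {ae mu, forall z n, goodc (odflt [::] (unpickle n)) z}.
    by apply: ae_foralln => n; exact: ae_goodc.
  by apply: filterS2 W1 => z h1 h2; split => // n _; exact: h2.
have goodP z c : good z -> goodc c z.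
  by move=> [_ /(_ (pickle c) Logic.I)]; rewrite pickleK.
pose m z c : R := if `[< good z >] then W c z else (code y0 (size c) == c)%:R.
have m1 z : m z [::] = 1 by rewrite /m; case: asboolP => // -[].
have m_ge0 z c : 0 <= m z c.
  by rewrite /m; case: asboolP => // _; have /andP[] := W01 c z.
have mD z c : m z (false :: c) + m z (true :: c) = m z c.
  rewrite /m; case: asboolP => [/(goodP z c)[]//|_] /=.
  rewrite !eqseq_cons; case: (digit y0 (size c)); case: (code y0 (size c) == c) => /=;
  by rewrite ?mulr0n ?addr0 ?add0r.
have m_supp z c : (forall y, K y -> code y (size c) <> c) -> m z c = 0.
  move=> hc; rewrite /m; case: asboolP => [/(goodP z c)[_]|_].
    by case: asboolP.
  by case: eqP => // /(hc _ Ky0).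
have mm c : measurable_fun setT (fun z => m z c).
  rewrite (_ : (fun z => _) = fun z => W c z * \1_good z +
      (code y0 (size c) == c)%:R * (1 - \1_good z)).
    apply: measurable_funD; first by apply: measurable_funM; [exact: mH|exact: measurable_indic].
    by apply: measurable_funM => //; apply: measurable_funB.
  apply/funext => z; rewrite /m indicE; case: asboolP => gz.
    by rewrite mem_set// mulr1 subrr mulr0 addr0.
  by rewrite memNset// mulr0 add0r subr0 mulr1.
have mn c z : `|m z c| <= 1.
  rewrite /m; case: asboolP => _; first exact: Wn.
  by case: eqP; rewrite ?normr1 ?normr0.
have cm c phi : mu.-integrable setT (EFin \o phi) ->
    (fun n => \int[mu]_z (phi z * mass (s n) c z)) @ \oo --> \int[mu]_z (phi z * m z c).
  move=> iphi; have -> : \int[mu]_z (phi z * m z c) = \int[mu]_z (phi z * W c z); last exact: cW.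
  have mphi : measurable_fun setT phi by apply/measurable_EFinP; exact: measurable_int iphi.
  apply: ae_eq_Rintegral.
  - by apply: measurable_funM.
  - by apply: measurable_funM => //; exact: mH.
  - by apply: filterS ae_good => z gz; rewrite /m asboolT.
pose law z := tree_law closedK KM Ky0 (m1 z) (m_ge0 z) (mD z) (m_supp z).
pose nu z := projT1 (cid (law z)).
have nuP z g := projT2 (cid (law z)) g.
rewrite -/nu in nuP.
have ms g k : measurable_fun setT (fun z => \sum_(c : k.-tuple bool) g (rep K y0 c) * m z c).
  by apply: measurable_sum => c; apply: measurable_funM.
exists s, nu; split => // g cg; split.
- by move=> B z gB; have [h1 _] := nuP z g cg; exact: h1.
- apply: measurable_uniform_approx => e e0.
  have [k hk] := continuous_code_within closedK KM cg e0.
  exists (fun z => \sum_(c : k.-tuple bool) g (rep K y0 c) * m z c); first exact: ms.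
  by move=> z; have [_ h2] := nuP z g cg; exact: h2.
move=> phi iphi.
have mphi : measurable_fun setT phi by apply/measurable_EFinP; exact: measurable_int iphi.
have iaphi := integrable_norm iphi.
apply/cvgrPdist_le => eps eps0.
pose L := \int[mu]_z `|phi z|.
have L0 : 0 <= L by apply: Rintegral_ge0.
pose e := eps / 3 / (L + 1).
have e0 : 0 < e by rewrite !divr_gt0// ltr_wpDl.
have eL : e * L <= eps / 3.
  rewrite /e mulrAC ler_pdivrMr ?ltr_wpDl// ler_wpM2l ?lerDl//.
  by rewrite divr_ge0 ?ltW.
have [k hk] := continuous_code_within closedK KM cg e0.
have E_ n z : `|E n g z - \sum_(c : k.-tuple bool) g (rep K y0 c) * mass n c z| <= e.
  exact: E_approx.
have F_ z : `|fine (pairing (nu z) g) - \sum_(c : k.-tuple bool) g (rep K y0 c) * m z c| <= e.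
  by have [_ h2] := nuP z g cg; exact: h2.
(* replacing a function by its discretization costs at most eps / 3 *)
have disc (a b : T -> R) : measurable_fun setT a -> measurable_fun setT b ->
    mu.-integrable setT (EFin \o (fun z => phi z * b z)) ->
    (forall z, `|a z - b z| <= e) ->
    `|\int[mu]_z (phi z * a z) - \int[mu]_z (phi z * b z)| <= eps / 3.
  move=> ma mb ib ab.
  have iab : mu.-integrable setT (EFin \o (fun z => phi z * (a z - b z))).
    by apply: (integrable_mul_bounded iphi _ ab); exact: measurable_funB.
  have -> : \int[mu]_z (phi z * a z) =
      \int[mu]_z (phi z * (a z - b z)) + \int[mu]_z (phi z * b z).
    rewrite -RintegralD//; apply: eq_Rintegral => z _.
    by rewrite -mulrDr subrK.
  rewrite addrK; apply: le_trans eL.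
  rewrite -RintegralZl//; apply: norm_Rintegral_le => //.
  - by apply: measurable_funM => //; exact: measurable_funB.
  - exact: (integrableZl measurableT e iaphi).
  - by move=> z _; rewrite normrM mulrC ler_wpM2r.
(* the discretized integrals are finite sums of integrals of masses *)
have dsum (b : seq bool -> T -> R) : (forall c, measurable_fun setT (b c)) ->
    (forall c z, `|b c z| <= 1) ->
    mu.-integrable setT (EFin \o (fun z => phi z *
      \sum_(c : k.-tuple bool) g (rep K y0 c) * b c z)) /\
    \int[mu]_z (phi z * \sum_(c : k.-tuple bool) g (rep K y0 c) * b c z) =
    \sum_(c : k.-tuple bool) g (rep K y0 c) * \int[mu]_z (phi z * b c z).
  move=> mb b1.
  have ipb c := integrable_mul_bounded iphi (mb c) (b1 c).
  have iF (c : k.-tuple bool) : mu.-integrable setT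
      (EFin \o (fun z => g (rep K y0 c) * (phi z * b c z))).
    exact: (integrableZl measurableT _ (ipb c)).
  have [h1 h2] := Rintegral_sum (index_enum (k.-tuple bool)) iF.
  have Eq : (fun z => phi z * \sum_(c : k.-tuple bool) g (rep K y0 c) * b c z) =
      (fun z => \sum_(c : k.-tuple bool) (g (rep K y0 c) * (phi z * b c z))).
    by apply/funext => z; rewrite big_distrr/=; apply: eq_bigr => c _; rewrite mulrCA.
  rewrite Eq; split => //; rewrite h2; apply: eq_bigr => c _.
  by rewrite RintegralZl.
have cs : (fun n => \sum_(c : k.-tuple bool) g (rep K y0 c) * \int[mu]_z (phi z * mass (s n) c z))
    @ \oo --> \sum_(c : k.-tuple bool) g (rep K y0 c) * \int[mu]_z (phi z * m z c).
  by apply: cvg_sum_seq => c; apply: cvgMl_tmp; exact: cm.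
have [ds1 ds2] := dsum (fun c z => m z c) mm mn.
have mE n : measurable_fun setT (E n g).
  apply: measurable_uniform_approx => e' e'0.
  have [k' hk'] := continuous_code_within closedK KM cg e'0.
  exists (fun z => \sum_(c : k'.-tuple bool) g (rep K y0 c) * mass n c z).
    by apply: measurable_sum => c; apply: measurable_funM.
  by move=> z; exact: E_approx.
have mF : measurable_fun setT (fun z => fine (pairing (nu z) g)).
  apply: measurable_uniform_approx => e' e'0.
  have [k' hk'] := continuous_code_within closedK KM cg e'0.
  exists (fun z => \sum_(c : k'.-tuple bool) g (rep K y0 c) * m z c); first exact: ms.
  by move=> z; have [_ h2] := nuP z g cg; exact: h2.
have dF := disc _ _ mF (ms g k) ds1 F_.
move/cvgrPdist_le : cs => /(_ _ (divr_gt0 eps0 (ltr0n _ 3))).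
apply: filterS => n hn.
have [dn1 dn2] := dsum (mass (s n)) (measurable_mass (s n)) (massn (s n)).
have msn : measurable_fun setT (fun z => \sum_(c : k.-tuple bool) g (rep K y0 c) * mass (s n) c z).
  by apply: measurable_sum => c; apply: measurable_funM.
have dE := disc _ _ (mE (s n)) msn dn1 (E_ (s n)).
move: dF dE hn; rewrite ds2 dn2 !ler_norml => /andP[? ?] /andP[? ?] /andP[? ?].
by apply/andP; split; lra.
Qed.

End young_compactness.

Section translation.
Context {R : realType}.
Local Notation RM := (measurableTypeR R).
Local Notation leb := (@lebesgue_measure R).

Lemma measurable_shift (c : R) : measurable_fun setT ((fun x => x + c) : RM -> RM).
Proof. by apply: measurable_funD. Qed.

Lemma lebesgue_measure_shift (c : R) (A : set RM) : measurable A ->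
  leb A = pushforward leb ((fun x => x + c) : RM -> RM) A.
Proof.
pose f : {mfun RM >-> RM} :=
  MeasurableFun.Pack (MeasurableFun.Class (isMeasurableFun.Build _ _ RM RM _ (measurable_shift c))).
move: A; apply: (@lebesgue_measure_unique R (pushforward leb f)).
move=> _ [[a b] _ <-] /=; rewrite /pushforward.
rewrite (_ : _ @^-1` _ = `]a - c, b - c]%classic).
  rewrite !lebesgue_measure_itv/= !lte_fin ltrD2r; case: ifP => // _.
  by rewrite -!EFinD opprB addrA subrK.
by apply/seteqP; split => x /=; rewrite !in_itv/= ltrBlDr lerBrDr.
Qed.

Lemma ge0_integral_shift (c : R) (f : R -> \bar R) :
  measurable_fun setT (f : RM -> \bar R) -> (forall x, 0 <= f x)%E ->
  (\int[leb]_x f (x + c)%R = \int[leb]_x f x)%E.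
Proof.
move=> mf f0.
have := @ge0_integral_pushforward _ _ RM RM R _ (measurable_shift c) leb setT f
  measurableT mf (fun x _ => f0 x).
rewrite preimage_setT => <-; apply: eq_measure_integral; first exact: measurable_shift.
move=> ms A mA _.
exact: (esym (lebesgue_measure_shift c mA)).
Qed.

Lemma integrable_shift (c : R) (f : R -> R) : leb.-integrable setT (EFin \o f) ->
  leb.-integrable setT (EFin \o (fun x => f (x + c))).
Proof.
move=> /integrableP[mf foo]; have mf' : measurable_fun setT f by exact/measurable_EFinP.
apply/integrableP; split.
  by apply/measurable_EFinP; apply: (measurableT_comp mf'); exact: measurable_shift.
rewrite (ge0_integral_shift c (f := fun x => `|(f x)%:E|%E))//.
by apply: measurableT_comp.
Qed.

Lemma Rintegral_shift (c : R) (f : R -> R) : leb.-integrable setT (EFin \o f) ->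
  \int[leb]_x f (x + c) = \int[leb]_x f x.
Proof.
move=> fi; have mf := measurable_int _ fi.
rewrite /Rintegral; congr fine.
have := @integral_pushforward _ _ RM RM R _ (measurable_shift c) leb setT
  (EFin \o f) mf; rewrite preimage_setT => h.
rewrite -[LHS](h (integrable_shift c fi) measurableT).
apply: eq_measure_integral; first exact: measurable_shift.
move=> ms A mA _; exact: (esym (lebesgue_measure_shift c mA)).
Qed.

End translation.

Section lipschitz_ftc.
Context {R : realType}.
Local Notation RM := (measurableTypeR R).
Local Notation leb := (@lebesgue_measure R).

Definition right_quotient (W : R -> R) (n : nat) (t : R) : R :=
  n.+1%:R * (W (t + n.+1%:R^-1) - W t).

(** The upper limit is a measurable version of the derivative, which need not
    exist everywhere. *)
Definition right_derivative (W : R -> R) (t : R) : R :=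
  limn_sup (right_quotient W ^~ t).

Lemma right_derivativeE (W : R -> R) t l :
  right_quotient W ^~ t @ \oo --> l -> right_derivative W t = l.
Proof. by move=> h; have [_] := cvg_limn_inf_sup h. Qed.

Lemma right_quotient_derivable (W : R -> R) t : derivable W t 1 ->
  right_quotient W ^~ t @ \oo --> derive1 W t.
Proof.
move=> dW.
have h : (fun h : R => h^-1 * (W (h + t) - W t)) @ (0 : R)^' --> derive1 W t.
  rewrite derive1E; apply: cvg_trans dW; apply: near_eq_cvg; apply: nearW => h /=.
  by rewrite [h *: 1]mulr1.
apply: (cvg_trans _ (cvg_comp (fun n : nat => n.+1%:R^-1 : R) _ _ h)).
  apply: near_eq_cvg; apply: nearW => n /=.
  by rewrite /right_quotient invrK [_ + t]addrC.
move=> A [e /= e0 eA]; have [k _ hk] := near_infty_natSinv_lt (PosNum e0).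
exists k => // n /hk ne; apply: eA => //=.
by rewrite sub0r normrN ger0_norm.
Qed.

Section lipschitz.
Variables (W : R -> R) (L : R).
Hypothesis WL : forall s t, `|W s - W t| <= L * `|s - t|.

Lemma lipschitz_ge0 : 0 <= L.
Proof.
have := WL 1 0; rewrite subr0 normr1 mulr1; apply: le_trans; exact: normr_ge0.
Qed.

Lemma lipschitz_continuous : continuous W.
Proof.
move=> x; apply/cvgrPdist_le => e e0.
have L1 : 0 < L + 1 by rewrite ltr_wpDl// lipschitz_ge0.
near=> y; apply: le_trans (WL _ _) _.
apply: (@le_trans _ _ ((L + 1) * `|x - y|)).
  by rewrite ler_wpM2r// lerDl.
rewrite mulrC -ler_pdivlMr//; near: y.
by apply: cvgr_dist_le => //; rewrite divr_gt0.
Unshelve. all: by end_near. Qed.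

Lemma lipschitz_measurable : measurable_fun setT (W : RM -> RM).
Proof. exact: continuous_measurable_fun lipschitz_continuous. Qed.

Lemma norm_right_quotient n t : `|right_quotient W n t| <= L.
Proof.
rewrite /right_quotient normrM ger0_norm//.
apply: (@le_trans _ _ (n.+1%:R * (L * `|n.+1%:R^-1|))).
  rewrite ler_wpM2l//; apply: le_trans (WL _ _) _.
  by rewrite addrC addKr.
by rewrite ger0_norm// mulrCA divff ?mulr1// pnatr_eq0.
Qed.

Lemma measurable_right_quotient n : measurable_fun setT (right_quotient W n : RM -> RM).
Proof.
apply: measurable_funM => //; apply: measurable_funB; last exact: lipschitz_measurable.
by apply: (measurableT_comp lipschitz_measurable); exact: measurable_shift.
Qed.

Lemma measurable_right_derivative : measurable_fun setT (right_derivative W : RM -> RM).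
Proof.
apply: measurable_fun_limn_sup.
- move=> t _; exists L => _ [n _ <-].
  by apply: le_trans (norm_right_quotient n t); exact: ler_norm.
- move=> t _; exists (- L) => _ [n _ <-].
  by have := norm_right_quotient n t; rewrite ler_norml => /andP[].
- exact: measurable_right_quotient.
Qed.

Let iW a b : leb.-integrable `[a, b] (EFin \o W).
Proof.
apply: continuous_compact_integrable; first exact: segment_compact.
exact/continuous_subspaceT/lipschitz_continuous.
Qed.

Let average a n : `|n.+1%:R * \int[leb]_(t in `[a, a + n.+1%:R^-1]) W t - W a|
  <= L * n.+1%:R^-1.
Proof.
set h : R := n.+1%:R^-1.
have h0 : 0 < h by rewrite invr_gt0.
have ic (c : R) : leb.-integrable `[a, a + h] (EFin \o cst c).
  apply: continuous_compact_integrable; first exact: segment_compact.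
  by apply: continuous_subspaceT => x; exact: cvg_cst.
have len : fine (leb (`[a, a + h]%classic : set RM)) = h.
  by rewrite lebesgue_measure_itv/= lte_fin ltrDl h0 -EFinD addrC addKr.
have E1 : \int[leb]_(t in `[a, a + h]) cst (W a) t = W a * h.
  by rewrite Rintegral_cst// len.
have E2 : \int[leb]_(t in `[a, a + h]) cst (L * h) t = L * h * h.
  by rewrite Rintegral_cst// len.
have -> : n.+1%:R * \int[leb]_(t in `[a, a + h]) W t - W a =
    n.+1%:R * \int[leb]_(t in `[a, a + h]) (W t - cst (W a) t).
  rewrite RintegralB// mulrBr E1; congr (_ - _).
  by rewrite mulrCA divff ?mulr1// pnatr_eq0.
rewrite normrM ger0_norm// -[leRHS](mulKf (_ : n.+1%:R != 0 :> R)) ?pnatr_eq0//.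
rewrite mulrCA ler_wpM2l// mulrC.
rewrite -[leRHS]E2; apply: norm_Rintegral_le => //.
  apply: measurable_funTS; apply: measurable_funB; last exact: measurable_cst.
  exact: lipschitz_measurable.
move=> t /=; rewrite in_itv/= => /andP[at_ ta]; apply: le_trans (WL _ _) _.
rewrite ler_wpM2l ?lipschitz_ge0// ger0_norm ?subr_ge0//.
by rewrite lerBlDl.
Qed.

Lemma lipschitz_ftc (T : R) : 0 <= T ->
  {ae leb, forall t, 0 < t -> cvgn (right_quotient W ^~ t)} ->
  leb.-integrable `[0, T] (EFin \o right_derivative W) /\
  \int[leb]_(t in `[0, T]) right_derivative W t = W T - W 0.
Proof.
move=> T0 cW.
have iL : leb.-integrable `[0, T] (EFin \o cst L).
  apply: continuous_compact_integrable; first exact: segment_compact.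
  by apply: continuous_subspaceT => x; exact: cvg_cst.
have [||||int_D cvg_D] := @Rdominated_cvg _ RM R leb `[0, T]%classic (measurable_itv _)
  (right_quotient W) (right_derivative W) (cst L) _ _ _ iL.
- by move=> n; apply: measurable_funTS; exact: measurable_right_quotient.
- by apply: measurable_funTS; exact: measurable_right_derivative.
- have FF := ae_filter_ringOfSetsType leb.
  have : {ae leb, forall t : RM, t != 0}.
    exists [set 0]; split => //; first exact: lebesgue_measure_set1.
    by move=> t /= /negP; rewrite negbK => /eqP.
  apply: filterS2 cW => t ct t0 /=; rewrite in_itv/= => /andP[t0' _].
  have {}ct : cvgn (right_quotient W ^~ t) by apply: ct; rewrite lt_neqAle eq_sym t0.
  by rewrite /right_derivative cvg_limn_supE.
- by move=> n t _; exact: norm_right_quotient.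
split => //; apply: (cvg_unique _ cvg_D) => //=.
apply/cvgrPdist_le => e e0.
have L0 := lipschitz_ge0.
have e' : 0 < e / (2 * L + 1) by rewrite divr_gt0// ltr_wpDl// mulr_ge0.
have [k _ hk] := near_infty_natSinv_lt (PosNum e').
exists k => // n /hk /= ne.
set h : R := n.+1%:R^-1 in ne *.
have h0 : 0 < h by rewrite invr_gt0.
have shiftE : \int[leb]_(t in `[0, T]) W (t + h) = \int[leb]_(t in `[h, T + h]) W t.
  rewrite Rintegral_mkcond [RHS]Rintegral_mkcond.
  rewrite -[RHS](Rintegral_shift h); last first.
    have := iW h (T + h); rewrite integrable_mkcond; last exact: measurable_itv.
    by rewrite restrict_EFin.
  apply: eq_Rintegral => t _; rewrite !patchE.
  rewrite (_ : (t + h \in `[h, T + h]%classic) = (t \in `[0, T]%classic))//.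
  by apply/idP/idP; rewrite !inE/= !in_itv/= lerD2r lerDr.
have iWh : leb.-integrable `[0, T] (EFin \o (fun t => W (t + h))).
  apply: continuous_compact_integrable; first exact: segment_compact.
  apply: continuous_subspaceT => x; apply: continuous_comp; last exact: lipschitz_continuous.
  by apply: cvgD; [exact: cvg_id|exact: cvg_cst].
have -> : \int[leb]_(t in `[0, T]) right_quotient W n t =
    n.+1%:R * \int[leb]_(t in `[T, T + h]) W t - n.+1%:R * \int[leb]_(t in `[0, h]) W t.
  rewrite /right_quotient RintegralZl//; last first.
    have mT : measurable (`[0, T]%classic : set RM) by exact: measurable_itv.
    exact: (integrableB mT iWh (iW 0 T)).
  rewrite RintegralB// shiftE -mulrBr; congr (_ * _).
  have e1 : \int[leb]_(t in `[0, T + h]) W t - \int[leb]_(t in `[0, T]) W t =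
      \int[leb]_(t in `]T, T + h]) W t.
    by apply: Rintegral_itvB; rewrite ?bnd_simp ?lerDl ?(ltW h0).
  have e2 : \int[leb]_(t in `[0, T + h]) W t - \int[leb]_(t in `[0, h]) W t =
      \int[leb]_(t in `]h, T + h]) W t.
    by apply: Rintegral_itvB; rewrite ?bnd_simp ?lerDr ?(ltW h0).
  have iW' a b : leb.-integrable `]a, b] (EFin \o W).
    by apply: integrableS (iW a b) => //; apply: subset_itv; rewrite bnd_simp.
  rewrite !Rintegral_itv_obnd_cbnd// in e1 e2.
  by rewrite -e1 -e2; ring.
have aT := average T n; have a0 := average 0 n; rewrite add0r in a0.
rewrite -/h in aT a0.
have : 2 * (L * h) <= e.
  rewrite mulrA; apply: (@le_trans _ _ ((2 * L + 1) * h)).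
    by rewrite ler_wpM2r ?lerDl// ltW.
  by rewrite mulrC -ler_pdivlMr ?ltW// ltr_wpDl// mulr_ge0.
move: aT a0; rewrite !ler_norml => /andP[? ?] /andP[? ?] ?.
by apply/andP; split; lra.
Qed.

End lipschitz.
End lipschitz_ftc.

Section plane_functions.
Context {R : realType}.
Local Notation RM := (measurableTypeR R).
Local Notation leb := (@lebesgue_measure R).

Lemma measurable_cell (dx a : R) (i : int) : 0 < dx ->
  measurable ([set x | cell_index dx a x = i] : set RM).
Proof.
move=> dx0; rewrite (_ : mkset _ =
    `[midpoint dx a i - dx / 2, midpoint dx a i + dx / 2[%classic).
  exact: measurable_itv.
apply/seteqP; split => x /=; rewrite in_itv/=.
  by move=> /(cell_indexP _ _ _ dx0).
by move=> h; apply/(cell_indexP _ _ _ dx0).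
Qed.

Lemma measurable_glue (idx : R -> int) (g : int -> R -> R) :
  (forall i, measurable ([set x | idx x = i] : set RM)) ->
  (forall i, measurable_fun setT (g i : RM -> RM)) ->
  measurable_fun setT ((fun z => g (idx z.1) z.2) : RM * RM -> RM).
Proof.
move=> midx mg _ Y mY; rewrite setTI.
rewrite (_ : _ @^-1` _ = \bigcup_i ([set x | idx x = i] `*` (g i @^-1` Y))).
  apply: countable_bigcupT_measurable => // i; apply: measurableX => //.
  by rewrite -[X in measurable X]setTI; exact: mg.
apply/seteqP; split => -[x t] /=; first by move=> h; exists (idx x).
by move=> [i _ [/= <-]].
Qed.

Lemma measurable_step (idx : R -> int) (g : int -> R) :
  (forall i, measurable ([set x | idx x = i] : set RM)) ->
  measurable_fun setT ((fun x => g (idx x)) : RM -> RM).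
Proof.
move=> midx; have := @measurable_glue idx (fun i _ => g i) midx (fun i => measurable_cst _).
move=> h; exact: (measurableT_comp h (pair2_measurable (0 : RM))).
Qed.

Lemma measurable_continuous_plane (phi : R * R -> R) : continuous phi ->
  measurable_fun setT (phi : RM * RM -> RM).
Proof.
move=> cphi.
pose m (n : nat) (x : R) := midpoint n.+1%:R^-1 (0 : R) (cell_index n.+1%:R^-1 0 x).
have n0 n : 0 < n.+1%:R^-1 :> R by rewrite invr_gt0.
have mn n x : `|x - m n x| <= n.+1%:R^-1.
  have := (cell_indexP 0 x (cell_index n.+1%:R^-1 0 x) (n0 n)).2 erefl.
  rewrite /cell/= -/(m n x) => /andP[h1 h2].
  have := n0 n; set d := n.+1%:R^-1 in h1 h2 *; move=> d0.
  by rewrite ler_norml; apply/andP; split; lra.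
apply: (@measurable_fun_cvg _ _ _ setT (fun n (z : RM * RM) => phi (m n z.1, z.2))).
  move=> n; apply: (@measurable_glue (cell_index n.+1%:R^-1 0)
    (fun i t => phi (midpoint n.+1%:R^-1 0 i, t))).
    by move=> i; exact: measurable_cell.
  move=> i; apply: continuous_measurable_fun => t.
  have ct : (fun s : R => (midpoint n.+1%:R^-1 0 i, s)) @ t -->
      ((midpoint n.+1%:R^-1 0 i, t) : R * R).
    exact: (cvg_pair (cvg_cst _) cvg_id).
  exact: (cvg_comp _ _ ct (cphi _)).
move=> [x t] _ /=.
have mx : m ^~ x @ \oo --> x.
  apply/cvgrPdist_le => e e0; have [k _ hk] := near_infty_natSinv_lt (PosNum e0).
  by exists k => // n /hk/ltW; apply: le_trans.
have mxt : (fun n => (m n x, t)) @ \oo --> ((x, t) : R * R).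
  exact: (cvg_pair mx (cvg_cst _)).
exact: (cvg_comp _ _ mxt (cphi _)).
Qed.

Definition box (X : R) (z : R * R) : R := \1_(`[- X, X]) z.1 * \1_(`[- X, X]) z.2.

(** Bounded measurable functions supported in a square: all integrals of
    interest are of this kind, so that Fubini applies without restriction. *)
Definition boxed (X B : R) (F : R * R -> R) :=
  measurable_fun setT (F : RM * RM -> RM) /\ forall z, `|F z| <= B * box X z.

Lemma box_ge0 X z : 0 <= box X z.
Proof. by rewrite /box mulr_ge0. Qed.

Lemma box_le1 X z : box X z <= 1.
Proof.
by rewrite /box !indicE; case: (_ \in _); case: (_ \in _); rewrite ?mulr1 ?mulr0 ?ler01.
Qed.

Lemma measurable_box X : measurable_fun setT (box X : RM * RM -> RM).
Proof.
apply: measurable_funM.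
  by apply: (measurableT_comp _ measurable_fst); apply: measurable_indic.
by apply: (measurableT_comp _ measurable_snd); apply: measurable_indic.
Qed.

Lemma integrable_indic_seg (X : R) : leb.-integrable setT (EFin \o \1_(`[- X, X])).
Proof. exact: integrable_indic_itv. Qed.

Lemma integrable_box X : (lebesgue2 R).-integrable setT (EFin \o box X).
Proof.
apply/integrable12ltyP; first by apply/measurable_EFinP; exact: measurable_box.
have iI := integrable_indic_seg X.
rewrite (_ : (\int[_]_x _)%E = (\int[leb]_x (\1_(`[- X, X]) x * fine (\int[leb]_y (\1_(`[- X, X]) y)%:E))%:E)%E).
  set c := fine _; have iZ : leb.-integrable setT (EFin \o (fun x => \1_(`[- X, X]) x * c)).
    exact: (integrableZr measurableT c iI).
  by have := integrable_fin_num measurableT iZ; rewrite fin_numElt => /andP[].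
apply: eq_integral => x _ /=.
transitivity (\int[leb]_y ((\1_(`[- X, X]) x)%:E * (\1_(`[- X, X]) y)%:E))%E.
  by apply: eq_integral => y _; rewrite -EFinM ger0_norm// box_ge0.
rewrite integralZl// EFinM fineK//.
exact: (integrable_fin_num measurableT iI).
Qed.

Section boxed.
Variables (X B : R) (F : R * R -> R).
Hypothesis bF : boxed X B F.

Lemma boxed_integrable : (lebesgue2 R).-integrable setT (EFin \o F).
Proof.
apply: (@integrable_leR _ (RM * RM)%type R (lebesgue2 R) setT measurableT F
  (fun z => B * box X z)).
- exact: bF.1.
- exact: (integrableZl measurableT B (integrable_box X)).
- by move=> z _; exact: bF.2.
Qed.

Lemma boxed_x t : measurable_fun setT ((fun x => F (x, t)) : RM -> RM) /\
  forall x, `|F (x, t)| <= B * \1_(`[- X, X]) t * \1_(`[- X, X]) x.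
Proof.
split; first exact: (measurableT_comp bF.1 (pair2_measurable t)).
by move=> x; rewrite -mulrA [\1_ _ t * _]mulrC; exact: bF.2 (x, t).
Qed.

Lemma boxed_t x : measurable_fun setT ((fun t => F (x, t)) : RM -> RM) /\
  forall t, `|F (x, t)| <= B * \1_(`[- X, X]) x * \1_(`[- X, X]) t.
Proof.
split; first exact: (measurableT_comp bF.1 (pair1_measurable x)).
by move=> t; rewrite -mulrA; exact: bF.2 (x, t).
Qed.

Lemma boxed_integrable_x t : leb.-integrable setT (EFin \o (fun x => F (x, t))).
Proof.
have [mF hF] := boxed_x t.
apply: (@integrable_leR _ RM _ leb setT measurableT _ _ mF _ (fun x _ => hF x)).
exact: (integrableZl measurableT _ (integrable_indic_seg X)).
Qed.

Lemma boxed_integrable_t x : leb.-integrable setT (EFin \o (fun t => F (x, t))).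
Proof.
have [mF hF] := boxed_t x.
apply: (@integrable_leR _ RM _ leb setT measurableT _ _ mF _ (fun x _ => hF x)).
exact: (integrableZl measurableT _ (integrable_indic_seg X)).
Qed.

Let fubini_FE : EFin \o (fun x => \int[leb]_t F (x, t)) = fubini_F leb (EFin \o F).
Proof.
apply/funext => x; rewrite /fubini_F /Rintegral/= fineK//.
exact: (integrable_fin_num measurableT (boxed_integrable_t x)).
Qed.

Let fubini_GE : EFin \o (fun t => \int[leb]_x F (x, t)) = fubini_G leb (EFin \o F).
Proof.
apply/funext => t; rewrite /fubini_G /Rintegral/= fineK//.
exact: (integrable_fin_num measurableT (boxed_integrable_x t)).
Qed.

Lemma integrable_int_t : leb.-integrable setT (EFin \o (fun x => \int[leb]_t F (x, t))).
Proof. by rewrite fubini_FE; exact: integrable_fubini_F boxed_integrable. Qed.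

Lemma integrable_int_x : leb.-integrable setT (EFin \o (fun t => \int[leb]_x F (x, t))).
Proof.
pose I := \int[leb]_x \1_(`[- X, X]) x.
apply: (@integrable_leR _ RM _ leb setT measurableT _ (fun t => B * I * \1_(`[- X, X]) t)).
- apply/measurable_EFinP; rewrite fubini_GE.
  exact: measurable_fubini_G boxed_integrable.
- exact: (integrableZl measurableT _ (integrable_indic_seg X)).
- move=> t _; have [mF hF] := boxed_x t.
  rewrite mulrAC; rewrite -RintegralZl//; last exact: integrable_indic_seg.
  apply: norm_Rintegral_le => //.
  exact: (integrableZl measurableT _ (integrable_indic_seg X)).
Qed.

Lemma boxed_fubini_xt :
  \int[lebesgue2 R]_z F z = \int[leb]_x \int[leb]_t F (x, t).
Proof.
rewrite [RHS]/Rintegral [LHS]/Rintegral; congr fine.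
rewrite -(integral12_prod_meas1 boxed_integrable).
by apply: eq_integral => x _; exact: (congr1 (@^~ x) (esym fubini_FE)).
Qed.

Lemma boxed_fubini_tx :
  \int[lebesgue2 R]_z F z = \int[leb]_t \int[leb]_x F (x, t).
Proof.
rewrite [RHS]/Rintegral [LHS]/Rintegral; congr fine.
rewrite -(integral21_prod_meas1 boxed_integrable).
by apply: eq_integral => t _; exact: (congr1 (@^~ t) (esym fubini_GE)).
Qed.

End boxed.

Lemma boxedM_bounded X B B' F G : 0 <= B' -> boxed X B F ->
  measurable_fun setT (G : RM * RM -> RM) -> (forall z, `|G z| <= B') ->
  boxed X (B * B') (fun z => F z * G z).
Proof.
move=> B'0 [mF hF] mG hG; split; first exact: measurable_funM.
by move=> z; rewrite normrM mulrAC ler_pM.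
Qed.

Lemma boxedD X B B' F G : boxed X B F -> boxed X B' G ->
  boxed X (B + B') (fun z => F z + G z).
Proof.
move=> [mF hF] [mG hG]; split; first exact: measurable_funD.
by move=> z; rewrite mulrDl (le_trans (ler_normD _ _))// lerD.
Qed.

Lemma boxedN X B F : boxed X B F -> boxed X B (fun z => - F z).
Proof.
by move=> [mF hF]; split=> [|z]; [exact: measurable_funN|rewrite normrN].
Qed.

End plane_functions.

Section test_functions_plane.
Context {R : realType}.
Local Notation RM := (measurableTypeR R).
Local Notation leb := (@lebesgue_measure R).

Definition hquot (phi : R * R -> R) (h : R) (z : R * R) : R :=
  (phi (z.1 + h, z.2) - phi z) / h.

Lemma slice_x (phi : R * R -> R) x t :
  (fun h : R => h^-1 *: (phi (h *: (1, 0) + (x, t)) - phi (x, t))) =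
  (fun h : R => h^-1 *: (phi (h *: 1 + x, t) - phi (x, t))).
Proof.
apply/funext => h; congr (_ *: (phi _ - _)).
by rewrite [LHS]surjective_pairing; congr pair; rewrite /= scaler0 add0r.
Qed.

Lemma slice_t (phi : R * R -> R) x t :
  (fun h : R => h^-1 *: (phi (h *: (0, 1) + (x, t)) - phi (x, t))) =
  (fun h : R => h^-1 *: (phi (x, h *: 1 + t) - phi (x, t))).
Proof.
apply/funext => h; congr (_ *: (phi _ - _)).
by rewrite [LHS]surjective_pairing; congr pair; rewrite /= scaler0 add0r.
Qed.

Section C1c_facts.
Variable phi : R * R -> R.
Hypothesis phi_C1c : C1c phi.

Let dphi z : differentiable phi z. Proof. by case: phi_C1c. Qed.

Lemma C1c_continuous : continuous phi.
Proof. by move=> z; exact: differentiable_continuous. Qed.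

Lemma Dx_continuous : continuous (Dx phi).
Proof. by case: phi_C1c => _ h _; exact: h. Qed.

Lemma Dt_continuous : continuous (Dt phi).
Proof. by case: phi_C1c => _ h _; exact: h. Qed.

Lemma is_derive_x (x t : R) : is_derive x (1 : R) (fun x => phi (x, t)) (Dx phi (x, t)).
Proof.
have dv : derivable phi (x, t) (1, 0) by exact: diff_derivable.
split; last first.
  by rewrite /Dx /derive slice_x.
by move: dv; rewrite /derivable slice_x.
Qed.

Lemma is_derive_t (x t : R) : is_derive t (1 : R) (fun t => phi (x, t)) (Dt phi (x, t)).
Proof.
have dv : derivable phi (x, t) (0, 1) by exact: diff_derivable.
split; last first.
  by rewrite /Dt /derive slice_t.
by move: dv; rewrite /derivable slice_t.
Qed.

Lemma continuous_slice_x (t : R) : continuous (fun x => phi (x, t)).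
Proof.
move=> x; have c : (fun s : R => (s, t) : R * R) @ x --> ((x, t) : R * R).
  exact: (cvg_pair cvg_id (cvg_cst _)).
exact: (cvg_comp _ _ c (@C1c_continuous (x, t))).
Qed.

Lemma continuous_slice_t (x : R) : continuous (fun t => phi (x, t)).
Proof.
move=> t; have c : (fun s : R => (x, s) : R * R) @ t --> ((x, t) : R * R).
  exact: (cvg_pair (cvg_cst _) cvg_id).
exact: (cvg_comp _ _ c (@C1c_continuous (x, t))).
Qed.

(** One square and one bound for the function and both its derivatives. *)
Lemma C1c_box : exists2 X : R, 0 < X & exists2 B : R, 0 <= B &
  [/\ boxed X B phi, boxed X B (Dx phi) & boxed X B (Dt phi)].
Proof.
have [_ _] := phi_C1c; set K := closure _ => cK.
have phi0 z : ~ K z -> phi z = 0.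
  move=> nK; apply: contrapT => /eqP h; apply: nK; exact: subset_closure.
have nearK z : ~ K z -> \forall y \near z, phi y = 0.
  move=> nK; have oK : open (~` K) by apply: closed_openC; exact: closed_closure.
  by apply: filterS (open_nbhs_nbhs (conj oK nK)) => y; exact: phi0.
have D0 v z : ~ K z -> 'D_v phi z = 0.
  move=> nK; rewrite -(derive_cst (0 : R) z v); apply: near_eq_derive.
  exact: nearK.
have [X0 [_ hX0]] := compact_bounded cK.
pose X := `|X0| + 1.
have X0X : X0 < X by rewrite /X ltr_pwDr// ler_norm.
have KX z : K z -> `|z.1| <= X /\ `|z.2| <= X.
  move=> Kz; have := hX0 X X0X z Kz; rewrite /= prod_normE ge_max => /andP[].
  by [].
have bnd (g : R * R -> R) : continuous g -> (forall z, ~ K z -> g z = 0) ->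
    exists2 B, 0 <= B & forall B', B <= B' -> boxed X B' g.
  move=> cg g0.
  have [B0 [_ hB0]] := compact_bounded (continuous_compact (continuous_subspaceT cg) cK).
  exists (`|B0| + 1) => [|B' BB']; first by rewrite addr_ge0.
  split; first exact: measurable_continuous_plane.
  move=> z; have [Kz|nK] := pselect (K z); last first.
    rewrite g0// normr0 mulr_ge0 ?box_ge0// (le_trans _ BB')// addr_ge0//.
  have [z1 z2] := KX z Kz.
  rewrite /box !indicE !mem_set/= ?in_itv/= -?ler_norml// !mulr1.
  apply: le_trans BB'; apply: hB0; last by exists z.
  by rewrite ltr_pwDr// ler_norm.
have [B1 B10 h1] := bnd _ C1c_continuous phi0.
have [B2 B20 h2] := bnd _ Dx_continuous (fun z => D0 (1, 0) z).
have [B3 B30 h3] := bnd _ Dt_continuous (fun z => D0 (0, 1) z).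
exists X; first by rewrite /X ltr_pwDr.
exists (B1 + B2 + B3); first by rewrite !addr_ge0.
split; [apply: h1|apply: h2|apply: h3].
- by rewrite -addrA lerDl addr_ge0.
- by rewrite addrAC lerDr addr_ge0.
- by rewrite lerDr addr_ge0.
Qed.

Section bounds.
Variables (X B : R).
Hypotheses (X0 : 0 < X) (B0 : 0 <= B).
Hypotheses (bphi : boxed X B phi) (bDx : boxed X B (Dx phi)) (bDt : boxed X B (Dt phi)).

Lemma boxed_bound Y B' (F : R * R -> R) : 0 <= B' -> boxed Y B' F -> forall z, `|F z| <= B'.
Proof.
move=> B'0 [_ h] z; apply: le_trans (h z) _.
by rewrite ler_piMr// box_le1.
Qed.

Lemma boxed_out Y B' (F : R * R -> R) z : boxed Y B' F ->
  (Y < `|z.1|) || (Y < `|z.2|) -> F z = 0.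
Proof.
move=> [_ h] hz; apply/eqP; rewrite -normr_le0; apply: le_trans (h z) _.
rewrite /box !indicE !mem_setE !in_itv/= -!ler_norml.
case/orP: hz => hz; first by rewrite [`|z.1| <= Y]leNgt hz/= mul0r mulr0.
by rewrite [`|z.2| <= Y]leNgt hz/= !mulr0.
Qed.

Lemma lipschitz_x x y t : `|phi (x, t) - phi (y, t)| <= B * `|x - y|.
Proof.
wlog xy : x y / x < y.
  move=> h; have [xy|yx|->] := ltgtP x y; first exact: h.
    by rewrite distrC [`|x - y|]distrC; exact: h.
  by rewrite !subrr normr0 mulr0.
have [c _ E] := MVT (df := fun x => Dx phi (x, t)) xy (fun z _ => is_derive_x z t)
  (continuous_subspaceT (@continuous_slice_x t)).
rewrite distrC E normrM [`|y - x|]distrC ler_wpM2r//.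
exact: boxed_bound bDx _.
Qed.

Lemma lipschitz_t x s t : `|phi (x, s) - phi (x, t)| <= B * `|s - t|.
Proof.
wlog st : s t / s < t.
  move=> h; have [st|ts|->] := ltgtP s t; first exact: h.
    by rewrite distrC [`|s - t|]distrC; exact: h.
  by rewrite !subrr normr0 mulr0.
have [c _ E] := MVT (df := fun t => Dt phi (x, t)) st (fun z _ => is_derive_t x z)
  (continuous_subspaceT (@continuous_slice_t x)).
rewrite distrC E normrM [`|t - s|]distrC ler_wpM2r//.
exact: boxed_bound bDt _.
Qed.

Lemma boxed_hquot h : 0 < h -> h <= 1 -> boxed (X + 1) B (hquot phi h).
Proof.
move=> h0 h1; split.
  apply: measurable_funM => //; apply: measurable_funB; last exact: bphi.1.
  apply: (measurableT_comp bphi.1); apply/measurable_fun_pairP; split => /=.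
    by apply: measurable_funD => //; exact: measurable_fst.
  exact: measurable_snd.
move=> [x t]; rewrite /hquot/=.
have [hz|] := boolP ((X + 1 < `|x|) || (X + 1 < `|t|)).
  rewrite (boxed_out (z := (x + h, t)) bphi) ?(boxed_out (z := (x, t)) bphi)/=.
  - by rewrite subrr mul0r normr0 mulr_ge0// box_ge0.
  - by case/orP: hz => hz; apply/orP; [left|right]; apply: lt_trans hz; rewrite ltrDl.
  - case/orP: hz => hz; apply/orP; [left|right]; last by apply: lt_trans hz; rewrite ltrDl.
    rewrite -(ltrD2r 1); apply: lt_le_trans hz _.
    rewrite -[x in leLHS](addrK h) (le_trans (ler_normB _ _))// lerD2l.
    by rewrite ger0_norm// ltW.
rewrite negb_or -!leNgt => /andP[hx ht].
rewrite /box/= !indicE !mem_set/= ?in_itv/= -?ler_norml// !mulr1.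
rewrite normrM normfV (ger0_norm (ltW h0)) ler_pdivrMr//.
apply: le_trans (lipschitz_x _ _ _) _.
by rewrite addrAC subrr add0r ger0_norm// ltW.
Qed.

Lemma hquot_cvg (dxs : nat -> R) z : (forall n, 0 < dxs n) -> dxs @ \oo --> (0 : R) ->
  (fun n => hquot phi (dxs n) z) @ \oo --> Dx phi z.
Proof.
case: z => x t dx0 cdx.
have dv : derivable phi (x, t) (1, 0) by exact: diff_derivable.
have h : (fun h : R => h^-1 *: (phi (h *: 1 + x, t) - phi (x, t))) @ (0 : R)^' --> Dx phi (x, t).
  by move: dv; rewrite /derivable slice_x /Dx /derive slice_x.
have c0 : dxs @ \oo --> (0 : R)^'.
  move=> A [e /= e0 eA]; move/cvgrPdist_lt : cdx => /(_ e e0).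
  by apply: filterS => n hn; apply: eA => //=; rewrite gt_eqF.
apply: cvg_trans (cvg_comp _ _ c0 h); apply: near_eq_cvg; apply: nearW => n /=.
rewrite /hquot/= [dxs n *: 1]mulr1 [x + _]addrC.
exact: mulrC.
Qed.

End bounds.

Lemma C1c_initial : C1c (fun x => phi (x, 0)).
Proof.
have [X X0 [B B0 [bphi bDx _]]] := C1c_box.
have dx x : derivable (fun x => phi (x, 0)) x 1.
  exact: (@ex_derive _ _ _ _ _ _ _ (is_derive_x x 0)).
split.
- by move=> x; exact/derivable1_diffP.
- move=> v.
  have -> : (fun z => 'D_v (fun x => phi (x, 0)) z) = (fun z => v * Dx phi (z, 0)).
    apply/funext => z; rewrite deriveE; last exact/derivable1_diffP.
    rewrite -[v in LHS]mulr1 -[v * 1]/(v *: (1 : R)) linearZ/=.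
    rewrite -deriveE; last exact/derivable1_diffP.
    by rewrite (@derive_val _ _ _ _ _ _ _ (is_derive_x z 0)).
  move=> x; apply: cvgMl_tmp.
  have cx : (fun s : R => (s, 0) : R * R) @ x --> ((x, 0) : R * R).
    exact: (cvg_pair cvg_id (cvg_cst _)).
  exact: (cvg_comp _ _ cx (@Dx_continuous (x, 0))).
- apply: (@subclosed_compact R _ `[- X, X]); [exact: closed_closure|exact: segment_compact|].
  rewrite [X in _ `<=` X]((closure_id _).1 _); last exact: itv_closed.
  apply: closureS => x /= /eqP phix; rewrite in_itv/= -ler_norml leNgt.
  apply/negP => Xx; apply: phix; apply: (boxed_out (z := (x, 0)) bphi).
  by rewrite Xx.
Qed.

End C1c_facts.
End test_functions_plane.

Section integration_by_parts_lipschitz.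
Context {R : realType}.
Local Notation RM := (measurableTypeR R).
Local Notation leb := (@lebesgue_measure R).

Lemma ae_le_Rintegral d (T : measurableType d) (mu : {measure set T -> \bar R})
    (f g : T -> R) : mu.-integrable setT (EFin \o f) ->
  mu.-integrable setT (EFin \o g) -> {ae mu, forall x, f x <= g x} ->
  \int[mu]_x f x <= \int[mu]_x g x.
Proof.
move=> fi gi fg.
have mf : measurable_fun setT f by apply/measurable_EFinP; exact: measurable_int fi.
have mg : measurable_fun setT g by apply/measurable_EFinP; exact: measurable_int gi.
pose k := f \min g; have mk : measurable_fun setT k by exact: measurable_minr.
have ki : mu.-integrable setT (EFin \o k).
  apply: (@integrable_leR _ _ _ mu setT measurableT k (fun x => `|f x| + `|g x|)) => //.
    exact: (integrableD measurableT (integrable_norm fi) (integrable_norm gi)).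
  move=> x _; rewrite /k /=; case: (leP (f x) (g x)) => _.
    by rewrite lerDl.
  by rewrite lerDr.
rewrite (ae_eq_Rintegral mf mk).
  by apply: le_Rintegral => // x _; rewrite /k/= ge_min lexx orbT.
by apply: filterS fg => x fgx; rewrite /k/= min_l.
Qed.

Definition nonneg_time (t : R) : R := \1_(`[0, +oo[%classic) t.

Lemma nonneg_time01 t : 0 <= nonneg_time t <= 1.
Proof. by rewrite /nonneg_time indicE; case: (_ \in _); rewrite ?lexx ?ler01. Qed.

Lemma nonneg_timeE t : nonneg_time t = ((0 <= t)%R)%:R.
Proof.
rewrite /nonneg_time indicE.
suff -> : (t \in `[0, +oo[%classic) = (0 <= t)%R by [].
by apply/idP/idP; rewrite inE/= in_itv/= andbT.
Qed.

Lemma measurable_nonneg_time : measurable_fun setT (nonneg_time : RM -> RM).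
Proof. by apply: measurable_indic. Qed.

(** Integration by parts on [0, +oo[ against a Lipschitz function. *)
Lemma lipschitz_by_parts (psi dpsi W : R -> R) (X B L M : R) : 0 < X -> 0 <= B ->
  0 <= M ->
  (forall t, is_derive t (1 : R) psi (dpsi t)) -> measurable_fun setT (dpsi : RM -> RM) ->
  (forall t, `|psi t| <= B) ->
  (forall s t, `|psi s - psi t| <= B * `|s - t|) ->
  (forall t, X < `|t| -> psi t = 0 /\ dpsi t = 0) ->
  (forall s t, `|W s - W t| <= L * `|s - t|) -> (forall t, `|W t| <= M) ->
  {ae leb, forall t, 0 < t -> cvgn (right_quotient W ^~ t)} ->
  \int[leb]_t (nonneg_time t * (dpsi t * W t + psi t * right_derivative W t)) =
  - (psi 0 * W 0).
Proof.
move=> X0 B0 M0 dpsiP mdpsi psiB psiL psi0 WL WM cW.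
have FF := ae_filter_ringOfSetsType leb.
pose P t := psi t * W t.
have PL s t : `|P s - P t| <= (B * L + M * B) * `|s - t|.
  have -> : P s - P t = psi s * (W s - W t) + W t * (psi s - psi t).
    by rewrite /P; ring.
  rewrite (le_trans (ler_normD _ _))// mulrDl !normrM lerD//.
    rewrite -mulrA; apply: ler_pM => //.
  by rewrite -mulrA; apply: ler_pM.
have cpsi : continuous psi by exact: lipschitz_continuous psiL.
have quotE t : cvgn (right_quotient W ^~ t) ->
    right_quotient P ^~ t @ \oo --> dpsi t * W t + psi t * right_derivative W t.
  move=> ct.
  have cD : right_quotient W ^~ t @ \oo --> right_derivative W t.
    by rewrite /right_derivative cvg_limn_supE.
  have cp : right_quotient psi ^~ t @ \oo --> dpsi t.
    have [d1 d2] := dpsiP t.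
    by rewrite -d2 -derive1E; exact: right_quotient_derivable.
  have cpt : (fun n : nat => psi (t + n.+1%:R^-1)) @ \oo --> psi t.
    apply: (continuous_cvg _ (cpsi t)); rewrite -[X in _ --> X]addr0.
    apply: cvgD; first exact: cvg_cst.
    exact: cvg_harmonic.
  have -> : right_quotient P ^~ t =
      (fun n => right_quotient psi n t * W t + psi (t + n.+1%:R^-1) * right_quotient W n t).
    by apply/funext => n; rewrite /right_quotient /P; ring.
  apply: cvgD; last exact: cvgM.
  by apply: cvgM => //; exact: cvg_cst.
have X10 : 0 <= X + 1 by rewrite addr_ge0// ltW.
have [iP ftcP] := lipschitz_ftc PL X10 (filterS (fun t h t0 => cvgP _ (quotE t (h t0))) cW).
have psiX : psi (X + 1) = 0.
  by have [] := psi0 (X + 1); rewrite // ger0_norm// ltrDl.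
move: ftcP; rewrite {2}/P psiX mul0r sub0r => <-.
rewrite [RHS]Rintegral_mkcond; apply: ae_eq_Rintegral.
- apply: measurable_funM; first exact: measurable_nonneg_time.
  apply: measurable_funD; apply: measurable_funM => //.
  + exact: (lipschitz_measurable WL).
  + exact: continuous_measurable_fun.
  + exact: (measurable_right_derivative WL).
- apply/(measurable_restrictT _ (measurable_itv _))/measurable_funTS.
  exact: (measurable_right_derivative PL).
- have : {ae leb, forall t : RM, t != 0}.
    exists [set 0]; split => //; first exact: lebesgue_measure_set1.
    by move=> t /= /negP; rewrite negbK => /eqP.
  apply: filterS2 cW => t ct t0; rewrite patchE nonneg_timeE.
  have [tn|tp|tE] := ltgtP t 0; last by rewrite tE eqxx in t0.
    by rewrite mul0r memNset//= in_itv/= leNgt tn.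
  rewrite mul1r.
  have [tX|tX] := leP t (X + 1).
    rewrite mem_set; last by rewrite /= in_itv/= (ltW tp).
    by rewrite (right_derivativeE (quotE t (ct tp))).
  rewrite memNset; last by rewrite /= in_itv/= (ltW tp)/= leNgt tX.
  have [-> ->] : psi t = 0 /\ dpsi t = 0.
    by apply: psi0; rewrite gtr0_norm// (lt_trans _ tX)// ltrDl.
  by rewrite !mul0r addr0.
Qed.

End integration_by_parts_lipschitz.

Section core_inequality.
Context {R : realType}.
Local Notation RM := (measurableTypeR R).
Local Notation leb := (@lebesgue_measure R).
Local Notation theta := (@nonneg_time R).

Lemma cell_index_shift (dx a x : R) : 0 < dx ->
  cell_index dx a (x + dx) = cell_index dx a x + 1.
Proof.
move=> dx0; rewrite /cell_index.
have -> : (x + dx - a) / dx + 2^-1 = (x - a) / dx + 2^-1 + 1%:~R.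
  by field; rewrite gt_eqF.
by rewrite floorDrz ?intr_int// intrKfloor.
Qed.

Variables (phi : R * R -> R) (X B : R).
Hypotheses (phi_C1c : C1c phi) (X0 : 0 < X) (B0 : 0 <= B).
Hypotheses (bphi : boxed X B phi) (bDx : boxed X B (Dx phi)) (bDt : boxed X B (Dt phi)).
Variables (dx a : R).
Hypotheses (dx0 : 0 < dx) (dx1 : dx <= 1).
Let idx := cell_index dx a.
Variables (w q Q err : int -> R -> R) (L Bw Bq BQ Be : R).
Hypotheses (Bw0 : 0 <= Bw) (Bq0 : 0 <= Bq) (Be0 : 0 <= Be).
Hypothesis wL : forall i s t, `|w i s - w i t| <= L * `|s - t|.
Hypothesis wB : forall i t, `|w i t| <= Bw.
Hypotheses (mq : forall i, measurable_fun setT (q i : RM -> RM)) (qB : forall i t, `|q i t| <= Bq).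
Hypothesis QB : forall i t, `|Q i t| <= BQ.
Hypotheses (merr : forall i, measurable_fun setT (err i : RM -> RM))
  (errB : forall i t, `|err i t| <= Be).
Hypothesis Qq : forall i t, `|Q i t - q i t| <= err i t.
Hypothesis w_cvg : forall i, {ae leb, forall t, 0 < t -> cvgn (right_quotient (w i) ^~ t)}.
Hypothesis w_le : {ae leb, forall t, 0 < t -> forall x,
  phi (x, t) * (right_derivative (w (idx x)) t + (Q (idx x) t - Q (idx x - 1) t) / dx) <= 0}.

Let midx i : measurable ([set x | idx x = i] : set RM).
Proof. exact: measurable_cell. Qed.

Let W (z : R * R) := w (idx z.1) z.2.
Let D (z : R * R) := right_derivative (w (idx z.1)) z.2.
Let q' (z : R * R) := q (idx z.1) z.2.
Let err' (z : R * R) := err (idx z.1) z.2.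
Let hq := hquot phi dx.

Let mW : measurable_fun setT (W : RM * RM -> RM).
Proof. by apply: measurable_glue => // i; exact: lipschitz_measurable (wL i). Qed.

Let mD : measurable_fun setT (D : RM * RM -> RM).
Proof.
apply: (@measurable_glue _ idx (fun i => right_derivative (w i))) => // i.
exact: measurable_right_derivative (wL i).
Qed.

Let mq' : measurable_fun setT (q' : RM * RM -> RM).
Proof. exact: measurable_glue. Qed.

Let merr' : measurable_fun setT (err' : RM * RM -> RM).
Proof. exact: measurable_glue. Qed.

Let right_derivative_le i t : `|right_derivative (w i) t| <= L.
Proof.
have L0 : 0 <= L := lipschitz_ge0 (wL i).
have bnd n := norm_right_quotient (wL i) n t.
have bf : bounded_fun (right_quotient (w i) ^~ t).
  exists L; split; first exact: num_real.
  by move=> M LM n _ /=; apply: le_trans (bnd n) (ltW LM).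
have lb n : - L <= right_quotient (w i) n t by have := bnd n; rewrite ler_norml => /andP[].
have ub n : right_quotient (w i) n t <= L by have := bnd n; rewrite ler_norml => /andP[].
have supn n : - L <= sups (right_quotient (w i) ^~ t) n <= L.
  apply/andP; split.
    apply: le_trans (lb n) _; apply: ub_le_sup; last by exists n => /=.
    by exists L => _ [k _ <-].
  apply: ge_sup; last by move=> _ [k _ <-].
  by exists (right_quotient (w i) n t); exists n => /=.
rewrite /right_derivative limn_supE// ler_norml; apply/andP; split.
  apply: lb_le_inf; first by exists (sups (right_quotient (w i) ^~ t) 0%N); exists 0%N.
  by move=> _ [n _ <-]; have /andP[] := supn n.
have /andP[_ h] := supn 0%N; apply: le_trans h; apply: ge_inf; last by exists 0%N.
by exists (- L) => _ [n _ <-]; have /andP[] := supn n.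
Qed.

Let mtheta : measurable_fun setT ((fun z => theta z.2) : RM * RM -> RM).
Proof. exact: (measurableT_comp measurable_nonneg_time measurable_snd). Qed.

Let theta1 (z : R * R) : `|theta z.2| <= 1.
Proof. by have /andP[? ?] := nonneg_time01 z.2; rewrite ger0_norm. Qed.

Let bhq : boxed (X + 1) B hq.
Proof. exact: (boxed_hquot phi_C1c B0 bphi bDx dx0 dx1). Qed.

Let L0 : 0 <= L. Proof. exact: lipschitz_ge0 (wL 0). Qed.

Let bM Y C' M (F G : R * R -> R) : 0 <= M -> boxed Y C' F ->
  measurable_fun setT (G : RM * RM -> RM) -> (forall z, `|G z| <= M) ->
  boxed Y (C' * 1 * M) (fun z => F z * theta z.2 * G z).
Proof. by move=> M0 bF mG GM; apply: boxedM_bounded => //; exact: boxedM_bounded. Qed.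

Let bF1 := bM Bw0 bDt mW (fun z => wB _ _).
Let bF2 := bM L0 bphi mD (fun z => right_derivative_le _ _).
Let bF3 := bM Bq0 bDx mq' (fun z => qB _ _).
Let bF4 := bM Bq0 bhq mq' (fun z => qB _ _).

Let bahq : boxed (X + 1) B (fun z => `|hq z|).
Proof.
split; first by apply: measurableT_comp => //; exact: bhq.1.
by move=> z; rewrite normr_id; exact: bhq.2.
Qed.

Let bF5 := bM Be0 bahq merr' (fun z => errB _ _).

Let F1 z := Dt phi z * theta z.2 * W z.
Let F2 z := phi z * theta z.2 * D z.
Let F3 z := Dx phi z * theta z.2 * q' z.
Let F4 z := hq z * theta z.2 * q' z.
Let F5 z := `|hq z| * theta z.2 * err' z.

Let parts_x x : \int[leb]_t F1 (x, t) + \int[leb]_t F2 (x, t) = - (phi (x, 0) * w (idx x) 0).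
Proof.
have i1 := boxed_integrable_t bF1 x.
have i2 := boxed_integrable_t bF2 x.
rewrite -RintegralD//.
transitivity (\int[leb]_t (theta t * (Dt phi (x, t) * w (idx x) t +
    phi (x, t) * right_derivative (w (idx x)) t))).
  by apply: eq_Rintegral => t _; rewrite /F1 /F2 /W /D/=; ring.
apply: (@lipschitz_by_parts _ (fun t => phi (x, t)) (fun t => Dt phi (x, t))
  (w (idx x)) X B L Bw) => //.
- by move=> t; exact: is_derive_t.
- exact: (boxed_t bDt x).1.
- by move=> t; exact: (boxed_bound B0 bphi).
- by move=> s t; exact: (lipschitz_t phi_C1c B0 bDt).
- move=> t Xt; split.
    by apply: (boxed_out (z := (x, t)) bphi); rewrite /= Xt orbT.
  by apply: (boxed_out (z := (x, t)) bDt); rewrite /= Xt orbT.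
Qed.

Let flux_x t : 0 < t ->
  (forall x, phi (x, t) * (right_derivative (w (idx x)) t + (Q (idx x) t - Q (idx x - 1) t) / dx) <= 0) ->
  \int[leb]_x F2 (x, t) <= \int[leb]_x F4 (x, t) + \int[leb]_x F5 (x, t).
Proof.
move=> t0 ht.
have th : theta t = 1 by rewrite nonneg_timeE ltW.
pose f x := phi (x, t).
pose Qs x := Q (idx x) t.
have mQs : measurable_fun setT (Qs : RM -> RM).
  exact: (measurable_step (fun i => Q i t) midx).
have QsB x : `|Qs x| <= BQ by exact: QB.
have fi : leb.-integrable setT (EFin \o f) by exact: (boxed_integrable_x bphi t).
have hi : leb.-integrable setT (EFin \o (fun x => hq (x, t))).
  exact: (boxed_integrable_x bhq t).
have Qs_shift x : Qs (x - dx) = Q (idx x - 1) t.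
  rewrite /Qs /idx -[in RHS](subrK dx x) cell_index_shift//.
  by rewrite addrK.
have mQs' : measurable_fun setT ((fun x => Qs (x - dx)) : RM -> RM).
  exact: (measurableT_comp mQs (measurable_shift (- dx))).
have i1 := integrable_mul_bounded fi mQs QsB.
have i2 := integrable_mul_bounded fi mQs' (fun x => QsB (x - dx)).
have i3 : leb.-integrable setT (EFin \o (fun x => f (x + dx) * Qs x)).
  exact: (integrable_mul_bounded (integrable_shift dx fi) mQs QsB).
have i4 := integrable_mul_bounded hi mQs QsB.
have i5 := boxed_integrable_x bF2 t.
have i6 := boxed_integrable_x bF4 t.
have i7 := boxed_integrable_x bF5 t.
have iB : leb.-integrable setT (EFin \o (fun x => f x * Qs (x - dx) - f x * Qs x)).
  exact: (integrableB measurableT i2 i1).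
have iB3 : leb.-integrable setT (EFin \o (fun x => f (x + dx) * Qs x - f x * Qs x)).
  exact: (integrableB measurableT i3 i1).
apply: (@le_trans _ _ (\int[leb]_x (dx^-1 * (f x * Qs (x - dx) - f x * Qs x)))).
  apply: le_Rintegral => //; first exact: (integrableZl measurableT dx^-1 iB).
  move=> x _; rewrite /F2 /D /= th mulr1 Qs_shift -subr_ge0.
  rewrite -[X in _ <= X]opprK oppr_ge0.
  by move: (ht x); apply: le_trans; rewrite le_eqVlt; apply/orP; left; apply/eqP;
    rewrite /f /Qs; field; rewrite gt_eqF.
rewrite RintegralZl// RintegralB//.
have -> : \int[leb]_x (f x * Qs (x - dx)) = \int[leb]_x (f (x + dx) * Qs x).
  rewrite -(Rintegral_shift dx i2); apply: eq_Rintegral => x _.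
  by rewrite addrK.
rewrite -RintegralB// -RintegralZl//.
apply: (@le_trans _ _ (\int[leb]_x (F4 (x, t) + F5 (x, t)))); last by rewrite RintegralD.
apply: le_Rintegral => //.
- exact: (integrableZl measurableT dx^-1 iB3).
- exact: (integrableD measurableT i6 i7).
move=> x _; rewrite /F4 /F5 /= th !mulr1.
have -> : dx^-1 * (f (x + dx) * Qs x - f x * Qs x) = hq (x, t) * Qs x.
  by rewrite /hq /hquot /f /=; field; rewrite gt_eqF.
have -> : hq (x, t) * Qs x = hq (x, t) * q' (x, t) + hq (x, t) * (Qs x - q' (x, t)).
  by ring.
rewrite lerD2l (le_trans (ler_norm _))// normrM ler_wpM2l//.
exact: Qq.
Qed.

Lemma core_inequality :
  - (\int[lebesgue2 R]_z (`|hq z| * theta z.2 * err' z)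
     + Bq * \int[lebesgue2 R]_z `|Dx phi z - hq z|) <=
  \int[lebesgue2 R]_z (Dt phi z * theta z.2 * W z + Dx phi z * theta z.2 * q' z)
  + \int[leb]_x (phi (x, 0) * w (idx x) 0).
Proof.
have I1 := boxed_integrable bF1.
have I2 := boxed_integrable bF2.
have I3 := boxed_integrable bF3.
have I4 := boxed_integrable bF4.
have I5 := boxed_integrable bF5.
have E12 : \int[lebesgue2 R]_z F1 z + \int[lebesgue2 R]_z F2 z =
    - \int[leb]_x (phi (x, 0) * w (idx x) 0).
  rewrite (boxed_fubini_xt bF1) (boxed_fubini_xt bF2) -RintegralD//.
  - under eq_Rintegral do rewrite parts_x.
    under eq_Rintegral do rewrite -mulN1r.
    rewrite RintegralZl// ?mulN1r//.
    apply: (@integrable_mul_bounded _ _ _ leb (fun x => phi (x, 0)) _ Bw).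
    + exact: (boxed_integrable_x bphi 0).
    + exact: (measurable_step (fun i => w i 0) midx).
    + by move=> x; exact: wB.
  - exact: integrable_int_t bF1.
  - exact: integrable_int_t bF2.
have E2 : \int[lebesgue2 R]_z F2 z <= \int[lebesgue2 R]_z F4 z + \int[lebesgue2 R]_z F5 z.
  rewrite (boxed_fubini_tx bF2) (boxed_fubini_tx bF4) (boxed_fubini_tx bF5).
  rewrite -RintegralD//; [|exact: integrable_int_x bF4|exact: integrable_int_x bF5].
  apply: ae_le_Rintegral.
  - exact: integrable_int_x bF2.
  - exact: (integrableD measurableT (integrable_int_x bF4) (integrable_int_x bF5)).
  have FF := ae_filter_ringOfSetsType leb.
  have : {ae leb, forall t : RM, t != 0}.
    exists [set 0]; split => //; first exact: lebesgue_measure_set1.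
    by move=> t /= /negP; rewrite negbK => /eqP.
  apply: filterS2 w_le => t ht t0.
  have [tn|tp|tE] := ltgtP t 0; last by rewrite tE eqxx in t0.
    have th : theta t = 0 by rewrite nonneg_timeE leNgt tn.
    have Z (F G : R -> R) : \int[leb]_x (F x * theta t * G x) = 0.
      rewrite -[RHS](_ : \int[leb]_x (cst 0 x : R) = 0).
        by apply: eq_Rintegral => x _; rewrite th mulr0 mul0r.
      by rewrite Rintegral_cst// mul0r.
    by rewrite /F2 /F4 /F5/= !Z addr0.
  by apply: flux_x => //; exact: ht.
have ibD : (lebesgue2 R).-integrable setT (EFin \o (fun z => Dx phi z - hq z)).
  exact: (integrableB measurableT (boxed_integrable bDx) (boxed_integrable bhq)).
have E34 : - (Bq * \int[lebesgue2 R]_z `|Dx phi z - hq z|) <=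
    \int[lebesgue2 R]_z F3 z - \int[lebesgue2 R]_z F4 z.
  rewrite -RintegralB// lerNl.
  apply: le_trans (ler_norm _) _; rewrite normrN -RintegralZl//; last exact: integrable_norm ibD.
  apply: norm_Rintegral_le => //.
  - by apply: measurable_funB; [exact: bF3.1|exact: bF4.1].
  - exact: (integrableZl measurableT Bq (integrable_norm ibD)).
  - move=> z _; 
    have -> : F3 z - F4 z = (Dx phi z - hq z) * (theta z.2 * q' z).
      by rewrite /F3 /F4; ring.
    rewrite normrM mulrC ler_wpM2r//.
    rewrite normrM -[leRHS]mul1r ler_pM//.
    exact: qB.
rewrite RintegralD//.
rewrite -/F1 -/F3 -/F5.
by move: E12 E2 E34; lra.
Qed.

End core_inequality.

Section weak_bounded_variation.
Context {R : realType}.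
Local Notation RM := (measurableTypeR R).
Local Notation leb := (@lebesgue_measure R).
Local Notation theta := (@nonneg_time R).

(** Small jumps are absorbed by e, large ones by their r-th power; this
    replaces Hoelder's inequality. *)
Lemma le_add_powR (r e x : R) : 1 <= r -> 0 < e -> 0 <= x ->
  x <= e + e `^ (1 - r) * x `^ r.
Proof.
move=> r1 e0 x0; have [xe|ex] := leP x e.
  by rewrite (le_trans xe)// lerDl mulr_ge0// powR_ge0.
have x_gt0 : 0 < x by exact: lt_trans ex.
rewrite (@le_trans _ _ (e `^ (1 - r) * x `^ r))//; last by rewrite lerDr ltW.
have -> : x `^ r = x * x `^ (r - 1).
  have xN0 : (1 + (r - 1) == 0) ==> (x != 0) by rewrite [x == 0]gt_eqF ?implybT.
  by rewrite -{1}(subrK 1 r) addrC (powRD xN0) powRr1// ltW.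
rewrite -opprB powRN mulrCA -[leLHS]mulr1 ler_wpM2l// mulrC ler_pdivlMr ?powR_gt0// mul1r.
by rewrite ge0_ler_powR ?nnegrE ?subr_ge0// ltW.
Qed.

Lemma cell_index_shiftz (dx a x : R) (c : int) : 0 < dx ->
  cell_index dx a (x + c%:~R * dx) = cell_index dx a x + c.
Proof.
move=> dx0; rewrite /cell_index.
have -> : (x + c%:~R * dx - a) / dx + 2^-1 = (x - a) / dx + 2^-1 + c%:~R.
  by field; rewrite gt_eqF.
by rewrite floorDrz ?intr_int// intrKfloor.
Qed.

Lemma lebesgue_measure_cell (dx a : R) (i : int) : 0 < dx ->
  leb ([set x | cell_index dx a x = i] : set RM) = dx%:E.
Proof.
move=> dx0; rewrite (_ : mkset _ =
    `[midpoint dx a i - dx / 2, midpoint dx a i + dx / 2[%classic); last first.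
  apply/seteqP; split => x /=; rewrite in_itv/=.
    by move=> /(cell_indexP _ _ _ dx0).
  by move=> h; apply/(cell_indexP _ _ _ dx0).
rewrite lebesgue_measure_itv/= lte_fin ifT; last by lra.
by rewrite -EFinD; congr EFin; field.
Qed.

Lemma integral_step_esum (dx a : R) (g : int -> R) : 0 < dx -> (forall i, 0 <= g i) ->
  (\int[leb]_x (g (cell_index dx a x))%:E =
   \esum_(i in [set: int]) ((g i * dx)%R%:E))%E.
Proof.
move=> dx0 g0; set idx := cell_index dx a.
have midx i : measurable ([set x | idx x = i] : set RM) by exact: measurable_cell.
pose F (n : nat) : set RM := [set x | pickle (idx x) = n].
have FE i : F (pickle i) = [set x | idx x = i].
  by apply/seteqP; split => x /=; [exact: (pcan_inj (@pickleK _))|exact: congr1].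
have F0 n : ~ range (pickle : int -> nat) n -> F n = set0.
  by move=> h; apply/seteqP; split => x //= xn; apply: h; exists (idx x).
have mF n : measurable (F n).
  by have [[i _ <-]|h] := pselect (range (pickle : int -> nat) n); [rewrite FE|rewrite F0].
have mg : measurable_fun setT ((fun x => g (idx x)) : RM -> RM) by exact: measurable_step.
have FT : setT = \bigcup_n F n.
  by apply/seteqP; split => x // _; exists (pickle (idx x)).
rewrite FT ge0_integral_bigcup//; first last.
- by apply/trivIsetP => m n _ _ mn; apply/seteqP; split => x //= [hm hn]; rewrite -hm hn eqxx in mn.
- by move=> x _; rewrite lee_fin.
- by rewrite -FT; exact/measurable_EFinP.
rewrite nneseries_esumT => [|n]; last by apply: integral_ge0 => x _; rewrite lee_fin.
have -> : (\esum_(n in [set: nat]) \int[leb]_(x in F n) (g (idx x))%:E =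
    \esum_(n in range (pickle : int -> nat)) \int[leb]_(x in F n) (g (idx x))%:E)%E.
  rewrite [RHS]esum_mkcond; apply: eq_esum => n _.
  case: ifPn => //; rewrite notin_setE => /F0 ->.
  by rewrite integral_set0.
rewrite esum_image; last by move=> i j _ _ /(pcan_inj pickleK).
apply: eq_esum => i _; rewrite FE.
transitivity (\int[leb]_(x in [set x | idx x = i]) (cst (g i)%:E x))%E.
  by apply: eq_integral => x; rewrite inE/= => ->.
by rewrite integral_cst// EFinM; congr (_ * _)%E; exact: lebesgue_measure_cell.
Qed.

Section estimate.
Variables (dx a : R) (delta : int -> R -> R) (M Y r : R).
Hypotheses (dx0 : 0 < dx) (M0 : 0 <= M) (r1 : 1 <= r).
Hypothesis mdelta : forall i, measurable_fun setT (delta i : RM -> RM).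
Hypothesis delta_ge0 : forall i t, 0 <= delta i t.
Hypothesis delta_le : forall i t, delta i t <= M.
Let idx := cell_index dx a.

Let midx i : measurable ([set x | idx x = i] : set RM).
Proof. exact: measurable_cell. Qed.

Let boxed_box : boxed Y 1 (box Y).
Proof.
by split; [exact: measurable_box|move=> z; rewrite mul1r ger0_norm// box_ge0].
Qed.

Let mtheta : measurable_fun setT ((fun z => theta z.2) : RM * RM -> RM).
Proof. exact: (measurableT_comp measurable_nonneg_time measurable_snd). Qed.

Let theta_ge0 t : 0 <= theta t. Proof. by have /andP[] := nonneg_time01 t. Qed.
Let theta_le1 t : theta t <= 1. Proof. by have /andP[] := nonneg_time01 t. Qed.

Let powd (i : int) t := delta i t `^ r.

Let mpowd i : measurable_fun setT (powd i : RM -> RM).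
Proof. exact: (measurableT_comp (measurable_powR r) (mdelta i)). Qed.

Let powd_ge0 i t : 0 <= powd i t. Proof. exact: powR_ge0. Qed.

Let powd_le i t : powd i t <= M `^ r.
Proof.
by rewrite /powd ge0_ler_powR ?nnegrE// (le_trans _ r1).
Qed.

Let S (t : R) : \bar R := (\esum_(i in [set: int]) ((powd i t * dx)%R%:E))%E.

Let mS : measurable_fun setT (S : RM -> \bar R).
Proof.
have -> : S = fubini_G leb (EFin \o (fun z : RM * RM => powd (idx z.1) z.2)).
  by apply/funext => t; rewrite /S -(integral_step_esum a dx0).
apply: measurable_fun_fubini_tonelli_G => /=; last by move=> z; rewrite lee_fin.
by apply/measurable_EFinP; exact: measurable_glue.
Qed.

Let mdc c : measurable_fun setT ((fun z => delta (idx z.1 + c) z.2) : RM * RM -> RM).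
Proof. by apply: (@measurable_glue _ idx (fun i => delta (i + c))). Qed.

Let mpc c : measurable_fun setT ((fun z => powd (idx z.1 + c) z.2) : RM * RM -> RM).
Proof. by apply: (@measurable_glue _ idx (fun i => powd (i + c))). Qed.

Let bdelta c : boxed Y (1 * 1 * M) (fun z => box Y z * theta z.2 * delta (idx z.1 + c) z.2).
Proof.
apply: boxedM_bounded => //.
  by apply: boxedM_bounded => // z; rewrite ger0_norm.
by move=> z; rewrite ger0_norm.
Qed.

Let bpow c : boxed Y (1 * 1 * M `^ r) (fun z => box Y z * theta z.2 * powd (idx z.1 + c) z.2).
Proof.
apply: boxedM_bounded => //; first exact: powR_ge0.
  by apply: boxedM_bounded => // z; rewrite ger0_norm.
by move=> z; rewrite ger0_norm.
Qed.

Let int_powd c t : (\int[leb]_x (powd (idx x + c) t)%:E = S t)%E.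
Proof.
have mp : measurable_fun setT ((fun x => (powd (idx x) t)%:E) : RM -> \bar R).
  by apply/measurable_EFinP; exact: (measurable_step (fun i => powd i t)).
rewrite /S -(integral_step_esum a dx0)//.
rewrite -(ge0_integral_shift (c%:~R * dx) mp)//; last by move=> x; rewrite lee_fin.
by apply: eq_integral => x _; rewrite /idx cell_index_shiftz.
Qed.

Lemma jump_integral_le (e : R) (c : int) : 0 < e ->
  ((\int[lebesgue2 R]_z (box Y z * theta z.2 * delta (idx z.1 + c) z.2))%:E <=
   (e * \int[lebesgue2 R]_z box Y z)%:E + (e `^ (1 - r))%:E *
     \int[leb]_(t in `[0%R, Y]) \esum_(i in [set: int]) ((delta i t `^ r * dx)%R%:E))%E.
Proof.
move=> e0.
have iB := boxed_integrable boxed_box.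
have iP := boxed_integrable (bpow c).
apply: (@le_trans _ _ ((e * \int[lebesgue2 R]_z box Y z +
    e `^ (1 - r) * \int[lebesgue2 R]_z (box Y z * theta z.2 * powd (idx z.1 + c) z.2))%:E)).
  rewrite lee_fin -!RintegralZl// -RintegralD//; first last.
  - exact: (integrableZl measurableT _ iP).
  - exact: (integrableZl measurableT _ iB).
  apply: le_Rintegral => //; first exact: boxed_integrable (bdelta c).
    exact: (integrableD measurableT (integrableZl measurableT e iB)
      (integrableZl measurableT (e `^ (1 - r)) iP)).
  move=> z _; have b0 := box_ge0 Y z; have t0 := theta_ge0 z.2.
  have b1 := box_le1 Y z; have t1 := theta_le1 z.2.
  have h := le_add_powR r1 e0 (delta_ge0 (idx z.1 + c) z.2).
  apply: (@le_trans _ _ (box Y z * theta z.2 * (e + e `^ (1 - r) * powd (idx z.1 + c) z.2))).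
    by rewrite ler_wpM2l// mulr_ge0.
  rewrite -subr_ge0 (_ : _ - _ = (1 - theta z.2) * (e * box Y z)); last by ring.
  by rewrite !mulr_ge0 ?subr_ge0// ltW.
rewrite EFinD leeD2l// EFinM lee_wpmul2l ?lee_fin ?powR_ge0//.
rewrite /Rintegral fineK; last exact: integrable_fin_num.
rewrite fubini_tonelli2/=; first last.
- by move=> z; rewrite lee_fin !mulr_ge0// box_ge0.
- by apply/measurable_EFinP; exact: (bpow c).1.
rewrite [leRHS]integral_mkcond; apply: ge0_le_integral => //.
- by move=> t _; apply: integral_ge0 => x _; rewrite lee_fin !mulr_ge0// box_ge0.
- rewrite -[X in measurable_fun _ X]/(fubini_G leb
      (fun z : RM * RM => (box Y z * theta z.2 * powd (idx z.1 + c) z.2)%:E)).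
  apply: measurable_fun_fubini_tonelli_G => /=.
    by apply/measurable_EFinP; exact: (bpow c).1.
  by move=> z; rewrite lee_fin !mulr_ge0// box_ge0.
- by apply/(measurable_restrictT _ (measurable_itv _))/measurable_funTS.
move=> t _; rewrite patchE; case: ifPn => [_|].
  rewrite -[leRHS]/(S t) -(int_powd c t); apply: ge0_le_integral => //.
  - by move=> x _; rewrite lee_fin !mulr_ge0// box_ge0.
  - by apply/measurable_EFinP; exact: (boxed_x (bpow c) t).1.
  - apply/measurable_EFinP.
    exact: (measurable_step (fun i => powd (i + c) t)).
  - move=> x _; rewrite lee_fin ler_piMl//.
    by rewrite mulr_ile1 ?box_ge0 ?box_le1.
rewrite notin_setE/= in_itv/= => /negP; rewrite negb_and => h.
rewrite [leLHS](_ : _ = 0%E)//; apply: integral0_eq => x _ /=; congr EFin.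
suff -> : box Y (x, t) * theta t = 0 by rewrite mul0r.
move: h; rewrite -!ltNge => /orP[t0|tY].
  by rewrite nonneg_timeE leNgt t0 mulr0.
rewrite /box/= (_ : \1_(`[- Y, Y]) t = 0) ?mulr0 ?mul0r//.
by rewrite indicE memNset//= in_itv/= [t <= Y]leNgt tY andbF.
Qed.

End estimate.

Lemma jump_integral_cvg0 (dxs as_ : nat -> R) (delta : nat -> int -> R -> R)
    (M Y r : R) (c : int) :
  (forall n, 0 < dxs n) -> 0 <= M -> 1 <= r ->
  (forall n i, measurable_fun setT (delta n i : RM -> RM)) ->
  (forall n i t, 0 <= delta n i t) -> (forall n i t, delta n i t <= M) ->
  (fun n => \int[leb]_(t in `[0%R, Y]) \esum_(i in [set: int])
     ((delta n i t `^ r * dxs n)%R%:E))%E @ \oo --> 0%E ->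
  (fun n => \int[lebesgue2 R]_z (box Y z * theta z.2 *
     delta n (cell_index (dxs n) (as_ n) z.1 + c) z.2)) @ \oo --> (0 : R).
Proof.
move=> dx0 M0 r1 md d0 dM bv.
apply/cvgrPdist_le => e e0.
set A := \int[lebesgue2 R]_z box Y z.
have A0 : 0 <= A by apply: Rintegral_ge0 => z _; exact: box_ge0.
pose eps := e / 2 / (A + 1).
have eps0 : 0 < eps by rewrite !divr_gt0// ltr_wpDl.
have epsA : eps * A <= e / 2.
  rewrite /eps mulrAC ler_pdivrMr ?ltr_wpDl// ler_wpM2l ?lerDl//.
  by rewrite divr_ge0 ?ltW.
pose k := e / 2 / eps `^ (1 - r).
have p0 : 0 < eps `^ (1 - r) by exact: powR_gt0.
have k0 : 0 < k by rewrite !divr_gt0.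
have small : \forall n \near \oo, ((\int[leb]_(t in `[0%R, Y]) \esum_(i in [set: int])
     ((delta n i t `^ r * dxs n)%R%:E)) < k%:E)%E.
  have := bv; move=> /fine_cvgP[fin] /cvgrPdist_lt/(_ k k0) h.
  apply: filterS2 fin h => n fn; rewrite /= sub0r normrN => hn.
  by rewrite -(fineK fn) lte_fin (le_lt_trans (ler_norm _)).
apply: filterS small => n hn.
rewrite sub0r normrN ger0_norm; last first.
  by apply: Rintegral_ge0 => z _; rewrite !mulr_ge0 ?box_ge0//; have /andP[] := nonneg_time01 z.2.
rewrite -lee_fin; apply: le_trans (@jump_integral_le (dxs n) (as_ n) (delta n) M Y r
  (dx0 n) M0 r1 (md n) (d0 n) (dM n) eps c eps0) _.
rewrite -/A (splitr e) EFinD; apply: leeD; first by rewrite lee_fin.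
apply: (@le_trans _ _ ((eps `^ (1 - r))%:E * k%:E)%E).
  by rewrite lee_wpmul2l ?lee_fin ?ltW.
by rewrite -EFinM lee_fin /k mulrC divfK// gt_eqF.
Qed.

End weak_bounded_variation.

Section grid_solutions.
Context {R : realType} {N : nat}.
Local Notation V := 'rV[R]_N.
Local Notation RM := (measurableTypeR R).
Local Notation leb := (@lebesgue_measure R).

Definition norm_ball (M : R) : set V := [set y | `|y| <= M].

Lemma norm_ball_closed M : closed (norm_ball M).
Proof.
have -> : norm_ball M = (fun y : V => `|y|) @^-1` [set x | x <= M] by [].
apply: closed_comp; last exact: closed_le.
by move=> y _; exact: norm_continuous.
Qed.

Lemma norm_ball_compact M : compact (norm_ball M).
Proof.
apply: bounded_closed_compact; last exact: norm_ball_closed.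
exists M; split; first exact: num_real.
by move=> M' MM' y /= h; apply: le_trans h (ltW MM').
Qed.

Lemma bounded_on_ball (W : normedModType R) (g : V -> W) M : continuous g ->
  exists2 B, 0 <= B & forall y, `|y| <= M -> `|g y| <= B.
Proof.
move=> cg.
have [B0 [_ hB]] := compact_bounded (continuous_compact (continuous_subspaceT cg)
  (@norm_ball_compact M)).
exists (`|B0| + 1); first by rewrite addr_ge0.
move=> y yM; apply: (hB _ _ (g y)).
  by rewrite (le_lt_trans (ler_norm _))// ltrDl.
by exists y.
Qed.

(** The values entering the flux at an interface run through neighbouring cells,
    so that they differ by sums of jumps. *)
Lemma stencil_jump m (v : int -> V) i (l : 'I_(2 * m)) : (0 < m)%N ->
  `|@stencil R N m v i l - v i| <=
    \sum_(j < 2 * m) `|v (i - m%:Z + 1 + (j : nat)%:Z + 1) - v (i - m%:Z + 1 + (j : nat)%:Z)|.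
Proof.
move=> m0; rewrite /stencil.
pose b := i - m%:Z + 1; pose x (j : nat) := v (b + j%:Z).
have -> : v i = x m.-1.
  by rewrite /x /b; congr v; rewrite -{1}(prednK m0) -addn1 PoszD; ring.
have -> : v (i - m%:Z + 1 + (l : nat)%:Z) = x l by [].
have main (j k : nat) : (j <= k)%N -> (k <= 2 * m)%N ->
    `|x k - x j| <= \sum_(j < 2 * m) `|x j.+1 - x j|.
  move=> jk km; rewrite -(telescope_sumr x jk).
  apply: le_trans (ler_norm_sum _ _ _) _.
  rewrite -(big_mkord xpredT (fun j => `|x j.+1 - x j|)).
  rewrite (@big_cat_nat _ _ _ j 0 (2 * m))//= ?(leq_trans jk)//.
  rewrite (@big_cat_nat _ _ _ k j (2 * m))//= addrCA lerDl addr_ge0//;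
    by rewrite sumr_ge0.
have -> : \sum_(j < 2 * m) `|v (i - m%:Z + 1 + (j : nat)%:Z + 1) - v (i - m%:Z + 1 + (j : nat)%:Z)|
    = \sum_(j < 2 * m) `|x j.+1 - x j|.
  by apply: eq_bigr => j _; rewrite /x /b -(addn1 j) PoszD !addrA.
have [lm|lm] := leqP l m.-1; last by apply: main; [exact: ltnW|exact: ltnW].
rewrite distrC; apply: main => //; rewrite (leq_trans (leq_pred _))//.
by rewrite mul2n -addnn leq_addr.
Qed.

Lemma consistent_flux_bounded (W : normedModType R) m (g : V -> W)
    (G : R -> int -> ('I_(2 * m) -> V) -> W) M :
  continuous g -> consistent_flux g G -> 0 <= M ->
  exists2 B, 0 <= B & forall (dx : R) i (v : int -> V), 0 < dx ->
    (forall j, `|v j| <= M) -> `|G dx i (@stencil R N m v i)| <= B.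
Proof.
move=> cg [m0 _ /(_ _ (@norm_ball_compact M))[c c0 hc]] M0.
have [B B0 hB] := bounded_on_ball M cg.
exists (B + c * \sum_(l < 2 * m) (M + M)).
  by rewrite addr_ge0// mulr_ge0 ?(ltW c0)// sumr_ge0// => i _; rewrite addr_ge0.
move=> dx i v dx0 vM.
have h := hc dx i v dx0 (fun l => vM _).
rewrite -[G _ _ _](subrK (g (v i))) addrC (le_trans (ler_normD _ _))// lerD ?hB//.
apply: le_trans h _; rewrite ler_wpM2l ?(ltW c0)// ler_sum// => l _.
by rewrite (le_trans (ler_normB _ _))// lerD// vM.
Qed.

Section one_solution.
Variables (p : nat) (F : R -> int -> ('I_(2 * p) -> V) -> V) (dx a : R) (u0 : R -> V)
  (u : int -> R -> V).
Hypotheses (dx0 : 0 < dx) (sol : scheme_solution F dx a u0 u).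

Let c i k t : R := rV_coord k (u i t).

Lemma grid_right_continuous i k t : 0 <= t -> c i k @ t^'+ --> c i k t.
Proof.
move=> t0; have [ig _] := sol.2 i k t 1 t0 ler01.
have tt1 : t < t + 1 by rewrite ltrDl.
have h := parameterized_integral_cvg_left tt1 ig.
have h' : c i k t - dx^-1 * parameterized_integral leb t x
    (fun s => rV_coord k (flux_diff F dx u i s)) @[x --> t^'+] --> c i k t.
  rewrite -[X in _ --> X]subr0 -(mulr0 dx^-1); apply: cvgB; first exact: cvg_cst.
  by apply: cvgMr; apply: cvg_at_right_filter.
apply: cvg_trans h'; apply: near_eq_cvg; near=> x.
have tx : t < x by near: x; exact: nbhs_right_gt.
have [_] := sol.2 i k t (x - t) t0 (ltW (eqbRL (subr_gt0 _ _) tx)).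
by rewrite subrKC /c => ->.
Unshelve. all: by end_near. Qed.

(** A value above the almost sure bound would persist for a short time on a
    whole cell, a set of positive measure. *)
Lemma grid_bounded C i t : {ae lebesgue2 R, forall z, half_plane R z ->
    `|cell_field dx a u z| <= C} -> 0 <= t -> `|u i t| <= `|C|.
Proof.
move=> ub t0; apply: le_rV_norm => // k; rewrite leNgt; apply/negP => large.
have : \forall x \near t^'+, `|C| < `|c i k x|.
  have cn := cvg_norm (@grid_right_continuous i k t t0).
  exact: (cvgr_gt _ (cn _) _ large).
move=> [d /= d0 hd].
pose A1 : set RM := [set x | cell_index dx a x = i].
pose A2 : set RM := `]t, (t + d)[%classic.
pose A : set (RM * RM) := A1 `*` A2.
have mc : measurable A1 by exact: measurable_cell.
have md : measurable A2 by exact: measurable_itv.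
have mA : measurable A by exact: measurableX.
have nA : (lebesgue2 R).-negligible A.
  apply: negligibleS ub => -[x s] [/= xi].
  rewrite /A2 /= in_itv => /andP[/= ts sd] h.
  have := h (le_trans t0 (ltW ts)).
  rewrite /cell_field /= xi; apply/negP; rewrite -ltNge.
  apply: lt_le_trans (coord_le_norm _ k); apply: le_lt_trans (ler_norm C) _.
  by apply: hd => //=; rewrite ltr0_norm ?subr_lt0// opprB ltrBlDl.
have : (leb A1 * leb A2 = 0)%E.
  rewrite -(product_measure1E leb leb mc md).
  exact: (measure_negligible mA nA).
rewrite lebesgue_measure_cell// lebesgue_measure_itv/= lte_fin ltrDl d0.
rewrite -EFinD addrAC subrr add0r -EFinM => -[] /eqP.
by rewrite mulf_eq0 !gt_eqF.
Qed.

Lemma grid_lipschitz B i k s t : (forall s, 0 <= s -> `|flux_diff F dx u i s| <= B) ->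
  0 <= s -> 0 <= t -> `|c i k s - c i k t| <= B / dx * `|s - t|.
Proof.
move=> hB; wlog st : s t / t <= s.
  move=> h s0 t0; have [ts|/ltW st] := leP t s; first exact: h.
  by rewrite distrC [`|s - t|]distrC; exact: h.
move=> s0 t0; have st0 : 0 <= s - t by rewrite subr_ge0.
have [ig] := sol.2 i k t (s - t) t0 st0; rewrite subrKC /c => ->.
rewrite addrAC subrr add0r normrN normrM gtr0_norm ?invr_gt0//.
rewrite mulrC mulrAC ler_wpM2r ?invr_ge0 ?(ltW dx0)// [`|s - t|]ger0_norm//.
rewrite subrKC in ig.
have mI : measurable (`[t, s]%classic : set RM) by exact: measurable_itv.
apply: le_trans (le_normr_Rintegral mI ig) _.
have -> : B * (s - t) = \int[leb]_(x in `[t, s]) B.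
  by rewrite Rintegral_cst//= lebesgue_measure_itv/= lte_fin lt_neqAle st andbT;
     case: eqVneq => [->|_] /=; rewrite ?subrr.
apply: le_Rintegral => //.
- exact: integrable_norm.
- apply: continuous_compact_integrable; first exact: segment_compact.
  by apply: continuous_subspaceT => x; exact: cvg_cst.
move=> x; rewrite /= in_itv/= => /andP[tx _].
by apply: le_trans (coord_le_norm _ _) _; rewrite hB// (le_trans t0).
Qed.

(** Lebesgue's differentiation theorem on each interval [0, n]. *)
Lemma grid_derivable i k : {ae leb, forall t, 0 < t ->
  derivable (c i k) t 1 /\
  derive1 (c i k) t = - (dx^-1 * rV_coord k (flux_diff F dx u i t))}.
Proof.
set g := fun s => rV_coord k (flux_diff F dx u i s).
have FF := ae_filter_ringOfSetsType leb.
have h n : {ae leb, forall t, 0 < t < n%:R -> derivable (c i k) t 1 /\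
    derive1 (c i k) t = - (dx^-1 * g t)}.
  have [ig _] := sol.2 i k 0 n%:R (lexx _) (ler0n _ _); rewrite add0r in ig.
  have mI : measurable (`[0, n%:R]%classic : set RM) by exact: measurable_itv.
  pose gn := g \_ `[0, n%:R].
  have ign : leb.-integrable setT (EFin \o gn).
    by rewrite /gn -restrict_EFin; apply/(integrable_mkcond _ mI).
  have lgn : locally_integrable setT gn.
    by apply: open_integrable_locally => //; exact: openT.
  have iy y : leb.-integrable [set` Interval (BLeft 0) (BRight y)] (EFin \o gn).
    by apply: integrableS ign => //; exact: measurable_itv.
  have := FTC1 iy lgn.
  apply: filterS => t h /andP[t0 tn].
  pose G (x : R) := \int[leb]_(s in [set` Interval (BLeft 0) (BRight x)]) gn s.
  have [dG G'] : derivable G t 1 /\ derive1 G t = gn t.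
    by apply: h; rewrite /= lte_fin.
  have cE : {near t, (fun x => c i k 0 - dx^-1 * G x) =1 c i k}.
    near=> x.
    have x0 : 0 <= x by apply: ltW; near: x; exact: lt_nbhsr.
    have xn : x < n%:R by near: x; exact: lt_nbhsl.
    have [_] := sol.2 i k 0 x (lexx _) x0; rewrite add0r /c => ->.
    congr (_ - _ * _); apply: eq_Rintegral => y; rewrite inE/= in_itv/= => /andP[y0 yx].
    by rewrite /gn patchE mem_set//= in_itv/= y0 (le_trans yx)// ltW.
  have dd : is_derive t (1 : R) (fun x => c i k 0 - dx^-1 * G x) (- (dx^-1 * g t)).
    have dG' : is_derive t (1 : R) G (g t).
      apply: DeriveDef dG _; rewrite -(derive1E G t) G' /gn patchE mem_set//= in_itv/=.
      by rewrite (ltW t0) (ltW tn).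
    by apply: is_derive_eq; rewrite add0r mul1r.
  split; first exact: (near_eq_derivable cE).
  rewrite derive1E -(near_eq_derive _ cE); exact: derive_val.
have := ae_foralln h; apply: filterS => t ht t0.
by apply: (ht (Num.truncn t).+1); rewrite t0/= truncnS_gt.
Unshelve. all: by end_near. Qed.

End one_solution.

End grid_solutions.

Section lipschitz_entropies.
Context {R : realType} {N : nat}.
Local Notation V := 'rV[R]_N.

Definition lipschitz_on_ball (M : R) (g : V -> R) := exists2 L, 0 <= L &
  forall y z, `|y| <= M -> `|z| <= M -> `|g y - g z| <= L * `|y - z|.

(** The segment from y to z can be prolonged by a unit length beyond z, where
    the function is still bounded; convexity then bounds the slope. *)
Lemma convex_lipschitz_on_ball (g : V -> R) M : convex_function [set: V] g ->
  continuous g -> lipschitz_on_ball M g.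
Proof.
move=> cvx cg; have [B B0 hB] := bounded_on_ball (M + 1) cg.
exists (B + B); first by rewrite addr_ge0.
have main y z : `|y| <= M -> `|z| <= M -> g z - g y <= (B + B) * `|y - z|.
  move=> yM zM; have [->|yz] := eqVneq y z; first by rewrite !subrr normr0 mulr0.
  set d := `|y - z|.
  have d0 : 0 < d by rewrite normr_gt0 subr_eq0.
  have d1 : 0 < 1 + d by rewrite ltr_wpDr ?ltW.
  pose z' := z + d^-1 *: (z - y).
  have z'M : `|z'| <= M + 1.
    rewrite (le_trans (ler_normD _ _))// lerD// normrZ distrC -/d.
    by rewrite gtr0_norm ?invr_gt0// mulVf// gt_eqF.
  pose l := d / (1 + d).
  have l0 : 0 <= l by rewrite divr_ge0// ltW.
  have l1 : l <= 1 by rewrite ler_pdivrMr// mul1r lerDr.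
  have ld : l <= d by rewrite ler_pdivrMr// ler_peMr ?(ltW d0)// lerDl ltW.
  have zE : z = l *: z' + (1 - l) *: y.
    rewrite /z' scalerDr scalerA.
    have -> : l * d^-1 = (1 + d)^-1 by rewrite /l; field; rewrite !gt_eqF.
    have -> : 1 - l = (1 + d)^-1 by rewrite /l; field; rewrite gt_eqF.
    rewrite -addrA -scalerDr subrK -scalerDl.
    have -> : l + (1 + d)^-1 = 1 by rewrite /l; field; rewrite gt_eqF.
    by rewrite scale1r.
  have h := cvx (Itv01 l0 l1) z' y (mem_set I) (mem_set I).
  have {}h : g z <= l * g z' + (1 - l) * g y by rewrite {1}zE; exact: h.
  have hz' := hB _ z'M; have hy : `|g y| <= B by apply: hB; rewrite (le_trans yM)// lerDl.
  apply: (@le_trans _ _ (l * (g z' - g y))); first by lra.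
  apply: (@le_trans _ _ (l * (B + B))); last by rewrite mulrC ler_wpM2l// addr_ge0.
  rewrite ler_wpM2l// (le_trans (ler_norm _))// (le_trans (ler_normB _ _))//.
  by rewrite lerD.
move=> y z yM zM; rewrite ler_norml; have := main y z yM zM; have := main z y zM yM.
by rewrite [`|z - y|]distrC => *; apply/andP; split; lra.
Qed.

Lemma coord_lipschitz_on_ball M k : lipschitz_on_ball M (rV_coord k : V -> R).
Proof.
exists 1 => // y z _ _; rewrite mul1r.
by have := coord_le_norm (y - z) k; rewrite !mxE.
Qed.

End lipschitz_entropies.

Section asymptotics.
Context {R : realType} {N : nat}.
Local Notation V := 'rV[R]_N.
Local Notation RM := (measurableTypeR R).
Local Notation leb := (@lebesgue_measure R).
Local Notation theta := (@nonneg_time R).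

(** Grid functions are extended to negative times by their initial values. *)
Definition forward (v : int -> R -> V) (i : int) (t : R) : V := v i (Num.max t 0).

Lemma forwardE v i t : 0 <= t -> forward v i t = v i t.
Proof. by move=> t0; rewrite /forward max_l. Qed.

Lemma dist_max0 (s t : R) : `|Num.max s 0 - Num.max t 0| <= `|s - t|.
Proof.
wlog st : s t / s <= t.
  by move=> h; case/orP: (le_total s t) => ?; [|rewrite distrC [leRHS]distrC]; exact: h.
have st' : Num.max s 0 <= Num.max t 0.
  by rewrite ge_max !le_max lexx st !orbT.
rewrite distrC [leRHS]distrC ger0_norm ?subr_ge0// ger0_norm ?subr_ge0//.
by move: st st'; have [] := leP s 0; have [] := leP t 0; lra.
Qed.

Section one_grid_function.
Variables (p : nat) (F : R -> int -> ('I_(2 * p) -> V) -> V) (f : V -> V).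
Variables (dx a : R) (u0 : R -> V) (u : int -> R -> V) (M : R).
Hypotheses (cf : continuous f) (Ff : consistent_flux f F) (M0 : 0 <= M).
Hypotheses (dx0 : 0 < dx) (sol : scheme_solution F dx a u0 u).
Hypothesis uM : forall i t, 0 <= t -> `|u i t| <= M.

Lemma forward_le i t : `|forward u i t| <= M.
Proof. by rewrite uM// le_max lexx orbT. Qed.

Lemma forward_lipschitz : exists2 L, 0 <= L &
  forall i s t, `|forward u i s - forward u i t| <= L * `|s - t|.
Proof.
have [B B0 hB] := consistent_flux_bounded cf Ff M0.
exists ((B + B) / dx); first by rewrite divr_ge0 ?addr_ge0// ltW.
move=> i s t.
apply: le_rV_norm; first by rewrite mulr_ge0// divr_ge0 ?addr_ge0// ltW.
move=> k; rewrite /forward !mxE.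
apply: le_trans (grid_lipschitz dx0 sol (B := B + B) (i := i) k _ _ _) _.
- move=> x x0; rewrite /flux_diff (le_trans (ler_normB _ _))// lerD//;
    by apply: hB => // j; exact: uM.
- by rewrite le_max lexx orbT.
- by rewrite le_max lexx orbT.
by rewrite ler_wpM2l ?dist_max0// divr_ge0 ?addr_ge0// ltW.
Qed.

Lemma forward_continuous i : continuous (forward u i).
Proof.
have [L L0 hL] := forward_lipschitz.
move=> x; apply/cvgrPdist_le => e e0.
have L1 : 0 < L + 1 by rewrite ltr_wpDl.
near=> y; apply: le_trans (hL _ _ _) _.
apply: (@le_trans _ _ ((L + 1) * `|x - y|)).
  by rewrite ler_wpM2r// lerDl.
rewrite -ler_pdivlMl//.
near: y; apply: cvgr_dist_le; first exact: cvg_id.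
by rewrite mulr_gt0 ?invr_gt0.
Unshelve. all: by end_near. Qed.

Lemma measurable_forward (g : V -> R) i : continuous g ->
  measurable_fun setT ((fun t => g (forward u i t)) : RM -> RM).
Proof.
move=> cg; apply: continuous_measurable_fun => t.
apply: continuous_comp; [exact: forward_continuous|exact: cg].
Qed.

Lemma forward_derivable : {ae leb, forall t, 0 < t -> forall i,
  derivable (u i) t 1 /\ forall k : 'I_N, derive1 (fun s => rV_coord k (u i s)) t =
    - (dx^-1 * rV_coord k (flux_diff F dx u i t))}.
Proof.
have FF := ae_filter_ringOfSetsType leb.
have h n : {ae leb, forall t, 0 < t -> forall (i : int) (k : 'I_N), n = pickle (i, k) ->
    derivable (fun s => rV_coord k (u i s)) t 1 /\
    derive1 (fun s => rV_coord k (u i s)) t = - (dx^-1 * rV_coord k (flux_diff F dx u i t))}.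
  case nE : (unpickle n : option (int * 'I_N)) => [[i k]|]; last first.
    apply: filterS (filterT : almost_everywhere leb setT) => t _ t0 i k nE'.
    by rewrite nE' pickleK in nE.
  apply: filterS (grid_derivable sol i k) => t h t0 i' k' nE'.
  by move: nE; rewrite nE' pickleK => -[-> ->]; exact: h.
have := ae_foralln h; apply: filterS => t {}h t0 i; split; last first.
  by move=> k; have [_] := h _ t0 i k erefl.
apply/derivable_mxP => j k; rewrite (ord1 j).
by have [] := h _ t0 i k erefl.
Qed.

(** At almost every time the chain rule applies to all cells at once. *)
Lemma forward_entropy_derivable (eta : V -> R) : (forall y, differentiable eta y) ->
  {ae leb, forall t, 0 < t -> forall i, derivable (eta \o u i) t 1 /\
    right_quotient (fun s => eta (forward u i s)) ^~ t @ \oo --> derive1 (eta \o u i) t}.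
Proof.
move=> de; have FF := ae_filter_ringOfSetsType leb.
apply: filterS forward_derivable => t h t0 i; have [du _] := h t0 i.
have d1 : derivable (eta \o u i) t 1.
  apply/derivable1_diffP/differentiable_comp; last exact: de.
  exact/derivable1_diffP.
split=> //.
have E : {near t, eta \o u i =1 (fun s => eta (forward u i s))}.
  near=> s; rewrite /= forwardE//; apply: ltW; near: s; exact: lt_nbhsr.
have -> : derive1 (eta \o u i) t = derive1 (fun s => eta (forward u i s)) t.
  by rewrite !derive1E; exact: near_eq_derive.
by apply: right_quotient_derivable; exact: near_eq_derivable E d1.
Unshelve. all: by end_near. Qed.

End one_grid_function.

End asymptotics.

Section asymptotic_inequality.
Context {R : realType} {N : nat}.
Local Notation V := 'rV[R]_N.
Local Notation RM := (measurableTypeR R).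
Local Notation leb := (@lebesgue_measure R).
Local Notation theta := (@nonneg_time R).

Definition weak_form (phi : R * R -> R) (eta q : V -> R) (w : R * R -> V) : R :=
  \int[lebesgue2 R]_z (Dt phi z * theta z.2 * eta (w z) + Dx phi z * theta z.2 * q (w z)) +
  \int[leb]_x (phi (x, 0) * eta (w (x, 0))).

Definition forward_field (dx a : R) (v : int -> R -> V) (z : R * R) : V :=
  forward v (cell_index dx a z.1) z.2.

Variables (p : nat) (F : R -> int -> ('I_(2 * p) -> V) -> V) (f : V -> V).
Variables (dxs as_ : nat -> R) (U0 : nat -> R -> V) (U : nat -> int -> R -> V) (M r : R).
Hypotheses (cf : continuous f) (Ff : consistent_flux f F) (M0 : 0 <= M) (r1 : 1 <= r).
Hypotheses (dx0 : forall n, 0 < dxs n) (dxs_cvg : dxs @ \oo --> (0 : R)).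
Hypothesis sol : forall n, scheme_solution F (dxs n) (as_ n) (U0 n) (U n).
Hypothesis UM : forall n i t, 0 <= t -> `|U n i t| <= M.
Hypothesis bv : forall T : R, 0 < T ->
  (fun n => \int[leb]_(t in `[0%R, T]) \esum_(i in [set: int])
     ((`|U n (i + 1) t - U n i t| `^ r) * dxs n)%R%:E)%E @ \oo --> 0%E.

Let W n := forward (U n).
Let delta n i t := `|W n (i + 1) t - W n i t|.

Let W_le n i t : `|W n i t| <= M.
Proof. exact: forward_le (UM n) _ _. Qed.

Let delta_le n i t : delta n i t <= M + M.
Proof. by rewrite (le_trans (ler_normB _ _))// lerD. Qed.

Let mdelta n i : measurable_fun setT (delta n i : RM -> RM).
Proof.
apply: continuous_measurable_fun => t; apply: cvg_norm; apply: cvgB;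
  exact: (forward_continuous cf Ff M0 (dx0 n) (sol n) (UM n)).
Qed.

Variable phi : R * R -> R.
Hypothesis phi_C1c : C1c phi.

(** The jumps weighted by a box tend to zero by the weak bound on variations. *)
Let jumps_cvg0 Y c : 0 < Y -> (fun n => \int[lebesgue2 R]_z (box Y z * theta z.2 *
     delta n (cell_index (dxs n) (as_ n) z.1 + c) z.2)) @ \oo --> (0 : R).
Proof.
move=> Y0; apply: (@jump_integral_cvg0 _ dxs as_ delta (M + M) Y r) => //.
- by rewrite addr_ge0.
- by move=> n i t; exact: normr_ge0.
rewrite (_ : (fun n => _) = (fun n => \int[leb]_(t in `[0%R, Y]) \esum_(i in [set: int])
     ((`|U n (i + 1) t - U n i t| `^ r) * dxs n)%R%:E)%E); first exact: bv.
apply/funext => n.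
apply: eq_integral => t; rewrite inE/= in_itv/= => /andP[t0 _].
by apply: eq_esum => i _; rewrite /delta /W !forwardE.
Qed.

Let shift_cvg0 (X B : R) : 0 < X -> 0 <= B -> boxed X B phi -> boxed X B (Dx phi) ->
  exists2 e : nat -> R, e @ \oo --> (0 : R) &
    forall n, dxs n <= 1 -> \int[lebesgue2 R]_z `|Dx phi z - hquot phi (dxs n) z| <= e n.
Proof.
move=> X0 B0 bphi bDx.
pose hs n := Num.min (dxs n) 1.
have hs0 n : 0 < hs n by rewrite lt_min dx0 ltr01.
have hs1 n : hs n <= 1 by rewrite ge_min lexx orbT.
have hs_cvg : hs @ \oo --> (0 : R).
  apply: (@squeeze_cvgr _ _ _ _ (cst 0) dxs) => //; last exact: cvg_cst.
  by apply: nearW => n; rewrite ltW//= ge_min lexx.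
exists (fun n => \int[lebesgue2 R]_z `|Dx phi z - hquot phi (hs n) z|); last first.
  by move=> n n1; rewrite /hs min_l.
have bq n := boxed_hquot phi_C1c B0 bphi bDx (hs0 n) (hs1 n).
have mD n : measurable_fun setT ((fun z => `|Dx phi z - hquot phi (hs n) z|) : RM * RM -> RM).
  by apply: measurableT_comp => //; apply: measurable_funB; [exact: bDx.1|exact: (bq n).1].
have [] := @Rdominated_cvg _ (RM * RM)%type R (lebesgue2 R) setT measurableT
  (fun n z => `|Dx phi z - hquot phi (hs n) z|) (cst 0)
  (fun z => B * box X z + B * box (X + 1) z) mD (measurable_cst _).
- apply/aeW => z _; rewrite -(normr0 R); apply: cvg_norm.
  rewrite -(subrr (Dx phi z)); apply: cvgB; first exact: cvg_cst.
  exact: hquot_cvg.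
- exact: (integrableD measurableT (integrableZl measurableT B (integrable_box X))
    (integrableZl measurableT B (integrable_box (X + 1)))).
- move=> n z _; rewrite normr_id (le_trans (ler_normB _ _))// lerD//.
    exact: bDx.2.
  exact: (bq n).2.
by move=> _; rewrite Rintegral_cst// mul0r.
Qed.

Variables (eta q : V -> R) (m : nat) (Q : R -> int -> ('I_(2 * m) -> V) -> R).
Hypotheses (eta_diff : forall y, differentiable eta y) (cq : continuous q).
Hypotheses (eta_lip : lipschitz_on_ball M eta) (Qq : consistent_flux q Q).
Hypothesis sgn : forall n, {ae leb, forall t, 0 < t -> forall i x,
  phi (x, t) * (derive1 (eta \o U n i) t + (dxs n)^-1 * flux_diff Q (dxs n) (U n) i t) <= 0}.

(** The discrete inequality passes to the test function up to an error made of
    the jumps and of the difference quotients of the test function. *)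
Lemma asymptotic_inequality : exists2 e : nat -> R, e @ \oo --> (0 : R) &
  forall n, dxs n <= 1 ->
    - e n <= weak_form phi eta q (forward_field (dxs n) (as_ n) (U n)).
Proof.
have [X X0 [B B0 [bphi bDx bDt]]] := C1c_box phi_C1c.
have ceta : continuous eta by move=> y; exact: differentiable_continuous.
have [Bw Bw0 hBw] := bounded_on_ball M ceta.
have [Bq Bq0 hBq] := bounded_on_ball M cq.
have [BQ BQ0 hBQ] := consistent_flux_bounded cq Qq M0.
have [m0 _ /(_ _ (@norm_ball_compact R N M))[c c0 hc]] := Qq.
have [Le Le0 hLe] := eta_lip.
have [e1 e1_cvg e1P] := shift_cvg0 X0 B0 bphi bDx.
pose jump n (j : 'I_(2 * m)) := \int[lebesgue2 R]_z (box (X + 1) z * theta z.2 *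
  delta n (cell_index (dxs n) (as_ n) z.1 + (1 - m%:Z + (j : nat)%:Z)) z.2).
pose k := c * (2 * m)%:R.
have k0 : 0 <= k by rewrite mulr_ge0 ?(ltW c0).
exists (fun n => B * (k * \sum_(j < 2 * m) jump n j) + Bq * e1 n).
  rewrite -[X in _ --> X](_ : B * (k * \sum_(j < 2 * m) 0) + Bq * 0 = 0); last first.
    by rewrite big1_eq !mulr0 addr0.
  apply: cvgD; last by apply: cvgMr.
  do 2 apply: cvgMr; apply: cvg_sum_seq => j.
  by apply: jumps_cvg0; rewrite addr_gt0.
move=> n n1; set idx := cell_index (dxs n) (as_ n).
have [L L0 hL] := forward_lipschitz cf Ff M0 (dx0 n) (sol n) (UM n).
pose err i t := k * \sum_(j < 2 * m) delta n (i + (1 - m%:Z + (j : nat)%:Z)) t.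
have merr i : measurable_fun setT (err i : RM -> RM).
  apply: measurable_funM => //; apply: measurable_sum => j.
  exact: mdelta.
have errB i t : `|err i t| <= k * ((M + M) *+ (2 * m)).
  rewrite ger0_norm; last by rewrite mulr_ge0// sumr_ge0// => j _; exact: normr_ge0.
  rewrite ler_wpM2l//.
  apply: le_trans (ler_sum _ (fun j _ => delta_le n _ t)) _.
  by rewrite sumr_const card_ord.
have stW t i : 0 < t -> (@stencil R N m ((U n)^~ t) i) = @stencil R N m ((W n)^~ t) i.
  by move=> t0; apply/funext => l; rewrite /stencil /W forwardE// ltW.
have wL i s t : `|eta (W n i s) - eta (W n i t)| <= (Le * L) * `|s - t|.
  apply: le_trans (hLe _ _ (W_le _ _ _) (W_le _ _ _)) _.
  by rewrite -mulrA ler_wpM2l//; exact: hL.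
have Qerr i t : `|Q (dxs n) i (@stencil R N m ((W n)^~ t) i) - q (W n i t)| <= err i t.
  apply: le_trans (hc (dxs n) i ((W n)^~ t) (dx0 n) (fun l => W_le _ _ _)) _.
  rewrite /err /k -mulrA ler_wpM2l ?(ltW c0)//.
  apply: le_trans (ler_sum _ (fun l _ => stencil_jump _ _ l m0)) _.
  rewrite sumr_const card_ord mulr_natl lerMn2r; apply/orP; right.
  apply: ler_sum => j _; rewrite /delta.
  by have -> : i - m%:Z + 1 + (j : nat)%:Z = i + (1 - m%:Z + (j : nat)%:Z) by ring.
have ae_der := forward_entropy_derivable (sol n) eta_diff.
have FF := ae_filter_ringOfSetsType leb.
apply: le_trans (core_inequality phi_C1c X0 B0 bphi bDx bDt (dx0 n) n1
  (w := fun i t => eta (W n i t)) (q := fun i t => q (W n i t))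
  (Q := fun i t => Q (dxs n) i (@stencil R N m ((W n)^~ t) i)) (err := err)
  (Bw := Bw) (Bq := Bq) (Be := k * ((M + M) *+ (2 * m))) (a := as_ n) (BQ := BQ)
  Bw0 Bq0 _ wL (fun i t => hBw _ (W_le n i t)) _ (fun i t => hBq _ (W_le n i t)) _ merr errB Qerr _ _);
  first last.
- apply: filterS2 ae_der (sgn n) => t h hs t0 x.
  have [_ hr] := h t0 (idx x).
  have := hs t0 (idx x) x.
  rewrite /flux_diff.
  rewrite (stW t (idx x) t0).
  rewrite (stW t (idx x - 1) t0).
  rewrite [(dxs n)^-1 * _]mulrC.
  rewrite -(right_derivativeE hr).
  apply.
- move=> i; apply: filterS ae_der => t h t0.
  by have [_ hr] := h t0 i; apply: cvgP hr.
- by move=> i t; apply: hBQ.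
- by move=> i; apply: (measurable_forward cf Ff M0 (dx0 n) (sol n) (UM n)).
- by rewrite mulr_ge0// mulrn_wge0// addr_ge0.
rewrite lerN2 lerD//; last by rewrite ler_wpM2l// e1P.
have theta_ge0 t : 0 <= theta t by have /andP[] := nonneg_time01 t.
have theta_le1 t : theta t <= 1 by have /andP[] := nonneg_time01 t.
have mtheta : measurable_fun setT ((fun z => theta z.2) : RM * RM -> RM).
  exact: (measurableT_comp measurable_nonneg_time measurable_snd).
have midx i : measurable ([set x | idx x = i] : set RM) by exact: measurable_cell.
have bbox : boxed (X + 1) 1 (box (X + 1)).
  by split; [exact: measurable_box|move=> z; rewrite mul1r ger0_norm// box_ge0].
have bjump (j : 'I_(2 * m)) : boxed (X + 1) (1 * 1 * (M + M)) (fun z =>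
    box (X + 1) z * theta z.2 * delta n (idx z.1 + (1 - m%:Z + (j : nat)%:Z)) z.2).
  apply: boxedM_bounded; first by rewrite addr_ge0.
  - by apply: boxedM_bounded => // z; rewrite ger0_norm.
  - by apply: (@measurable_glue _ idx (fun i => delta n (i + _))).
  - by move=> z; rewrite ger0_norm ?normr_ge0// delta_le.
have bhq := boxed_hquot phi_C1c B0 bphi bDx (dx0 n) n1.
have berr : boxed (X + 1) (B * 1 * (k * ((M + M) *+ (2 * m)))) (fun z =>
    `|hquot phi (dxs n) z| * theta z.2 * err (idx z.1) z.2).
  apply: boxedM_bounded; first by rewrite mulr_ge0// mulrn_wge0// addr_ge0.
  - apply: boxedM_bounded => //; last by move=> z; rewrite ger0_norm.
    split; first by apply: measurableT_comp => //; exact: bhq.1.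
    by move=> z; rewrite normr_id; exact: bhq.2.
  - by apply: (@measurable_glue _ idx err).
  - by move=> z; exact: errB.
have ij j := boxed_integrable (bjump j).
have [isum Esum] := Rintegral_sum (index_enum 'I_(2 * m)) ij.
have iksum := integrableZl measurableT k isum.
rewrite /jump -Esum -RintegralZl// -RintegralZl//.
apply: le_Rintegral => //.
- exact: boxed_integrable berr.
- exact: (integrableZl measurableT B iksum).
move=> z _; have hz := bhq.2 z.
rewrite /err -/idx.
have -> : B * (k * \sum_(j < 2 * m) box (X + 1) z * theta z.2 *
    delta n (idx z.1 + (1 - m%:Z + (j : nat)%:Z)) z.2) =
    (B * box (X + 1) z) * (theta z.2 * (k * \sum_(j < 2 * m)
      delta n (idx z.1 + (1 - m%:Z + (j : nat)%:Z)) z.2)).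
  by rewrite -mulr_sumr; ring.
rewrite -mulrA ler_wpM2r// mulr_ge0// mulr_ge0// sumr_ge0// => j _.
exact: normr_ge0.
Qed.
End asymptotic_inequality.

Section random_fields.
Context {R : realType} {N : nat}.
Local Notation V := 'rV[R]_N.
Local Notation BV := (borel_rV R N).
Context {d' : measure_display} {Omega : measurableType d'} (P : probability Omega R).

Let cst_integrable (B : R) : P.-integrable setT (EFin \o cst B).
Proof. exact: finite_measure_integrable_cst. Qed.

Lemma integrable_bounded_expectation (Y : Omega -> R) B : measurable_fun setT Y ->
  (forall w, `|Y w| <= B) -> P.-integrable setT (EFin \o Y).
Proof.
move=> mY YB.
exact: (@integrable_leR _ _ _ _ setT measurableT _ (cst B) mY (cst_integrable B)
  (fun w _ => YB w)).
Qed.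

Lemma norm_expectation_le (Y : Omega -> R) B : measurable_fun setT Y ->
  (forall w, `|Y w| <= B) -> `|\int[P]_w Y w| <= B.
Proof.
move=> mY YB.
apply: le_trans (norm_Rintegral_le measurableT mY (cst_integrable B) (fun w _ => YB w)) _.
have -> : \int[P]_w cst B w = B * fine (P setT) by exact: Rintegral_cst.
by rewrite probability_setT mulr1.
Qed.

Lemma pairing_law (Y : Omega -> V) (nu : probability BV R) (g : V -> R) B :
  measurable_fun setT (Y : Omega -> BV) ->
  (forall F : set BV, measurable F -> nu F = P [set w | F (Y w)]) ->
  continuous g -> (forall w, `|g (Y w)| <= B) ->
  pairing nu g = (\int[P]_w g (Y w))%:E.
Proof.
move=> mY law cg gB.
have mg : measurable_fun setT (g : BV -> measurableTypeR R).
  exact: measurable_continuous_rV.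
have mgY : measurable_fun setT (fun w => g (Y w)) by exact: (measurableT_comp mg mY).
have ig := integrable_bounded_expectation mgY gB.
pose X : {mfun Omega >-> BV} :=
  MeasurableFun.Pack (MeasurableFun.Class (isMeasurableFun.Build _ _ Omega BV Y mY)).
rewrite /pairing (eq_measure_integral (distribution P X)); last first.
  by move=> A mA _; exact: (law A mA).
rewrite /distribution integral_pushforward//; last exact/measurable_EFinP.
by rewrite /Rintegral fineK//; exact: (integrable_fin_num measurableT ig).
Qed.

Lemma fubini_expectation d (T : measurableType d) (mu : {sigma_finite_measure set T -> \bar R})
    (G : Omega -> T -> R) (h : T -> R) :
  measurable_fun setT (fun p : Omega * T => G p.1 p.2) ->
  mu.-integrable setT (EFin \o h) -> (forall w z, `|G w z| <= h z) ->
  [/\ measurable_fun setT (fun w => \int[mu]_z G w z),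
      forall w, `|\int[mu]_z G w z| <= \int[mu]_z h z,
      measurable_fun setT (fun z => \int[P]_w G w z) &
      \int[P]_w \int[mu]_z G w z = \int[mu]_z \int[P]_w G w z].
Proof.
move=> mG ih Gh.
have mGw w : measurable_fun setT (G w) by exact: (measurableT_comp mG (pair1_measurable w)).
have mGz z : measurable_fun setT (G ^~ z) by exact: (measurableT_comp mG (pair2_measurable z)).
have iGw w : mu.-integrable setT (EFin \o G w).
  exact: (@integrable_leR _ _ _ _ setT measurableT _ _ (mGw w) ih (fun z _ => Gh w z)).
have iGz z : P.-integrable setT (EFin \o G ^~ z).
  exact: integrable_bounded_expectation (mGz z) (fun w => Gh w z).
pose GE : Omega * T -> \bar R := EFin \o (fun p : Omega * T => G p.1 p.2).
have iG : (P \x mu)%E.-integrable setT GE.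
  apply/integrable12ltyP; first exact/measurable_EFinP.
  apply: (@le_lt_trans _ _ (\int[P]_w (\int[mu]_z h z)%:E)%E).
    apply: ge0_le_integral => //.
    - by move=> w _; apply: integral_ge0.
    - apply: (@measurable_fun_fubini_tonelli_F _ _ _ _ _ mu (abse \o GE)).
        by apply: measurableT_comp => //; exact/measurable_EFinP.
      by move=> p; exact: abse_ge0.
    move=> w _; rewrite /Rintegral fineK; last exact: (integrable_fin_num measurableT ih).
    apply: ge0_le_integral => //.
    - have mE : measurable_fun setT (fun z => `|G w z|).
        by apply: measurableT_comp => //; exact: mGw.
      exact/measurable_EFinP.
    - exact: (measurable_int _ ih).
    - by move=> z _; rewrite lee_fin.
  apply: (@le_lt_trans _ _ ((\int[mu]_z h z)%:E * P setT)%E); last first.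
    by rewrite probability_setT mule1 ltry.
  by rewrite integral_cst.
have FE : EFin \o (fun w => \int[mu]_z G w z) = fubini_F mu GE.
  apply/funext => w; rewrite /fubini_F /Rintegral/= fineK//.
  exact: (integrable_fin_num measurableT (iGw w)).
have FG : EFin \o (fun z => \int[P]_w G w z) = fubini_G P GE.
  apply/funext => z; rewrite /fubini_G /Rintegral/= fineK//.
  exact: (integrable_fin_num measurableT (iGz z)).
split.
- by apply/measurable_EFinP; rewrite FE; exact: measurable_fubini_F iG.
- by move=> w; exact: (norm_Rintegral_le measurableT (mGw w) ih (fun z _ => Gh w z)).
- by apply/measurable_EFinP; rewrite FG; exact: measurable_fubini_G iG.
rewrite [LHS]/Rintegral [RHS]/Rintegral; congr fine.
transitivity (\int[P]_w fubini_F mu GE w)%E.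
  by apply: eq_integral => w _; exact: (congr1 (@^~ w) FE).
rewrite integral12_prod_meas1// -integral21_prod_meas1//.
by apply: eq_integral => z _; exact: (congr1 (@^~ z) (esym FG)).
Qed.

Lemma measurable_expectation d (T : measurableType d) (G : Omega -> T -> R) B :
  measurable_fun setT (fun p : Omega * T => G p.1 p.2) ->
  (forall w z, `|G w z| <= B) -> measurable_fun setT (fun z => \int[P]_w G w z).
Proof.
move=> mG GB.
have mGz z : measurable_fun setT (G ^~ z) by exact: (measurableT_comp mG (pair2_measurable z)).
have iGz z := integrable_bounded_expectation (mGz z) (fun w => GB w z).
have mh : measurable_fun setT (fubini_G P (fun p : Omega * T => (G p.1 p.2 + B)%:E)).
  apply: measurable_fun_fubini_tonelli_G.
    by apply/measurable_EFinP; exact: measurable_funD.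
  by move=> p; rewrite lee_fin -lerBlDr sub0r; have := GB p.1 p.2; rewrite ler_norml => /andP[].
have E : fubini_G P (fun p : Omega * T => (G p.1 p.2 + B)%:E) =
    EFin \o (fun z => \int[P]_w G w z + \int[P]_w cst B w).
  apply/funext => z; rewrite /fubini_G /= -RintegralD//; last exact: cst_integrable.
  rewrite /Rintegral fineK//; apply: (integrable_fin_num measurableT).
  exact: (integrableD measurableT (iGz z) (cst_integrable B)).
move: mh; rewrite E => /measurable_EFinP mh.
rewrite (_ : (fun z => _) = (fun z => \int[P]_w G w z + \int[P]_w cst B w - \int[P]_w cst B w)).
  exact: measurable_funB mh (measurable_cst _).
by apply/funext => z; rewrite addrK.
Qed.

(** Only the negative parts have to be controlled, and these tend to zero
    pointwise and boundedly. *)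
Lemma expectation_lower_bound (dxs : nat -> R) (S : nat -> Omega -> R) B :
  dxs @ \oo --> (0 : R) ->
  (forall n, measurable_fun setT (S n)) -> (forall n w, `|S n w| <= B) ->
  (forall w, exists2 e : nat -> R, e @ \oo --> (0 : R) &
    forall n, dxs n <= 1 -> - e n <= S n w) ->
  exists2 e : nat -> R, e @ \oo --> (0 : R) & forall n, - e n <= \int[P]_w S n w.
Proof.
move=> dxs_cvg mS SB h.
pose Neg n w := Num.max (- S n w) 0.
have Neg0 n w : 0 <= Neg n w by rewrite le_max lexx orbT.
have mNeg n : measurable_fun setT (Neg n).
  by apply: measurable_maxr => //; exact: measurable_funN.
have NegB n w : `|Neg n w| <= B.
  rewrite ger0_norm// ge_max (le_trans (normr_ge0 _) (SB n w)) andbT.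
  by rewrite (le_trans (ler_norm _))// normrN.
have iS n := integrable_bounded_expectation (mS n) (SB n).
have iN n := integrable_bounded_expectation (mNeg n) (NegB n).
have [] := @Rdominated_cvg _ Omega R P setT measurableT Neg (cst 0) (cst B) mNeg
  (measurable_cst _) _ (cst_integrable B) (fun n w _ => NegB n w).
  apply/aeW => w _; have [e e0 he] := h w.
  have small : \forall n \near \oo, dxs n <= 1 by exact: (cvgr_le _ dxs_cvg _ ltr01).
  apply: (@squeeze_cvgr _ _ _ _ (cst 0) (fun n => `|e n|)); last first.
  - by rewrite -(normr0 R); exact: cvg_norm.
  - exact: cvg_cst.
  apply: filterS small => n n1; rewrite Neg0/= ge_max normr_ge0 andbT.
  by rewrite lerNl (le_trans _ (he n n1))// lerN2 ler_norm.
move=> _; rewrite Rintegral_cst// mul0r => cN.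
exists (fun n => \int[P]_w Neg n w); first exact: cN.
move=> n; rewrite -mulN1r -RintegralZl//; apply: le_Rintegral => //.
  exact: (integrableZl measurableT (-1) (iN n)).
by move=> w _; rewrite mulN1r lerNl le_max lexx.
Qed.

End random_fields.

Section plane_measure.
Context {R : realType}.
Local Notation RM := (measurableTypeR R).
Local Notation leb := (@lebesgue_measure R).

Lemma sigma_finite_plane : sigma_finite setT (lebesgue2 R).
Proof.
have [I IT Ifin] := sigma_finiteT leb.
exists (fun n : nat => if unpickle n is Some (i, j) then I i `*` I j else set0).
  apply/seteqP; split => // -[x t] _.
  have : (\bigcup_i I i) x by rewrite -IT.
  have : (\bigcup_i I i) t by rewrite -IT.
  move=> [j _ jt] [i _ ix]; exists (pickle (i, j)) => //.
  by rewrite pickleK.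
move=> n; case: (unpickle n : option (nat * nat)) => [[i j]|]; last by (split; [exact: measurable0|rewrite (_ : lebesgue2 R set0 = 0%E)]).
have [mi fi] := Ifin i; have [mj fj] := Ifin j; split; first exact: measurableX.
apply: (@le_lt_trans _ _ (leb (I i) * leb (I j))%E).
  by rewrite -(product_measure1E leb leb mi mj).
by apply: lte_mul_pinfty => //; rewrite ge0_fin_numE.
Qed.

Definition plane_measure : set (RM * RM) -> \bar R := (leb \x leb)%E.

HB.instance Definition _ := Measure.on plane_measure.

HB.instance Definition _ :=
  Measure_isSigmaFinite.Build _ _ _ plane_measure sigma_finite_plane.

End plane_measure.

Section passage_to_the_limit.
Context {R : realType} {N : nat}.
Local Notation V := 'rV[R]_N.
Local Notation BV := (borel_rV R N).
Local Notation RM := (measurableTypeR R).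
Local Notation leb := (@lebesgue_measure R).
Local Notation theta := (@nonneg_time R).
Context {d' : measure_display} {Omega : measurableType d'} (P : probability Omega R).
Variables (X : nat -> Omega -> R * R -> V) (M : R).
Hypotheses (M0 : 0 <= M) (XM : forall n w z, `|X n w z| <= M).
Hypothesis mX : forall n, measurable_fun setT (fun p : Omega * (RM * RM) => X n p.1 p.2 : BV).

Let E n (g : V -> R) z : R := \int[P]_w g (X n w z).

Let mtheta : measurable_fun setT ((fun z => theta z.2) : RM * RM -> RM).
Proof. exact: (measurableT_comp measurable_nonneg_time measurable_snd). Qed.

Let theta_le1 (z : R * R) : `|theta z.2| <= 1.
Proof. by have /andP[h0 h1] := nonneg_time01 z.2; rewrite ger0_norm. Qed.

(** Fubini for a weighted expectation over the plane. *)
Let weighted Y B' Bg (h : R * R -> R) (g : V -> R) n : 0 <= Bg -> continuous g ->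
  (forall y, `|y| <= M -> `|g y| <= Bg) -> boxed Y B' h ->
  [/\ measurable_fun setT (fun w => \int[lebesgue2 R]_z (h z * theta z.2 * g (X n w z))),
      forall w, `|\int[lebesgue2 R]_z (h z * theta z.2 * g (X n w z))| <=
        \int[lebesgue2 R]_z (B' * 1 * Bg * box Y z),
      boxed Y (B' * 1 * Bg) (fun z => h z * theta z.2 * E n g z),
      forall w, (lebesgue2 R).-integrable setT (EFin \o (fun z => h z * theta z.2 * g (X n w z))) &
      \int[P]_w \int[lebesgue2 R]_z (h z * theta z.2 * g (X n w z)) =
      \int[lebesgue2 R]_z (h z * theta z.2 * E n g z)].
Proof.
move=> Bg0 cg hg bh.
have mg : measurable_fun setT (g : BV -> measurableTypeR R).
  exact: measurable_continuous_rV.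
have bht : boxed Y (B' * 1) (fun z => h z * theta z.2) by apply: boxedM_bounded.
have mgX : measurable_fun setT (fun p : Omega * (RM * RM) => g (X n p.1 p.2)).
  exact: (measurableT_comp mg (mX n)).
have bG w z : `|h z * theta z.2 * g (X n w z)| <= B' * 1 * Bg * box Y z.
  rewrite normrM mulrAC ler_pM//; first exact: bht.2.
  exact: hg.
have mG : measurable_fun setT (fun p : Omega * (RM * RM) =>
    h p.2 * theta p.2.2 * g (X n p.1 p.2)).
  apply: measurable_funM => //.
  exact: (measurableT_comp bht.1 measurable_snd).
have ih : (@plane_measure R).-integrable setT (EFin \o (fun z => B' * 1 * Bg * box Y z)).
  exact: (integrableZl measurableT (B' * 1 * Bg) (integrable_box Y)).
have [m1 b1 m2 F12] := fubini_expectation P mG ih bG.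
have EE z : \int[P]_w (h z * theta z.2 * g (X n w z)) = h z * theta z.2 * E n g z.
  rewrite RintegralZl//.
  apply: (integrable_bounded_expectation P (B := Bg)); last by move=> w; exact: hg.
  exact: (measurableT_comp mgX (pair2_measurable z)).
split.
- exact: m1.
- exact: b1.
- split; first by have := m2; under eq_fun do rewrite EE.
  move=> z; rewrite -EE; apply: norm_expectation_le => // .
  exact: (measurableT_comp mG (pair2_measurable z)).
- move=> w.
  apply: (@integrable_leR _ (RM * RM)%type R (lebesgue2 R) setT measurableT _ _ _ ih).
    exact: (measurableT_comp mG (pair1_measurable w)).
  by move=> z _; exact: bG.
by transitivity (\int[@plane_measure R]_z \int[P]_w (h z * theta z.2 * g (X n w z)));
  [exact: F12|apply: eq_Rintegral => z _; exact: EE].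
Qed.

Variable phi : R * R -> R.
Hypothesis phi_C1c : C1c phi.
Variables eta q : V -> R.
Hypotheses (ceta : continuous eta) (cq : continuous q).

Lemma expected_weak_form : exists B, forall n,
  [/\ measurable_fun setT (fun w => weak_form phi eta q (X n w)),
      forall w, `|weak_form phi eta q (X n w)| <= B,
      forall w, weak_form phi (fun y => - eta y) (fun y => - q y) (X n w) =
        - weak_form phi eta q (X n w),
      leb.-integrable setT (EFin \o (fun x => phi (x, 0) * E n eta (x, 0))) &
      \int[P]_w weak_form phi eta q (X n w) =
        \int[lebesgue2 R]_z (Dt phi z * theta z.2 * E n eta z + Dx phi z * theta z.2 * E n q z)
        + \int[leb]_x (phi (x, 0) * E n eta (x, 0))].
Proof.
have [Y Y0 [B B0 [bphi bDx bDt]]] := C1c_box phi_C1c.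
have [Be Be0 hBe] := bounded_on_ball M ceta.
have [Bq Bq0 hBq] := bounded_on_ball M cq.
have me : measurable_fun setT (eta : BV -> measurableTypeR R).
  exact: measurable_continuous_rV.
eexists => n.
have [m1 b1 e1 i1 F1] := weighted n Be0 ceta hBe bDt.
have [m2 b2 e2 i2 F2] := weighted n Bq0 cq hBq bDx.
have mi : measurable_fun setT ((fun x => (x, 0)) : RM -> RM * RM).
  by apply/measurable_fun_pairP; split; [exact: measurable_id|exact: measurable_cst].
have mX0 : measurable_fun setT (fun p : Omega * RM => eta (X n p.1 (p.2, 0))).
  have mk : measurable_fun setT (fun p : Omega * RM => (p.1, (p.2, 0)) : Omega * (RM * RM)).
    apply/measurable_fun_pairP; split; first exact: measurable_fst.
    exact: (measurableT_comp mi measurable_snd).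
  exact: (measurableT_comp (measurableT_comp me (mX n)) mk).
have mG : measurable_fun setT (fun p : Omega * RM => phi (p.2, 0) * eta (X n p.1 (p.2, 0))).
  apply: measurable_funM => //.
  exact: (measurableT_comp bphi.1 (measurableT_comp mi measurable_snd)).
have [_ bx] := boxed_x bphi 0.
pose c := B * \1_(`[- Y, Y]) (0 : R) : R.
have ih : leb.-integrable setT (EFin \o (fun x => Be * c * \1_(`[- Y, Y]) x)).
  exact: (integrableZl measurableT (Be * c) (integrable_indic_seg Y)).
have bG w x : `|phi (x, 0) * eta (X n w (x, 0))| <= Be * c * \1_(`[- Y, Y]) x.
  rewrite normrM mulrC -mulrA.
  by apply: ler_pM; [exact: normr_ge0|exact: normr_ge0|exact: hBe|exact: bx].
have [m3 b3 m4 F3] := fubini_expectation P mG ih bG.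
have EE x : \int[P]_w (phi (x, 0) * eta (X n w (x, 0))) = phi (x, 0) * E n eta (x, 0).
  rewrite RintegralZl//.
  apply: (integrable_bounded_expectation P (B := Be)); last by move=> w; exact: hBe.
  exact: (measurableT_comp mX0 (pair2_measurable x)).
pose S1 w := \int[lebesgue2 R]_z (Dt phi z * theta z.2 * eta (X n w z)).
pose S2 w := \int[lebesgue2 R]_z (Dx phi z * theta z.2 * q (X n w z)).
pose S3 w := \int[leb]_x (phi (x, 0) * eta (X n w (x, 0))).
have SE : (fun w => weak_form phi eta q (X n w)) = (fun w => S1 w + S2 w + S3 w).
  by apply/funext => w; rewrite /weak_form RintegralD.
have mS12 : measurable_fun setT (fun w => S1 w + S2 w) by exact: measurable_funD m1 m2.
have bS12 w : `|S1 w + S2 w| <= _ := le_trans (ler_normD _ _) (lerD (b1 w) (b2 w)).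
split.
- by rewrite SE; exact: measurable_funD mS12 m3.
- move=> w; have -> : weak_form phi eta q (X n w) = S1 w + S2 w + S3 w.
    exact: (congr1 (@^~ w) SE).
  exact: le_trans (ler_normD _ _) (lerD (bS12 w) (b3 w)).
- move=> w; rewrite /weak_form opprD -[in RHS]mulN1r -[X in _ = _ + X]mulN1r -!RintegralZl//.
  + congr (_ + _); apply: eq_Rintegral => z _; ring.
  + apply: (@integrable_leR _ RM R leb setT measurableT _ _ _ ih); last by move=> x _; exact: bG.
    exact: (measurableT_comp mG (pair1_measurable w)).
  + exact: (integrableD measurableT (i1 w) (i2 w)).
- apply: (@integrable_leR _ RM R leb setT measurableT _ _ _ ih).
    by have := m4; under eq_fun do rewrite EE.
  move=> x _; rewrite -EE; apply: norm_expectation_le => //.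
  exact: (measurableT_comp mG (pair2_measurable x)).
rewrite SE RintegralD//; first last.
- exact: integrable_bounded_expectation m3 b3.
- exact: integrable_bounded_expectation mS12 bS12.
rewrite RintegralD//; first last.
- exact: integrable_bounded_expectation m2 b2.
- exact: integrable_bounded_expectation m1 b1.
rewrite F1 F2 -RintegralD//; first last.
- exact: boxed_integrable e2.
- exact: boxed_integrable e1.
congr (_ + _); transitivity (\int[leb]_x \int[P]_w (phi (x, 0) * eta (X n w (x, 0)))).
  exact: F3.
by apply: eq_Rintegral => x _; exact: EE.
Qed.

Lemma weak_form_limit (s : nat -> nat) (nu : R * R -> probability BV R) :
  (forall g : V -> R, continuous g ->
    [/\ forall B z, (forall y, `|y| <= M -> `|g y| <= B) ->
          (nu z).-integrable setT ((EFin \o g) : BV -> \bar R) /\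
          `|fine (pairing (nu z) g)| <= B,
        measurable_fun setT ((fun z => fine (pairing (nu z) g)) : RM * RM -> RM) &
        forall psi : R * R -> R, (lebesgue2 R).-integrable setT (EFin \o psi) ->
        (fun n => \int[lebesgue2 R]_z (psi z * E (s n) g z)) @ \oo -->
        \int[lebesgue2 R]_z (psi z * fine (pairing (nu z) g))]) ->
  [/\ (fun n => \int[lebesgue2 R]_z
         (Dt phi z * theta z.2 * E (s n) eta z + Dx phi z * theta z.2 * E (s n) q z)) @ \oo -->
      \int[lebesgue2 R]_z (Dt phi z * theta z.2 * fine (pairing (nu z) eta)
         + Dx phi z * theta z.2 * fine (pairing (nu z) q)) &
      (lebesgue2 R).-integrable setT (EFin \o (fun z =>
         Dt phi z * theta z.2 * fine (pairing (nu z) eta)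
         + Dx phi z * theta z.2 * fine (pairing (nu z) q)))].
Proof.
move=> H.
have [Y Y0 [B B0 [bphi bDx bDt]]] := C1c_box phi_C1c.
have [Be Be0 hBe] := bounded_on_ball M ceta.
have [Bq Bq0 hBq] := bounded_on_ball M cq.
have [be me ce] := H _ ceta; have [bq mq cvq] := H _ cq.
have bDt' : boxed Y (B * 1) (fun z => Dt phi z * theta z.2) by apply: boxedM_bounded.
have bDx' : boxed Y (B * 1) (fun z => Dx phi z * theta z.2) by apply: boxedM_bounded.
have b1 := boxedM_bounded Be0 bDt' me (fun z => (be Be z hBe).2).
have b2 := boxedM_bounded Bq0 bDx' mq (fun z => (bq Bq z hBq).2).
split; last exact: boxed_integrable (boxedD b1 b2).
rewrite RintegralD//; first last.
- exact: boxed_integrable b2.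
- exact: boxed_integrable b1.
rewrite (_ : (fun n => _) = (fun n =>
    \int[lebesgue2 R]_z (Dt phi z * theta z.2 * E (s n) eta z) +
    \int[lebesgue2 R]_z (Dx phi z * theta z.2 * E (s n) q z))); last first.
  apply/funext => n.
  have [_ _ e1 _ _] := weighted (s n) Be0 ceta hBe bDt.
  have [_ _ e2 _ _] := weighted (s n) Bq0 cq hBq bDx.
  by rewrite RintegralD//; [exact: boxed_integrable e1|exact: boxed_integrable e2].
apply: cvgD; [apply: ce|apply: cvq].
- exact: boxed_integrable bDt'.
- exact: boxed_integrable bDx'.
Qed.

End passage_to_the_limit.

Section conservation.
Context {R : realType} {N : nat}.
Local Notation V := 'rV[R]_N.
Local Notation leb := (@lebesgue_measure R).

Lemma coord_consistent_flux p (f : V -> V) (F : R -> int -> ('I_(2 * p) -> V) -> V)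
    (b : R) k : `|b| <= 1 -> consistent_flux f F ->
  consistent_flux (fun y => b * rV_coord k (f y)) (fun dx i v => b * rV_coord k (F dx i v)).
Proof.
move=> b1 [p0 Fc Fl]; split=> // [dx i y dx0|K cK]; first by rewrite Fc.
have [c c0 hc] := Fl K cK; exists c => // dx i v dx0 Kv.
apply: le_trans (hc dx i v dx0 Kv); rewrite -mulrBr normrM.
apply: le_trans (coord_le_norm _ k); rewrite !mxE ler_piMl//.
Qed.

Lemma coord_differentiable (b : R) k (y : V) : differentiable (fun y => b * rV_coord k y) y.
Proof.
apply: differentiableM => //.
exact: differentiable_coord.
Qed.

Lemma coord_continuous_scale (b : R) k : continuous (fun y : V => b * rV_coord k y).
Proof. by move=> y; exact: differentiable_continuous (coord_differentiable b k y). Qed.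

Lemma coord_lipschitz_scale M (b : R) k : `|b| <= 1 ->
  lipschitz_on_ball M (fun y : V => b * rV_coord k y).
Proof.
move=> b1; have [L L0 hL] := coord_lipschitz_on_ball (N := N) M k.
exists L => // y z yM zM; rewrite -mulrBr normrM (le_trans _ (hL y z yM zM))//.
by rewrite ler_piMl.
Qed.

Lemma coord_balance p (F : R -> int -> ('I_(2 * p) -> V) -> V) dx a u0 u (b : R) k :
  scheme_solution F dx a u0 u ->
  {ae leb, forall t, 0 < t -> forall i,
    derive1 ((fun y => b * rV_coord k y) \o u i) t +
    dx^-1 * flux_diff (fun dx i v => b * rV_coord k (F dx i v)) dx u i t = 0}.
Proof.
move=> sol; have FF := ae_filter_ringOfSetsType leb.
apply: filterS (forward_derivable sol) => t h t0 i; have [du dE] := h t0 i.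
have dk : derivable (fun s => rV_coord k (u i s)) t 1.
  exact: ((derivable_mxP _ _ _).1 du ord0 k).
have -> : derive1 ((fun y => b * rV_coord k y) \o u i) t =
    b * derive1 (fun s => rV_coord k (u i s)) t.
  by rewrite !derive1E; exact: (deriveZ b dk).
rewrite dE /flux_diff /rV_coord !mxE; ring.
Qed.

End conservation.

Section limits.
Context {R : realType}.
Local Notation RM := (measurableTypeR R).

Lemma cvg_at_right_positive (h : nat -> R) : (forall n, 0 < h n) ->
  h @ \oo --> (0 : R) -> h @ \oo --> (0 : R)^'+.
Proof.
move=> h0 hc A hA.
have {}hc : \forall n \near \oo, 0 < h n -> A (h n) by exact: (hc _ hA).
apply: filterS hc => n hn.
exact: (hn (h0 n)).
Qed.

(** An upper limit dominates the limits along sequences. *)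
Lemma le_limf_esup_seq (F : R -> \bar R) (h : nat -> R) (l : R) :
  (forall n, 0 < h n) -> h @ \oo --> (0 : R) ->
  (forall e, 0 < e -> \forall n \near \oo, ((l - e)%:E <= F (h n))%E) ->
  (l%:E <= limf_esup F (0 : R)^'+)%E.
Proof.
move=> h0 hc hl; apply: le_ereal_inf_tmp => _ [A hA <-].
apply/lee_subgt0Pr => e e0.
have hA' : \forall n \near \oo, A (h n) by exact: (cvg_at_right_positive h0 hc hA).
have [n [An ln]] := filter_ex (filterI hA' (hl e e0)).
rewrite -EFinB; apply: le_trans ln _; apply: ereal_sup_ubound.
by exists (h n).
Qed.

Lemma half_plane_integral (G : R * R -> \bar R) (g : R * R -> R) :
  (forall z, half_plane R z -> G z = (g z)%:E) ->
  (forall z, ~ half_plane R z -> g z = 0) ->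
  (lebesgue2 R).-integrable setT (EFin \o g) ->
  (\int[lebesgue2 R]_(z in half_plane R) G z)%E = (\int[lebesgue2 R]_z g z)%:E.
Proof.
move=> Gg g0 ig.
rewrite /Rintegral fineK; last exact: (integrable_fin_num measurableT ig).
rewrite [LHS]integral_mkcond; apply: eq_integral => z _; rewrite patchE.
by case: ifPn => [/set_mem/Gg//|]; rewrite notin_setE => /g0 ->.
Qed.

Lemma measurable_half_plane : measurable (half_plane R : set (RM * RM)).
Proof.
rewrite (_ : half_plane R = setT `*` `[0, +oo[%classic).
  by apply: measurableX => //; exact: measurable_itv.
by apply/seteqP; split => z /=; rewrite in_itv/= andbT// => -[].
Qed.

End limits.

Section forward_random_fields.
Context {R : realType} {N : nat}.
Local Notation V := 'rV[R]_N.
Local Notation BV := (borel_rV R N).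
Local Notation RM := (measurableTypeR R).
Context {d' : measure_display} {Omega : measurableType d'}.

Lemma forward_fieldE (dx a : R) (u : int -> R -> V) (z : R * R) :
  half_plane R z -> forward_field dx a u z = cell_field dx a u z.
Proof. exact: forwardE. Qed.

Lemma measurable_forward_field (dx a : R) (u : Omega -> int -> R -> V) :
  random_field (half_plane R) (fun w => cell_field dx a (u w)) ->
  measurable_fun setT (fun p : Omega * (RM * RM) => forward_field dx a (u p.1) p.2 : BV).
Proof.
move=> mu.
pose G (p : Omega * (RM * RM)) : BV := cell_field dx a (u p.1) p.2.
pose g (p : Omega * (RM * RM)) : Omega * (RM * RM) := (p.1, (p.2.1, Num.max p.2.2 0)).
have mF : measurable ([set: Omega] `*` half_plane R : set (Omega * (RM * RM))).
  by apply: measurableX => //; exact: measurable_half_plane.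
have mG : measurable_fun ([set: Omega] `*` half_plane R : set (Omega * (RM * RM))) G.
  exact: mu.
have mg : measurable_fun setT g.
  apply/measurable_fun_pairP; split; first exact: measurable_fst.
  apply/measurable_fun_pairP; split.
    exact: (measurableT_comp measurable_fst measurable_snd).
  apply: measurable_maxr => //.
  exact: (measurableT_comp measurable_snd measurable_snd).
have sub : g @` setT `<=` [set: Omega] `*` half_plane R.
  by move=> _ [p _ <-]; split => //=; rewrite /half_plane/= le_max lexx orbT.
have mGg : measurable_fun setT (G \o g) by exact: measurable_comp mF sub mG mg.
apply: eq_measurable_fun mGg => p _.
by rewrite /G/g/= /forward_field /forward.
Qed.

End forward_random_fields.

Lemma cvg_extraction (s : nat -> nat) : {homo s : m n / (m < n)%N} -> s @ \oo --> \oo.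
Proof.
move=> hs; have le_s n : (n <= s n)%N.
  by elim: n => // n IH; rewrite (leq_ltn_trans IH)// hs.
by move=> A [m _ mA]; exists m => // n mn; apply: mA; rewrite /= (leq_trans mn).
Qed.

Theorem theorem4p2 (R : realType) (N : nat)
    (f : 'rV[R]_N -> 'rV[R]_N) (f_diff : forall y, differentiable f y)
    (d : measure_display) (Omega : measurableType d) (P : probability Omega R)
    (* initial data *)
    (sigma : R -> probability (borel_rV R N) R)
    (sigma_young : young_measure [set: R] sigma)
    (u0 : Omega -> R -> 'rV[R]_N)
    (u0_field : random_field [set: R] u0)
    (u0_law : law_of P [set: R] u0 sigma)
    (* the scheme: numerical flux and, for each mesh size, a grid *)
    (p : nat) (F : R -> int -> ('I_(2 * p) -> 'rV[R]_N) -> 'rV[R]_N)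
    (F_consistent : consistent_flux f F)
    (a : R -> R)
    (* approximate initial data, constant on each cell, and their laws *)
    (u0dx : R -> Omega -> R -> 'rV[R]_N)
    (u0dx_field : forall dx : R, 0 < dx -> random_field [set: R] (u0dx dx))
    (u0dx_cell : forall (dx : R) w i x, 0 < dx -> cell dx (a dx) i x ->
      u0dx dx w x = u0dx dx w (midpoint dx (a dx) i))
    (sigmadx : R -> R -> probability (borel_rV R N) R)
    (u0dx_law : forall dx : R, 0 < dx -> law_of P [set: R] (u0dx dx) (sigmadx dx))
    (* computed solutions and their laws *)
    (u : R -> Omega -> int -> R -> 'rV[R]_N)
    (u_scheme : forall (dx : R) w, 0 < dx ->
      scheme_solution F dx (a dx) (u0dx dx w) (u dx w))
    (u_field : forall dx : R, 0 < dx ->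
      random_field (half_plane R) (fun w => cell_field dx (a dx) (u dx w)))
    (nudx : R -> R * R -> probability (borel_rV R N) R)
    (u_law : forall dx : R, 0 < dx ->
      law_of P (half_plane R) (fun w => cell_field dx (a dx) (u dx w)) (nudx dx))
    (* (a) *)
    (C : R)
    (u_bounded : forall (dx : R) w, 0 < dx ->
      {ae lebesgue2 R, forall z, half_plane R z ->
         `|cell_field dx (a dx) (u dx w) z| <= C})
    (* (b) *)
    (r : R) (r_ge1 : 1 <= r)
    (weak_BV : forall w (T : R), 0 < T ->
      (fun dx => \int[lebesgue_measure]_(t in `[0%R, T])
         \esum_(i in [set: int])
           ((`|u dx w (i + 1) t - u dx w i t| `^ r) * dx)%R%:E)%E @ (0 : R)^'+ --> 0%E)
    (* (c) *)
    (E : set (('rV[R]_N -> R) * ('rV[R]_N -> R)))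
    (E_entropy : E `<=` entropy_pairs f)
    (entropy_stable : forall eta q, E (eta, q) ->
      exists (m : nat) (Q : R -> int -> ('I_(2 * m) -> 'rV[R]_N) -> R),
        consistent_flux q Q /\
        forall (dx : R) w, 0 < dx -> discrete_entropy_inequality eta Q dx (u dx w))
    (* (d) *)
    (init_mean : forall (psi : R -> R) (k : 'I_N), C1c psi ->
      (fun dx => \int[lebesgue_measure]_x
         ((psi x)%:E * pairing (sigmadx dx x) (rV_coord k)))%E @ (0 : R)^'+ -->
      (\int[lebesgue_measure]_x ((psi x)%:E * pairing (sigma x) (rV_coord k)))%E)
    (init_entropy : forall eta q, E (eta, q) ->
      forall psi : R -> R, C1c psi -> (forall x, 0 <= psi x) ->
      (limf_esup (fun dx => \int[lebesgue_measure]_x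
         ((psi x)%:E * pairing (sigmadx dx x) eta)) (0 : R)%R^'+ <=
       \int[lebesgue_measure]_x ((psi x)%:E * pairing (sigma x) eta))%E) :
  forall dxs : nat -> R, (forall n, 0 < dxs n) -> dxs @ \oo --> (0 : R) ->
  exists (s : nat -> nat) (nu : R * R -> probability (borel_rV R N) R),
    [/\ {homo s : m n / (m < n)%N},
        young_measure (half_plane R) nu,
        weak_star_cvg (lebesgue2 R) (half_plane R)
          (fun n => nudx (dxs (s n))) nu &
        emv_solution E f sigma nu].
Proof.
move=> dxs dxs_gt0 dxs_cvg.
have dxs_right := cvg_at_right_positive dxs_gt0 dxs_cvg.
have cf : continuous f by move=> y; exact: differentiable_continuous.
pose M := `|C|.
have M0 : 0 <= M by exact: normr_ge0.
pose U n w := u (dxs n) w.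
have sol n w : scheme_solution F (dxs n) (a (dxs n)) (u0dx (dxs n) w) (U n w).
  exact: u_scheme.
have UM n w i t : 0 <= t -> `|U n w i t| <= M.
  exact: (grid_bounded (dxs_gt0 n) (sol n w) i (u_bounded _ w (dxs_gt0 n))).
pose X n w (z : R * R) := forward_field (dxs n) (a (dxs n)) (U n w) z.
have XM n w z : `|X n w z| <= M by exact: (forward_le (UM n w)).
have mX n : measurable_fun setT
    (fun p : Omega * (measurableTypeR R * measurableTypeR R) => X n p.1 p.2 : borel_rV R N).
  exact: (measurable_forward_field (u_field _ (dxs_gt0 n))).
pose E' n (g : 'rV[R]_N -> R) z := \int[P]_w g (X n w z).
have [||||||s [nu [s_homo H]]] := @young_compactness R N _ _ (@plane_measure R)
  (@gaussian_weight R) (@rational_quadrant R) _ _ _ _ (norm_ball M) M 0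
  (@norm_ball_closed R N M) _ _ _ _ P X mX XM.
- exact: gaussian_weight_gt0.
- exact: integrable_gaussian_weight.
- exact: measurable_rational_quadrant.
- exact: rational_quadrant_setI_closed.
- by [].
- by rewrite /norm_ball/= normr0.
have H' g : continuous g ->
    [/\ forall B z, (forall y, `|y| <= M -> `|g y| <= B) ->
          (nu z).-integrable setT ((EFin \o g) : borel_rV R N -> \bar R) /\
          `|fine (pairing (nu z) g)| <= B,
        measurable_fun setT ((fun z => fine (pairing (nu z) g)) :
          measurableTypeR R * measurableTypeR R -> measurableTypeR R) &
        forall psi : R * R -> R, (lebesgue2 R).-integrable setT (EFin \o psi) ->
        (fun n => \int[lebesgue2 R]_z (psi z * E' (s n) g z)) @ \oo -->
        \int[lebesgue2 R]_z (psi z * fine (pairing (nu z) g))].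
  by move=> cg; exact: (H g cg).
have pairE g z : continuous g -> pairing (nu z) g = (fine (pairing (nu z) g))%:E.
  move=> cg; have [B _ hB] := bounded_on_ball M cg; have [/(_ B z hB)[ig _] _ _] := H' g cg.
  by rewrite fineK//; exact: (integrable_fin_num measurableT ig).
have mXz n z : measurable_fun setT ((fun w => X n w z) : Omega -> borel_rV R N).
  exact: (measurableT_comp (mX n) (pair2_measurable z)).
have lawE n g z : continuous g -> half_plane R z -> pairing (nudx (dxs n) z) g = (E' n g z)%:E.
  move=> cg hz; have [B _ hB] := bounded_on_ball M cg.
  apply: (pairing_law (mXz n z) _ cg (fun w => hB _ (XM n w z))) => A mA.
  rewrite (u_law (dxs n) (dxs_gt0 n) z hz A mA).
  congr (P _); apply/seteqP; split => w; rewrite /X /= forward_fieldE//.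
have initE n w x : u0dx (dxs n) w x = X n w (x, 0).
  rewrite /X /forward_field /= forwardE// (sol n w).1.
  by apply: u0dx_cell => //; apply/cell_indexP.
have law0E n g x : continuous g -> pairing (sigmadx (dxs n) x) g = (E' n g (x, 0%R))%:E.
  move=> cg; have [B _ hB] := bounded_on_ball M cg.
  apply: (pairing_law (mXz n (x, 0)) _ cg (fun w => hB _ (XM n w (x, 0)))) => A mA.
  rewrite (u0dx_law (dxs n) (dxs_gt0 n) x I A mA).
  by congr (P _); apply/seteqP; split => w; rewrite /= initE.
have bv w T : 0 < T -> (fun n => \int[lebesgue_measure]_(t in `[0%R, T])
    \esum_(i in [set: int]) ((`|U n w (i + 1) t - U n w i t| `^ r) * dxs n)%R%:E)%E
    @ \oo --> 0%E.
  by move=> T0; apply: (cvg_comp _ _ dxs_right (weak_BV w T T0)).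
have s_cvg := cvg_extraction s_homo.
pose A (phi : R * R -> R) (eta q : 'rV[R]_N -> R) (n : nat) : R := \int[lebesgue2 R]_z (Dt phi z * nonneg_time z.2 * E' n eta z
  + Dx phi z * nonneg_time z.2 * E' n q z).
pose J (phi : R * R -> R) (eta : 'rV[R]_N -> R) (n : nat) : R := \int[lebesgue_measure]_x (phi (x, 0) * E' n eta (x, 0)).
pose L (phi : R * R -> R) (eta q : 'rV[R]_N -> R) : R := \int[lebesgue2 R]_z (Dt phi z * nonneg_time z.2 * fine (pairing (nu z) eta)
  + Dx phi z * nonneg_time z.2 * fine (pairing (nu z) q)).
have Alim phi eta q : C1c phi -> continuous eta -> continuous q ->
    (fun n => A phi eta q (s n)) @ \oo --> L phi eta q.
  by move=> c1 ce cq; have [] := weak_form_limit XM mX c1 ce cq H'.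
have LE phi eta q : C1c phi -> continuous eta -> continuous q ->
    (\int[lebesgue2 R]_(z in half_plane R) ((Dt phi z)%:E * pairing (nu z) eta
      + (Dx phi z)%:E * pairing (nu z) q))%E = (L phi eta q)%:E.
  move=> c1 ce cq; have [_ iL] := weak_form_limit XM mX c1 ce cq H'.
  apply: half_plane_integral iL => z hz.
    rewrite (pairE eta)// (pairE q)// -!EFinM -EFinD nonneg_timeE.
    by move: hz; rewrite /half_plane/= => ->; rewrite !mulr1.
  have -> : nonneg_time z.2 = 0 by rewrite nonneg_timeE; move/negP/negbTE: hz => ->.
  by rewrite !mulr0 !mul0r addr0.
have JE (phi : R * R -> R) eta n : C1c phi -> continuous eta ->
    (\int[lebesgue_measure]_x ((phi (x, 0%R))%:E * pairing (sigmadx (dxs n) x) eta))%E =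
    (J phi eta n)%:E.
  move=> c1 ce; have [B hB] := expected_weak_form P XM mX c1 ce ce.
  have [_ _ _ iJ _] := hB n.
  rewrite /J /Rintegral fineK; last exact: (integrable_fin_num measurableT iJ).
  by apply: eq_integral => x _; rewrite law0E// -EFinM.
(* Expectations of the pathwise inequalities. *)
have lower phi eta q : C1c phi -> continuous eta -> continuous q ->
    (forall w, exists2 e : nat -> R, e @ \oo --> (0 : R) &
      forall n, dxs n <= 1 -> - e n <= weak_form phi eta q (X n w)) ->
    exists2 e : nat -> R, e @ \oo --> (0 : R) & forall n, - e n <= A phi eta q n + J phi eta n.
  move=> c1 ce cq he; have [B hB] := expected_weak_form P XM mX c1 ce cq.
  have mS n : measurable_fun setT (fun w => weak_form phi eta q (X n w)) by have [] := hB n.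
  have bS n w : `|weak_form phi eta q (X n w)| <= B by have [] := hB n.
  have [e e0 eS] := expectation_lower_bound P dxs_cvg mS bS he.
  by exists e => // n; have [_ _ _ _ <-] := hB n; exact: eS.
exists s, nu; split.
- exact: s_homo.
- move=> g [cg _]; have [_ mg _] := H' g cg.
  apply: (@eq_measurable_fun _ _ _ _ _ (fun z => (fine (pairing (nu z) g))%:E)).
    by move=> z _; rewrite -pairE.
  by apply: measurable_funTS; exact/measurable_EFinP.
- move=> psi g ipsi [cg _]; have [B B0 hB] := bounded_on_ball M cg.
  have [bg mg cvg_g] := H' g cg.
  pose psi' := psi \_ (half_plane R).
  have ipsi' : (lebesgue2 R).-integrable setT (EFin \o psi').
    by rewrite /psi' -restrict_EFin; apply/(integrable_mkcond _ measurable_half_plane).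
  have psi'E z : half_plane R z -> psi' z = psi z by move=> hz; rewrite /psi' patchE mem_set.
  have psi'0 z : ~ half_plane R z -> psi' z = 0 by move=> hz; rewrite /psi' patchE memNset.
  rewrite (half_plane_integral (g := fun z => psi' z * fine (pairing (nu z) g))); first last.
  + apply: (integrable_mul_bounded (B := B)) => // z; exact: (bg B z hB).2.
  + by move=> z hz; rewrite psi'0// mul0r.
  + by move=> z hz; rewrite psi'E// (pairE g)// EFinM.
  rewrite (_ : (fun n => _) = (fun n => (\int[lebesgue2 R]_z (psi' z * E' (s n) g z))%:E)).
    by apply/cvg_EFin; [exact: nearW|exact: cvg_g].
  apply/funext => n; apply: half_plane_integral.
  + by move=> z hz; rewrite psi'E// lawE// EFinM.
  + by move=> z hz; rewrite psi'0// mul0r.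
  have mgX : measurable_fun setT
      (fun p : Omega * (measurableTypeR R * measurableTypeR R) => g (X (s n) p.1 p.2)).
    exact: (measurableT_comp (measurable_continuous_rV cg) (mX (s n))).
  have gXB w z : `|g (X (s n) w z)| <= B by exact: hB.
  apply: (integrable_mul_bounded (B := B)) => //.
    exact: (measurable_expectation P mgX gXB).
  move=> z; apply: norm_expectation_le => //.
  exact: (measurableT_comp mgX (pair2_measurable z)).
split.
- move=> phi k c1.
  pose l (b : R) (y : 'rV[R]_N) := b * rV_coord k y.
  have path (b : R) w : `|b| <= 1 -> exists2 e : nat -> R, e @ \oo --> (0 : R) &
      forall n, dxs n <= 1 -> - e n <= weak_form phi (l b) (l b \o f) (X n w).
    move=> b1; apply: (asymptotic_inequality cf F_consistent M0 r_ge1 dxs_gt0 dxs_cvg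
      (fun n => sol n w) (fun n => UM n w) (bv w) c1 (coord_differentiable b k) _
      (coord_lipschitz_scale M k b1) (coord_consistent_flux k b1 F_consistent)).
      by move=> y; apply: (@continuous_comp _ _ _ f (l b)); [exact: cf|exact: coord_continuous_scale].
    move=> n; have FF := ae_filter_ringOfSetsType (@lebesgue_measure R).
    apply: filterS (coord_balance b k (sol n w)) => t ht t0 i x.
    by rewrite ht// mulr0.
  have ceta : continuous (rV_coord k : 'rV[R]_N -> R).
    by have := @coord_continuous_scale R N 1 k; under eq_fun do rewrite mul1r.
  have cq : continuous (fun y => rV_coord k (f y)).
    by move=> y; apply: (@continuous_comp _ _ _ f (rV_coord k)); [exact: cf|exact: ceta].
  have l1 : l 1 = rV_coord k by apply/funext => y; rewrite /l mul1r.
  have lN1 : l (-1) = (fun y => - rV_coord k y) by apply/funext => y; rewrite /l mulN1r.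
  have path1 w : exists2 e : nat -> R, e @ \oo --> (0 : R) & forall n, dxs n <= 1 ->
      - e n <= weak_form phi (rV_coord k) (fun y => rV_coord k (f y)) (X n w).
    by have := path 1 w; rewrite l1 normr1; apply.
  have pathN1 w : exists2 e : nat -> R, e @ \oo --> (0 : R) & forall n, dxs n <= 1 ->
      - e n <= - weak_form phi (rV_coord k) (fun y => rV_coord k (f y)) (X n w).
    have := path (-1) w; rewrite lN1 normrN1 => /(_ (lexx _))[e e0 he].
    have [B hB] := expected_weak_form P XM mX c1 ceta cq.
    by exists e => // n n1; have [_ _ <- _ _] := hB n; exact: he.
  have [e1 e10 h1] := lower phi _ _ c1 ceta cq path1.
  have [e2 e20 h2] : exists2 e : nat -> R, e @ \oo --> (0 : R) & forall n,
      - e n <= - (A phi (rV_coord k) (fun y => rV_coord k (f y)) n + J phi (rV_coord k) n).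
    have [B hB] := expected_weak_form P XM mX c1 ceta cq.
    pose S n w := weak_form phi (rV_coord k) (fun y => rV_coord k (f y)) (X n w).
    have mS n : measurable_fun setT (S n) by have [] := hB n.
    have bS n w : `|S n w| <= B by have [_ h _ _ _] := hB n; exact: h.
    have bSN n w : `|- S n w| <= B by rewrite normrN.
    have [e e0 eS] := expectation_lower_bound P dxs_cvg
      (fun n => measurable_funN (mS n)) bSN pathN1.
    exists e => // n; have [_ _ _ _ <-] := hB n.
    rewrite -[leRHS]mulN1r -RintegralZl//; last exact: integrable_bounded_expectation (mS n) (bS n).
    apply: le_trans (eS n) _.
    by under [leRHS]eq_Rintegral do rewrite mulN1r.
  have AJ0 : (fun n => A phi (rV_coord k) (fun y => rV_coord k (f y)) (s n)
      + J phi (rV_coord k) (s n)) @ \oo --> (0 : R).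
    apply: (@squeeze_cvgr _ _ _ _ (fun n => - e1 (s n)) (fun n => e2 (s n))).
    + by apply: nearW => n; rewrite h1 -lerN2 h2.
    + by rewrite -oppr0; apply: cvgN; exact: (cvg_comp _ _ s_cvg e10).
    + exact: (cvg_comp _ _ s_cvg e20).
  have JL : (fun n => J phi (rV_coord k) (s n)) @ \oo -->
      - L phi (rV_coord k) (fun y => rV_coord k (f y)).
    rewrite -sub0r (_ : (fun n => _) = (fun n =>
      (A phi (rV_coord k) (fun y => rV_coord k (f y)) (s n) + J phi (rV_coord k) (s n))
      - A phi (rV_coord k) (fun y => rV_coord k (f y)) (s n))).
      exact: cvgB AJ0 (Alim phi _ _ c1 ceta cq).
    by apply/funext => n; rewrite addrAC subrr add0r.
  have sJ : (fun n => (J phi (rV_coord k) (s n))%:E) @ \oo -->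
      (\int[lebesgue_measure]_x ((phi (x, 0%R))%:E * pairing (sigma x) (rV_coord k)))%E.
    rewrite (_ : (fun n => _) = (fun n => \int[lebesgue_measure]_x
      ((phi (x, 0%R))%:E * pairing (sigmadx (dxs (s n)) x) (rV_coord k)))%E).
      exact: (cvg_comp _ _ (cvg_comp _ _ s_cvg dxs_right) (init_mean _ k (C1c_initial c1))).
    by apply/funext => n; rewrite JE.
  have sL : (fun n => (J phi (rV_coord k) (s n))%:E) @ \oo -->
      (- L phi (rV_coord k) (fun y => rV_coord k (f y)))%:E.
    by apply/cvg_EFin; [exact: nearW|exact: JL].
  rewrite LE// (cvg_unique _ sJ sL)// -EFinD subrr//.
move=> eta q Eeq phi c1 phi0.
have [/= cvx deta dq _] := E_entropy _ Eeq.
have ceta : continuous eta by move=> y; exact: differentiable_continuous.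
have cq : continuous q by move=> y; exact: differentiable_continuous.
have [m [Q [Qq DE]]] := entropy_stable _ _ Eeq.
have path w : exists2 e : nat -> R, e @ \oo --> (0 : R) &
    forall n, dxs n <= 1 -> - e n <= weak_form phi eta q (X n w).
  apply: (asymptotic_inequality cf F_consistent M0 r_ge1 dxs_gt0 dxs_cvg
    (fun n => sol n w) (fun n => UM n w) (bv w) c1 deta cq
    (convex_lipschitz_on_ball M cvx ceta) Qq).
  move=> n; have FF := ae_filter_ringOfSetsType (@lebesgue_measure R).
  apply: filterS (forward_entropy_derivable (sol n w) deta) => t ht t0 i x.
  have [dt _] := ht t0 i.
  rewrite mulr_ge0_le0//; first by apply: phi0; exact: ltW.
  exact: (DE (dxs n) w (dxs_gt0 n) i t t0 dt).
have [e e0 eAJ] := lower phi eta q c1 ceta cq path.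
have limJ : ((- L phi eta q)%:E <=
    \int[lebesgue_measure]_x ((phi (x, 0%R))%:E * pairing (sigma x) eta))%E.
  apply: le_trans (init_entropy _ _ Eeq _ (C1c_initial c1) (fun x => phi0 (x, 0) (lexx _))).
  apply: (le_limf_esup_seq (h := dxs \o s)) => [n||eps eps0].
  + exact: dxs_gt0.
  + exact: (cvg_comp _ _ s_cvg dxs_cvg).
  have eps2 : 0 < eps / 2 by rewrite divr_gt0.
  have nearA : \forall n \near \oo, A phi eta q (s n) < L phi eta q + eps / 2.
    by apply: (cvgr_lt _ (Alim phi eta q c1 ceta cq)); rewrite ltrDl.
  have neare : \forall n \near \oo, e (s n) < eps / 2.
    exact: (cvgr_lt _ (cvg_comp _ _ s_cvg e0) _ eps2).
  apply: filterS2 nearA neare => n An en; rewrite /= JE// lee_fin.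
  by have := eAJ (s n); lra.
rewrite LE//.
have := leeD2l (L phi eta q)%:E limJ.
by rewrite -EFinD subrr.
Qed.
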